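(* Let $\mathcal{Q},\mathcal{U},\mathbf{g},\pi,\Delta,\Gamma$ be as in the context, with the transversality condition $\Delta_{\mathbf q}+\Gamma_{\mathbf q}=T_{\mathbf q}\mathcal{Q}$ for all $\mathbf q\in\mathcal{Q}$. The following conditions are equivalent: (1) If $F\equiv 0$, then for every $C^1$ control $u(\cdot)$ (defined on a time interval $\mathcal I$) and every solution $q(\cdot)$ of the control differential equation (on $\mathcal{Q}$) $\dot q=h(\dot u)$, the map $t\mapsto (q(t),p(t))\doteq\big(q(t),k(\dot u(t))\big)$ is a solution of the system (Ham) written in the context. In particular, $p_I(t)=0$ and hence $\dot q_I(t)=0$ for all $t\in\mathcal I$. (2) For every ($\Delta$-adapted) local chart $(q)$, the vector-valued quadratic form $\Psi$ vanishes identically. (3) For every ($\Delta$-adapted) local chart $(q)$, the vector-valued quadratic form $v\mapsto\theta_I[v,v]$ vanishes on the subspace $P^*_{III}(\mathbb{R}^{N+M})$ (at every point $q$ of the chart). (4) The sub-bundle $(T\mathcal{Q})_{III}=\Gamma\cap(\Gamma\cap\Delta)^\perp$ is $\Gamma$-inertially invariant.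
   Context: Setting. $N,M,\nu$ are positive integers. $\mathcal{Q}$ is a smooth manifold of dimension $N+M$ with a smooth Riemannian metric $\mathbf g$ (kinetic metric); the kinetic energy is $\mathcal T(\mathbf q,\mathbf v)=\frac12\mathbf g_{\mathbf q}[\mathbf v,\mathbf v]$. $\mathcal{U}$ is a smooth $M$-dimensional manifold (control manifold), $\pi:\mathcal{Q}\to\mathcal{U}$ is a smooth submersion, and $\Delta_{\mathbf q}=\ker T_{\mathbf q}\pi$ (rank $N$). $\Gamma\subset T\mathcal{Q}$ is a smooth distribution (vector sub-bundle, not necessarily integrable) of rank $N+M-\nu$. Transversality $\Delta_{\mathbf q}+\Gamma_{\mathbf q}=T_{\mathbf q}\mathcal{Q}$ is assumed at all points (so $\nu\le N$). $\perp$ denotes $\mathbf g$-orthogonal complement. For a subspace $W\subset T_{\mathbf q}\mathcal{Q}$, $\ker W\subset T^*_{\mathbf q}\mathcal{Q}$ denotes its annihilator. $\mathbf g_{\mathbf q}(\mathbf v)$ also denotes the covector $\mathbf w\mapsto\mathbf g_{\mathbf q}[\mathbf v,\mathbf w]$, so that $\mathbf g_{\mathbf q}:T_{\mathbf q}\mathcal{Q}\to T^*_{\mathbf q}\mathcal{Q}$ is an isomorphism with inverse $\mathbf g^{-1}_{\mathbf q}$, and $\mathbf g^{-1}_{\mathbf q}[\mathbf p,\tilde{\mathbf p}]=\mathbf g_{\mathbf q}[\mathbf g_{\mathbf q}^{-1}(\mathbf p),\mathbf g_{\mathbf q}^{-1}(\tilde{\mathbf p})]$ is the dual scalar product. The Hamiltonian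 is $H(q,p)=\frac12 g^{-1}_q[p,p]$. Decomposition. $(T_{\mathbf q}\mathcal{Q})_I=\Delta_{\mathbf q}\cap\Gamma_{\mathbf q}$, $(T_{\mathbf q}\mathcal{Q})_{II}=\Gamma_{\mathbf q}^\perp$, $(T_{\mathbf q}\mathcal{Q})_{III}=(\Delta_{\mathbf q}\cap\Gamma_{\mathbf q})^\perp\cap\Gamma_{\mathbf q}$; these are mutually orthogonal with direct sum $T_{\mathbf q}\mathcal{Q}$. For $J\in\{I,II,III\}$, $P_J$ is the orthogonal projection onto $(T_{\mathbf q}\mathcal{Q})_J$, $(T^*_{\mathbf q}\mathcal{Q})_J=\mathbf g_{\mathbf q}((T_{\mathbf q}\mathcal{Q})_J)$, and $P_J^*=\mathbf g\circ P_J\circ\mathbf g^{-1}$ is the orthogonal projection onto $(T^*_{\mathbf q}\mathcal{Q})_J$. Write $\dot q_J=P_J(\dot q)$, $p_J=P_J^*(p)$. Maps $h,k$. The differential $D\pi$ restricted to $(T_{\mathbf q}\mathcal{Q})_{III}$ is a bijection onto $T_{\pi(\mathbf q)}\mathcal{U}$; its inverse is $h=h_{\mathbf q}:T_{\pi(\mathbf q)}\mathcal{U}\to(T_{\mathbf q}\mathcal{Q})_{III}$, and $k(\mathbf v)=\mathbf g_{\mathbf q}(h(\mathbf v))$. In the equation $\dot q=h(\dot u)$ one has $\dot u(t)\in T_{u(t)}\mathcal{U}$, so a solution satisfies $\pi(q(t))=u(t)$ and $\dot q(t)=h_{q(t)}(\dot u(t))$. Charts. $\Delta$-adapted local charts $(q^1,\dots,q^{N+M})$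 on $\mathcal{Q}$ and $(u^1,\dots,u^M)$ on $\mathcal{U}$ are such that $\pi$ is given by $u^\alpha=q^{N+\alpha}$, $\alpha=1,\dots,M$. In such a chart, with the corresponding natural coordinates $(q,p)$ on $T^*\mathcal{Q}$, and viewing $P_J^*$ and $g^{-1}$ as $q$-dependent matrices, define the $\mathbb{R}^{N+M}$-valued bilinear map $$\theta_I[p,\tilde p]=\Big(\frac{\partial P_I^*}{\partial q}\cdot g^{-1}(p)\Big)(\tilde p)-\frac12P_I^*\Big(\frac{\partial g^{-1}}{\partial q}[p,\tilde p]\Big),$$ where $\frac{\partial P_I^*}{\partial q}\cdot w$ is the derivative of the matrix $P_I^*$ in the direction $w$, and $\frac{\partial g^{-1}}{\partial q}[p,\tilde p]$ is the covector with components $\frac{\partial g^{r,s}}{\partial q^i}p_r\tilde p_s$. Set $\Psi[w,w]=\theta_I[k(w),k(w)]$ for $w\in\mathbb{R}^M$ (at each $q$). System (Ham), with external force $F=F(t,q,p)$, control $u(\cdot)$ and reaction $R(t)\in T^*_{q(t)}\mathcal{Q}$ (a solution is a pair $(q,p)$ for which such an $R$ exists), in adapted charts: $$\dot q=\frac{\partial H}{\partial p}(q,p),\quad \dot p=-\frac{\partial H}{\partial q}(q,p)+F(t,q,p)+R(t),\quad \pi(q(t))=u(t),\quad p(t)\in g_{q(t)}(\Gamma_{q(t)}),\quad R(t)\in\ker\Delta_{q(t)}+\ker\Gamma_{q(t)}.$$ $\Gamma$-constrained inertial motion: a $C^2$ map $q:\mathcal I\to\mathcal{Q}$ ($\mathcal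 I$ a time interval) which in any coordinates satisfies $\frac{d}{dt}\frac{\partial\mathcal T}{\partial\dot q}-\frac{\partial\mathcal T}{\partial q}\in\ker\Gamma_{q(t)}$ and $\dot q(t)\in\Gamma_{q(t)}$. A set $S\subseteq T\mathcal{Q}$ is $\Gamma$-inertially invariant if for every $\Gamma$-constrained inertial motion $q:\mathcal I\to\mathcal{Q}$ with $(q,\dot q)(t_0)\in S$ for some $t_0\in\mathcal I$ one has $(q,\dot q)(t)\in S$ for all $t\in\mathcal I$.
   Formalization: In (1), since p = k(u') is in general only continuous for a C^1 control u, the momentum equation of (Ham) and its reaction R are understood in the sense of distributions, and pointwise at every time where p is differentiable. *)

(* Defs.v *)
From HB Require Import structures.
From mathcomp Require Import all_boot all_order all_algebra.
From mathcomp Require Import all_classical all_reals all_analysis.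

Set Implicit Arguments.
Unset Strict Implicit.
Unset Printing Implicit Defensive.

Import Order.TTheory GRing.Theory Num.Theory.
Import numFieldNormedType.Exports.

Local Open Scope classical_set_scope.
Local Open Scope ring_scope.

(* Vectors and covectors are row vectors, and linear maps act by right
   multiplication: the covector p pairs with the vector v as p *m v^T, a
   metric with Gram matrix g sends v to the covector v *m g, and a subspace is
   the row space of a matrix, so that the annihilator of W is kermx W^T. *)

(* D is meant to be open. *)
Fixpoint Ck (R : realType) (V W : normedModType R) (k : nat) (D : set V)
    (f : V -> W) : Prop :=
  if k is j.+1 then
    (forall x, D x -> differentiable f x) /\
    (forall v : V, Ck j D (fun x => 'D_v f x))
  else forall x, D x -> {for x, continuous f}.

Definition smooth_on (R : realType) (V W : normedModType R) (D : set V)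
    (f : V -> W) : Prop :=
  forall k, Ck k D f.

Definition grad (R : realType) (n : nat) (f : 'rV[R]_n -> R) (x : 'rV[R]_n) :
    'rV[R]_n :=
  \row_i 'D_(delta_mx 0 i) f x.

Definition time_interval (R : realType) (I : set R) : Prop :=
  is_interval I /\ (exists a b, [/\ I a, I b & a < b]).

(* Derivatives along I: two-sided at interior points and one-sided at the end
   points that belong to I. *)
Definition diff_quot (R : realType) (V : normedModType R) (f : R -> V)
    (t s : R) : V :=
  (s - t)^-1 *: (f s - f t).

Definition derivable_in (R : realType) (V : normedModType R) (I : set R)
    (f : R -> V) (t : R) : Prop :=
  cvg (diff_quot f t s @[s --> within I t^']).

Definition deriv_in (R : realType) (V : normedModType R) (I : set R)
    (f : R -> V) (t : R) : V :=
  lim (diff_quot f t s @[s --> within I t^']).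

Definition cont_in (R : realType) (T : topologicalType) (I : set R)
    (f : R -> T) (t : R) : Prop :=
  f s @[s --> within I (nbhs t)] --> f t.

Record chart (R : realType) (n : nat) (T : topologicalType) := Chart {
  cdom : set T;
  cmap : T -> 'rV[R]_n;
  cinv : 'rV[R]_n -> T;
  cdom_open : open cdom;
  cimg_open : open (cmap @` cdom);
  cmapK : forall q, cdom q -> cinv (cmap q) = q;
  cmap_cont : forall q, cdom q -> {for q, continuous cmap};
  cinv_cont : forall x, (cmap @` cdom) x -> {for x, continuous cinv}
}.

Definition cimg (R : realType) (n : nat) (T : topologicalType)
    (c : chart R n T) : set 'rV[R]_n :=
  cmap c @` cdom c.

Definition smooth_transition (R : realType) (n : nat) (T : topologicalType)
    (c c' : chart R n T) : Prop :=
  smooth_on (cmap c @` (cdom c `&` cdom c')) (cmap c' \o cinv c).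

(* The atlas is maximal, so "for every local chart" is quantification over it.
   The distinguished chart chart_at q around q serves only to represent the
   tangent space at q: see frame. *)
Record manifold (R : realType) (n : nat) := Manifold {
  carrier :> topologicalType;
  carrier_hausdorff : hausdorff_space carrier;
  carrier_second_countable : @second_countable carrier;
  atlas : set (chart R n carrier);
  atlas_compat : forall c c', atlas c -> atlas c' -> smooth_transition c c';
  atlas_maximal : forall c,
    (forall c', atlas c' -> smooth_transition c c' /\ smooth_transition c' c) ->
    atlas c;
  chart_at : carrier -> chart R n carrier;
  chart_at_atlas : forall q, atlas (chart_at q);
  chart_at_dom : forall q, cdom (chart_at q) q
}.

(* A tangent vector (resp. covector) at q is represented by its coordinates in
   the chart chart_at q, so that T_q Q and T^*_q Q are both 'rV[R]_n. The rows
   of frame c q are the coordinate vectors d/dx^i of the chart c at q. Thus the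
   vector with c-coordinates w is w *m frame c q, and the covector p has
   c-coordinates p *m (frame c q)^T. *)
Definition frame (R : realType) (n : nat) (Q : manifold R n)
    (c : chart R n Q) (q : Q) : 'M[R]_n :=
  'J (cmap (chart_at q) \o cinv c) (cmap c q).

Definition smooth_map (R : realType) (n m : nat) (Q : manifold R n)
    (U : manifold R m) (f : Q -> U) : Prop :=
  continuous f /\
  forall c d, atlas c -> atlas d ->
    smooth_on (cmap c @` (cdom c `&` f @^-1` cdom d)) (cmap d \o f \o cinv c).

Definition tangent_map (R : realType) (n m : nat) (Q : manifold R n)
    (U : manifold R m) (f : Q -> U) (q : Q) : 'M[R]_(n, m) :=
  'J (cmap (chart_at (f q)) \o f \o cinv (chart_at q)) (cmap (chart_at q) q).

Definition submersion (R : realType) (n m : nat) (Q : manifold R n)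
    (U : manifold R m) (f : Q -> U) : Prop :=
  smooth_map f /\ (forall q, row_full (tangent_map f q)).

(* f in the charts c and d, differentiated at the point with c-coordinates x *)
Definition loc_tangent_map (R : realType) (n m : nat) (Q : manifold R n)
    (U : manifold R m) (f : Q -> U) (c : chart R n Q) (d : chart R m U)
    (x : 'rV[R]_n) : 'M[R]_(n, m) :=
  'J (cmap d \o f \o cinv c) x.

(* Gram matrix of the coordinate vectors of c, as a function of c-coordinates *)
Definition loc_metric (R : realType) (n : nat) (Q : manifold R n)
    (g : Q -> 'M[R]_n) (c : chart R n Q) (x : 'rV[R]_n) : 'M[R]_n :=
  let A := frame c (cinv c x) in A *m g (cinv c x) *m A^T.

Definition riemannian_metric (R : realType) (n : nat) (Q : manifold R n)
    (g : Q -> 'M[R]_n) : Prop :=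
  [/\ forall q, (g q)^T = g q,
      forall q (v : 'rV[R]_n), v != 0 -> 0 < (v *m g q *m v^T) 0 0
    & forall c, atlas c -> smooth_on (cimg c) (loc_metric g c)].

Definition loc_distribution (R : realType) (n : nat) (Q : manifold R n)
    (G : Q -> 'M[R]_n) (c : chart R n Q) (x : 'rV[R]_n) : 'M[R]_n :=
  G (cinv c x) *m invmx (frame c (cinv c x)).

(* The fibre at q is the row space of G q. Only this row space matters, so
   smoothness is the existence of smooth local frames. *)
Definition smooth_distribution (R : realType) (n : nat) (Q : manifold R n)
    (r : nat) (G : Q -> 'M[R]_n) : Prop :=
  (forall q, \rank (G q) = r) /\
  (forall c x, atlas c -> cimg c x ->
     exists (O : set 'rV[R]_n) (E : 'rV[R]_n -> 'M[R]_(r, n)),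
       [/\ open O, O x, O `<=` cimg c, smooth_on O E
         & forall y, O y -> (E y :=: loc_distribution G c y)%MS]).

(* g is the Gram matrix of the scalar product, Dp the matrix of the tangent map
   of the projection pi (so Delta = kermx Dp) and G spans Gamma; all three are
   expressed in the same coordinates. *)

Definition perp (R : realType) (n : nat) (g W : 'M[R]_n) : 'M[R]_n :=
  kermx (g *m W^T).

Definition space_I (R : realType) (n m : nat) (Dp : 'M[R]_(n, m))
    (G : 'M[R]_n) : 'M[R]_n :=
  (kermx Dp :&: G)%MS.

Definition space_III (R : realType) (n m : nat) (g : 'M[R]_n)
    (Dp : 'M[R]_(n, m)) (G : 'M[R]_n) : 'M[R]_n :=
  (perp g (space_I Dp G) :&: G)%MS.

Definition orth_proj (R : realType) (n : nat) (g W : 'M[R]_n) : 'M[R]_n :=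
  proj_mx W (perp g W).

(* p |-> g (P (g^-1 p)) for covectors p *)
Definition dual_proj (R : realType) (n : nat) (g P : 'M[R]_n) : 'M[R]_n :=
  invmx g *m P *m g.

Definition P_I (R : realType) (n m : nat) (g : 'M[R]_n) (Dp : 'M[R]_(n, m))
    (G : 'M[R]_n) : 'M[R]_n :=
  orth_proj g (space_I Dp G).

Definition Pstar_I (R : realType) (n m : nat) (g : 'M[R]_n)
    (Dp : 'M[R]_(n, m)) (G : 'M[R]_n) : 'M[R]_n :=
  dual_proj g (P_I g Dp G).

Definition Pstar_III (R : realType) (n m : nat) (g : 'M[R]_n)
    (Dp : 'M[R]_(n, m)) (G : 'M[R]_n) : 'M[R]_n :=
  dual_proj g (orth_proj g (space_III g Dp G)).

(* The inverse of the restriction of Dp to space_III: w *m pinvmx (S *m Dp) is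
   a family of coefficients a with a *m S *m Dp = w, and w is sent to
   a *m S. *)
Definition h_map (R : realType) (n m : nat) (g : 'M[R]_n) (Dp : 'M[R]_(n, m))
    (G : 'M[R]_n) : 'M[R]_(m, n) :=
  let S := space_III g Dp G in pinvmx (S *m Dp) *m S.

Definition k_map (R : realType) (n m : nat) (g : 'M[R]_n) (Dp : 'M[R]_(n, m))
    (G : 'M[R]_n) : 'M[R]_(m, n) :=
  h_map g Dp G *m g.

Definition adapted (R : realType) (N M : nat) (Q : manifold R (N + M))
    (U : manifold R M) (pi : Q -> U) (c : chart R (N + M) Q)
    (d : chart R M U) : Prop :=
  [/\ atlas c, atlas d
    & forall q, cdom c q -> cdom d (pi q) /\ cmap d (pi q) = rsubmx (cmap c q)].

Definition loc_Pstar_I (R : realType) (N M : nat) (Q : manifold R (N + M))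
    (U : manifold R M) (g : Q -> 'M[R]_(N + M)) (pi : Q -> U)
    (G : Q -> 'M[R]_(N + M)) (c : chart R (N + M) Q) (d : chart R M U)
    (x : 'rV[R]_(N + M)) : 'M[R]_(N + M) :=
  Pstar_I (loc_metric g c x) (loc_tangent_map pi c d x)
    (loc_distribution G c x).

Definition loc_Pstar_III (R : realType) (N M : nat) (Q : manifold R (N + M))
    (U : manifold R M) (g : Q -> 'M[R]_(N + M)) (pi : Q -> U)
    (G : Q -> 'M[R]_(N + M)) (c : chart R (N + M) Q) (d : chart R M U)
    (x : 'rV[R]_(N + M)) : 'M[R]_(N + M) :=
  Pstar_III (loc_metric g c x) (loc_tangent_map pi c d x)
    (loc_distribution G c x).

Definition loc_k (R : realType) (N M : nat) (Q : manifold R (N + M))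
    (U : manifold R M) (g : Q -> 'M[R]_(N + M)) (pi : Q -> U)
    (G : Q -> 'M[R]_(N + M)) (c : chart R (N + M) Q) (d : chart R M U)
    (x : 'rV[R]_(N + M)) : 'M[R]_(M, N + M) :=
  k_map (loc_metric g c x) (loc_tangent_map pi c d x)
    (loc_distribution G c x).

Definition theta_I (R : realType) (N M : nat) (Q : manifold R (N + M))
    (U : manifold R M) (g : Q -> 'M[R]_(N + M)) (pi : Q -> U)
    (G : Q -> 'M[R]_(N + M)) (c : chart R (N + M) Q) (d : chart R M U)
    (x p p' : 'rV[R]_(N + M)) : 'rV[R]_(N + M) :=
  let P := loc_Pstar_I g pi G c d in
  let ginv y := invmx (loc_metric g c y) in
  p' *m 'D_(p *m ginv x) P x
  - 2^-1 *: (grad (fun y => (p *m ginv y *m p'^T) 0 0) x *m P x).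

Definition Psi (R : realType) (N M : nat) (Q : manifold R (N + M))
    (U : manifold R M) (g : Q -> 'M[R]_(N + M)) (pi : Q -> U)
    (G : Q -> 'M[R]_(N + M)) (c : chart R (N + M) Q) (d : chart R M U)
    (x : 'rV[R]_(N + M)) (w : 'rV[R]_M) : 'rV[R]_(N + M) :=
  let kw := w *m loc_k g pi G c d x in theta_I g pi G c d x kw kw.

Definition diff_curve (R : realType) (n : nat) (Q : manifold R n) (I : set R)
    (q : R -> Q) : Prop :=
  (forall t, I t -> cont_in I q t) /\
  (forall c t, atlas c -> I t -> cdom c (q t) -> derivable_in I (cmap c \o q) t).

Definition C1_curve (R : realType) (n : nat) (Q : manifold R n) (I : set R)
    (q : R -> Q) : Prop :=
  diff_curve I q /\
  (forall c t, atlas c -> I t -> cdom c (q t) ->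
     cont_in I (deriv_in I (cmap c \o q)) t).

Definition C2_curve (R : realType) (n : nat) (Q : manifold R n) (I : set R)
    (q : R -> Q) : Prop :=
  C1_curve I q /\
  (forall c t, atlas c -> I t -> cdom c (q t) ->
     let v := deriv_in I (cmap c \o q) in
     derivable_in I v t /\ cont_in I (deriv_in I v) t).

Definition velocity (R : realType) (n : nat) (Q : manifold R n) (I : set R)
    (q : R -> Q) (t : R) : 'rV[R]_n :=
  deriv_in I (cmap (chart_at (q t)) \o q) t.

Definition control_solution (R : realType) (N M : nat)
    (Q : manifold R (N + M)) (U : manifold R M) (g : Q -> 'M[R]_(N + M))
    (pi : Q -> U) (G : Q -> 'M[R]_(N + M)) (I : set R) (u : R -> U)
    (q : R -> Q) : Prop :=
  diff_curve I q /\
  (forall t, I t -> pi (q t) = u t /\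
     velocity I q t =
     velocity I u t *m h_map (g (q t)) (tangent_map pi (q t)) (G (q t))).

Definition hamiltonian (R : realType) (n : nat) (Q : manifold R n)
    (g : Q -> 'M[R]_n) (c : chart R n Q) (x p : 'rV[R]_n) : R :=
  2^-1 * (p *m invmx (loc_metric g c x) *m p^T) 0 0.

(* C^1 fields along q, in c-coordinates, with compact support in the open set
   of the interior times t at which q t lies in the chart *)
Definition test_field (R : realType) (n : nat) (Q : manifold R n) (I : set R)
    (q : R -> Q) (c : chart R n Q) (phi : R -> 'rV[R]_n) : Prop :=
  [/\ forall t, derivable phi t 1,
      continuous (derive1 phi)
    & exists K : set R, [/\ compact K, K `<=` I° `&` q @^-1` cdom c
                          & forall t, ~ K t -> phi t = 0]].

(* Generalized covector fields along q: linear functionals on test fields *)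
Definition linear_on_tests (R : realType) (n : nat) (Q : manifold R n)
    (I : set R) (q : R -> Q) (c : chart R n Q)
    (L : (R -> 'rV[R]_n) -> R) : Prop :=
  forall a phi psi, test_field I q c phi -> test_field I q c psi ->
    L (fun t => a *: phi t + psi t) = a * L phi + L psi.

(* "L takes its values in the annihilator of W" *)
Definition annihilates (R : realType) (n : nat) (Q : manifold R n)
    (I : set R) (q : R -> Q) (c : chart R n Q)
    (W : 'rV[R]_n -> 'M[R]_n) (L : (R -> 'rV[R]_n) -> R) : Prop :=
  forall phi, test_field I q c phi ->
    (forall t, I t -> cdom c (q t) -> (phi t <= W (cmap c (q t)))%MS) ->
    L phi = 0.

Section HamiltonianSystem.
Context (R : realType) (N M : nat) (Q : manifold R (N + M)) (U : manifold R M).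
Context (g : Q -> 'M[R]_(N + M)) (pi : Q -> U) (G : Q -> 'M[R]_(N + M)).
Context (F : R -> forall q : Q, 'rV[R]_(N + M) -> 'rV[R]_(N + M)).
Context (I : set R) (u : R -> U) (q : R -> Q) (p : R -> 'rV[R]_(N + M)).

Definition covec (c : chart R (N + M) Q) (b : 'rV[R]_(N + M)) (t : R) :
    'rV[R]_(N + M) :=
  b *m (frame c (q t))^T.

Definition pc (c : chart R (N + M) Q) (t : R) := covec c (p t) t.

(* -dH/dq + F along (q, p), in c-coordinates *)
Definition drift (c : chart R (N + M) Q) (t : R) :=
  - grad (fun y => hamiltonian g c y (pc c t)) (cmap c (q t))
  + covec c (F t (q t) (p t)) t.

Definition Delta_loc (c : chart R (N + M) Q) (d : chart R M U) (x : 'rV[R]_(N + M)) :=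
  kermx (loc_tangent_map pi c d x).

Definition momentum_equation (c : chart R (N + M) Q) (d : chart R M U)
    (t : R) : Prop :=
  exists r : 'rV[R]_(N + M),
    (r <= kermx (Delta_loc c d (cmap c (q t)))^T
          + kermx (loc_distribution G c (cmap c (q t)))^T)%MS /\
    deriv_in I (pc c) t = drift c t + r.

(* The same equation when p is only continuous: the time derivative of p and
   the reaction r = rD + rG are taken in the sense of distributions. *)
Definition weak_momentum_equation (c : chart R (N + M) Q) (d : chart R M U) :
    Prop :=
  exists rD rG : (R -> 'rV[R]_(N + M)) -> R,
    [/\ linear_on_tests I q c rD /\ linear_on_tests I q c rG,
        annihilates I q c (Delta_loc c d) rD,
        annihilates I q c (loc_distribution G c) rG
      & forall phi, test_field I q c phi ->
          - (\int[lebesgue_measure]_(t in I) (pc c t *m (derive1 phi t)^T) 0 0)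
          = (\int[lebesgue_measure]_(t in I) (drift c t *m (phi t)^T) 0 0)
            + rD phi + rG phi].

(* Along q' = h(u') with u of class C^1, the momentum k(u') is in general only
   continuous. A solution thus satisfies the momentum equation in the sense of
   distributions, and pointwise wherever p is differentiable. *)
Definition ham_solution : Prop :=
  diff_curve I q /\
  forall c d, adapted pi c d ->
    (forall t, I t -> cdom c (q t) ->
      [/\ cont_in I (pc c) t,
          deriv_in I (cmap c \o q) t
          = grad (hamiltonian g c (cmap c (q t))) (pc c t),
          pi (q t) = u t,
          (pc c t <= loc_distribution G c (cmap c (q t))
                     *m loc_metric g c (cmap c (q t)))%MS
        & derivable_in I (pc c) t -> momentum_equation c d t]) /\
    weak_momentum_equation c d.

End HamiltonianSystem.

Definition kinetic (R : realType) (n : nat) (Q : manifold R n)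
    (g : Q -> 'M[R]_n) (c : chart R n Q) (x v : 'rV[R]_n) : R :=
  2^-1 * (v *m loc_metric g c x *m v^T) 0 0.

Definition inertial_motion (R : realType) (n : nat) (Q : manifold R n)
    (g : Q -> 'M[R]_n) (G : Q -> 'M[R]_n) (I : set R) (q : R -> Q) : Prop :=
  [/\ C2_curve I q,
      forall t, I t -> (velocity I q t <= G (q t))%MS
    & forall c t, atlas c -> I t -> cdom c (q t) ->
        let x := cmap c \o q in
        let v := deriv_in I x in
        (deriv_in I (fun s => grad (kinetic g c (x s)) (v s)) t
         - grad (fun y => kinetic g c y (v t)) (x t)
         <= kermx (loc_distribution G c (x t))^T)%MS].

(* S is a subset of TQ, given as a set of pairs (q, v) with v in T_q Q *)
Definition inertially_invariant (R : realType) (n : nat) (Q : manifold R n)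
    (g : Q -> 'M[R]_n) (G : Q -> 'M[R]_n) (S : set (Q * 'rV[R]_n)) : Prop :=
  forall (I : set R) (q : R -> Q),
    time_interval I -> inertial_motion g G I q ->
    (exists t0, I t0 /\ S (q t0, velocity I q t0)) ->
    forall t, I t -> S (q t, velocity I q t).

(* Main.v *)
Require Import Defs.
From HB Require Import structures.
From mathcomp Require Import all_boot all_order all_algebra.
From mathcomp Require Import all_classical all_reals all_analysis.
From mathcomp Require Import ring lra.

Set Implicit Arguments.
Unset Strict Implicit.
Unset Printing Implicit Defensive.

Import Order.TTheory GRing.Theory Num.Theory.
Import numFieldNormedType.Exports.

Local Open Scope classical_set_scope.
Local Open Scope ring_scope.

(** Let q be a curve tangent to Gamma with momentum p, so that q' = p g^-1, and
    let y = p P*_I be the component of p along Delta :&: Gamma. Differentiating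
    y and inserting p' = - dH/dq + r, where r annihilates Delta :&: Gamma and
    hence r P*_I = 0, leaves
      y' = theta_I[p, p]
    (momentum_split, loc_momentum_split). This identity drives every
    implication. A reaction in ker Delta + ker Gamma is exactly a covector r
    with r P*_I = 0 (ann_Pstar_I), and the momenta k(w) are exactly the covectors
    in the range of P*_III (Pstar_III_k).

    Hamiltonian system => Psi = 0 (Psi_of_hamiltonian). In an adapted chart the
    equation x' = h_x(w) with w constant has a solution through any point, and
    it projects to a smooth control u with u' = w. Its momentum k(w) has no
    component along Delta :&: Gamma, so y = 0 and theta_I[k(w), k(w)] = 0.

    Psi = 0 => theta_I = 0 on the range of P*_III. Pure linear algebra.

    theta_I = 0 on the range of P*_III => invariance (III_invariant). Along a
    constrained inertial motion write p = y + z with z in the range of P*_III.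
    As theta_I is bilinear and theta_I[z, z] = 0, the identity gives
    |y'| <= C |y| locally, so that y vanishes near each of its zeros
    (gronwall_zero). The set of times where the velocity lies in (TQ)_III is
    thus open and closed in the time interval (interval_clopen).

    Invariance => theta_I = 0 on the range of P*_III (theta_of_invariance). The
    inertial motion starting with a given velocity in (TQ)_III exists; it is
    produced by an ordinary differential equation for the position and the
    coefficients of the velocity in a frame of Gamma. Invariance says that y = 0
    along it, so the identity at time 0 gives the claim. That a motion which
    satisfies the equation in one chart satisfies it in all charts is the
    covariance of the Euler-Lagrange covector (euler_lagrange_pair).

    theta_I = 0 on the range of P*_III => Hamiltonian system
    (solution_hamiltonian). For q' = h(u') and p = k(u') the defect p' + dH/dq is
    killed by P*_I, by the same identity. Since u' is merely continuous, p' is a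
    distribution; the product rule is then put on the test field: if psi takes
    its values in Delta :&: Gamma, then p P*_I = 0 and psi (P*_I)^T = psi turn
    p psi' into a pointwise expression that cancels dH/dq (reaction_work).
    The projector v |-> h(D pi v) splits the defect into a part that annihilates
    Delta and a part that annihilates Gamma (solution_weak).

    The analysis these arguments rest on is developed first: calculus of C^k
    maps, symmetry of second derivatives, local solvability of ordinary
    differential equations, and the inverse function theorem, which yields an
    adapted chart around every point (adapted_chart_exists). *)

(** * Linear algebra of the splitting *)

Definition posdef (R : realType) (n : nat) (g : 'M[R]_n) : Prop :=
  g^T = g /\ forall v : 'rV[R]_n, v != 0 -> 0 < (v *m g *m v^T) 0 0.

Section Orthogonality.
Context (R : realType) (n : nat) (g : 'M[R]_n).
Hypothesis g_pd : posdef g.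

(** Definiteness makes kernels, and intersections of a subspace with its orthogonal
    complement, trivial; the decompositions then follow by counting dimensions. *)
Lemma posdef_eq0 (v : 'rV[R]_n) : v *m g *m v^T = 0 -> v = 0.
Proof.
move=> e; apply/eqP; apply: contraT => /g_pd.2.
by rewrite e mxE ltxx.
Qed.

Lemma posdef_unit : g \in unitmx.
Proof.
rewrite -row_free_unit -kermx_eq0; apply/eqP/row_matrixP => i; rewrite row0.
by apply: posdef_eq0; rewrite -row_mul mulmx_ker row0 mul0mx.
Qed.

Lemma sub_perp (k : nat) (V : 'M[R]_(k, n)) (W : 'M[R]_n) :
  (V <= perp g W)%MS = (V *m g *m W^T == 0).
Proof. by rewrite sub_kermx mulmxA. Qed.

Lemma perp_sym (k : nat) (V : 'M[R]_(k, n)) (W X : 'M[R]_n) :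
  (V <= perp g W)%MS -> (X <= W)%MS -> V *m g *m X^T = 0.
Proof.
rewrite sub_perp => /eqP e /submxP[Y ->].
by rewrite trmx_mul mulmxA e mul0mx.
Qed.

Lemma cap_perp (W : 'M[R]_n) : (W :&: perp g W)%MS = 0.
Proof.
apply/eqP/rowV0P => v; rewrite sub_capmx => /andP[vW].
rewrite sub_perp => /eqP e; apply: posdef_eq0.
by case/submxP: vW => y {2}->; rewrite trmx_mul mulmxA e mul0mx.
Qed.

(** The orthogonal complement has complementary dimension because g is
    invertible, and it meets W trivially. *)
Lemma add_perp_full (W : 'M[R]_n) : row_full (W + perp g W)%MS.
Proof.
rewrite /row_full; have := mxrank_sum_cap W (perp g W).
rewrite cap_perp mxrank0 addn0 => ->.
rewrite /perp mxrank_ker -(mxrank_tr (g *m _)) trmx_mul trmxK g_pd.1.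
rewrite mxrankMfree ?subnKC ?rank_leq_row//.
by rewrite row_free_unit posdef_unit.
Qed.

Lemma orth_proj_sub (k : nat) (V : 'M[R]_(k, n)) (W : 'M[R]_n) :
  (V *m orth_proj g W <= W)%MS.
Proof. exact: proj_mx_sub. Qed.

Lemma orth_proj_compl (k : nat) (V : 'M[R]_(k, n)) (W : 'M[R]_n) :
  (V - V *m orth_proj g W <= perp g W)%MS.
Proof. by apply: proj_mx_compl_sub; apply: submx_full; exact: add_perp_full. Qed.

Lemma orth_proj_id (k : nat) (V : 'M[R]_(k, n)) (W : 'M[R]_n) :
  (V <= W)%MS -> V *m orth_proj g W = V.
Proof. by move=> VW; apply: proj_mx_id => //; exact: cap_perp. Qed.

Lemma orth_proj_0 (k : nat) (V : 'M[R]_(k, n)) (W : 'M[R]_n) :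
  (V <= perp g W)%MS -> V *m orth_proj g W = 0.
Proof. by move=> VW; apply: proj_mx_0 => //; exact: cap_perp. Qed.

Lemma orth_proj_unique (P W : 'M[R]_n) :
  (P <= W)%MS -> (1%:M - P <= perp g W)%MS -> orth_proj g W = P.
Proof.
move=> PW PV; rewrite -[LHS]mul1mx -[in LHS](subrK P 1%:M) mulmxDl.
by rewrite orth_proj_0// orth_proj_id// add0r.
Qed.

(** Self-adjointness. It makes the dual projection on covectors the plain
    transpose, which is how P*_I is differentiated and multiplied below. *)
Lemma orth_proj_adj (W : 'M[R]_n) :
  orth_proj g W *m g = g *m (orth_proj g W)^T.
Proof.
move: (orth_proj g W) (orth_proj_compl 1%:M W) (orth_proj_sub 1%:M W) => P.
rewrite !mul1mx => h1 h2; have e : g *m P^T = P *m g *m P^T.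
  by have /eqP := perp_sym h1 h2; rewrite mulmxBl mul1mx mulmxBl subr_eq0 => /eqP.
have := congr1 trmx e; rewrite !trmx_mul !trmxK g_pd.1 mulmxA => ->.
by rewrite -e.
Qed.

Lemma dual_orth_proj (W : 'M[R]_n) :
  dual_proj g (orth_proj g W) = (orth_proj g W)^T.
Proof. by rewrite /dual_proj -mulmxA orth_proj_adj mulKmx// posdef_unit. Qed.

End Orthogonality.

Section Splitting.
Context (R : realType) (n m : nat) (g : 'M[R]_n) (D : 'M[R]_(n, m))
  (G : 'M[R]_n).
Hypothesis g_pd : posdef g.
Hypothesis D_full : row_full D.
Hypothesis DG_full : row_full (kermx D + G)%MS.

Local Notation SI := (space_I D G).
Local Notation SIII := (space_III g D G).
Local Notation PI := (P_I g D G).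
Local Notation h := (h_map g D G).

Lemma space_IP (k : nat) (V : 'M[R]_(k, n)) :
  (V <= SI)%MS = (V *m D == 0) && (V <= G)%MS.
Proof. by rewrite sub_capmx sub_kermx. Qed.

Lemma space_III_sub (k : nat) (V : 'M[R]_(k, n)) :
  (V <= SIII)%MS -> (V <= G)%MS.
Proof. by rewrite sub_capmx => /andP[]. Qed.

(** Within Gamma, the orthogonal complement of Delta :&: Gamma is the kernel of
    P_I. *)
Lemma space_III_P_I (k : nat) (V : 'M[R]_(k, n)) :
  (V <= SIII)%MS = (V <= G)%MS && (V *m PI == 0).
Proof.
rewrite sub_capmx andbC; congr (_ && _); apply/idP/eqP => [|e].
  exact: orth_proj_0.
by have := orth_proj_compl g_pd V SI; rewrite -/(P_I g D G) e subr0.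
Qed.

Lemma sub_P_I_III (k : nat) (V : 'M[R]_(k, n)) :
  (V <= G)%MS -> (V - V *m PI <= SIII)%MS.
Proof.
move=> VG; rewrite sub_capmx orth_proj_compl//= addmx_sub// eqmx_opp.
by have := orth_proj_sub g V SI; rewrite -/(P_I g D G) space_IP => /andP[].
Qed.

Lemma space_III_ker0 (k : nat) (V : 'M[R]_(k, n)) :
  (V <= SIII)%MS -> V *m D = 0 -> V = 0.
Proof.
move=> V3 VD; have VI : (V <= SI)%MS by rewrite space_IP VD eqxx space_III_sub.
rewrite space_III_P_I in V3; have /andP[_ /eqP <-] := V3.
by rewrite orth_proj_id.
Qed.

(** By transversality D is already onto from Gamma, and removing the component
    in Delta :&: Gamma does not change the image under D. *)
Lemma space_III_onto : row_full (SIII *m D).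
Proof.
have /row_fullP[B eB] : row_full D by [].
rewrite -sub1mx -eB.
have /sub_addsmxP[[u v] /= ->] : (B <= kermx D + G)%MS by rewrite submx_full.
rewrite mulmxDl -mulmxA mulmx_ker mulmx0 add0r.
set b := v *m G.
have bP : b *m PI *m D = 0.
  have := orth_proj_sub g b SI.
  by rewrite space_IP => /andP[/eqP].
have -> : b *m D = (b - b *m PI) *m D by rewrite mulmxBl bP subr0.
by rewrite submxMr// sub_P_I_III// submxMl.
Qed.

Lemma h_sub : (h <= SIII)%MS. Proof. exact: submxMl. Qed.

Lemma h_sub_G (k : nat) (V : 'M[R]_(k, m)) : (V *m h <= G)%MS.
Proof. by apply: submx_trans (submxMl _ _) _; apply/space_III_sub/h_sub. Qed.

Lemma h_mulD : h *m D = 1%:M.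
Proof.
rewrite /h_map -mulmxA -[pinvmx _]mul1mx mulmxKpV//.
by rewrite submx_full ?space_III_onto.
Qed.

Lemma space_III_h (k : nat) (V : 'M[R]_(k, n)) :
  (V <= SIII)%MS -> V = V *m D *m h.
Proof.
move=> V3; apply/eqP; rewrite -subr_eq0; apply/eqP/space_III_ker0.
  by rewrite addmx_sub// eqmx_opp (submx_trans (submxMl _ _) h_sub).
by rewrite mulmxBl -[X in _ - X]mulmxA h_mulD mulmx1 subrr.
Qed.

(** This characterization computes h in frames and under changes of
    coordinates. *)
Lemma h_unique (h' : 'M[R]_(m, n)) :
  (h' <= SIII)%MS -> h' *m D = 1%:M -> h = h'.
Proof. by move=> /space_III_h {2}-> ->; rewrite mul1mx. Qed.

Lemma h_P_I : h *m PI = 0.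
Proof. by have := h_sub; rewrite space_III_P_I => /andP[_ /eqP]. Qed.

Lemma Pstar_IE : Pstar_I g D G = PI^T.
Proof. exact: dual_orth_proj. Qed.

Lemma k_Pstar_I : k_map g D G *m Pstar_I g D G = 0.
Proof. by rewrite Pstar_IE -mulmxA -orth_proj_adj// mulmxA h_P_I mul0mx. Qed.

(** The map v |-> v D h is the projection on space_III along Delta. *)
Lemma sub_Dh_Delta (k : nat) (V : 'M[R]_(k, n)) : (V - V *m D *m h) *m D = 0.
Proof. by rewrite mulmxBl -[X in _ - X]mulmxA h_mulD mulmx1 subrr. Qed.

Lemma sub_Dh_I (k : nat) (V : 'M[R]_(k, n)) :
  (V <= G)%MS -> (V - V *m D *m h <= SI)%MS.
Proof.
move=> VG; rewrite space_IP sub_Dh_Delta eqxx/= addmx_sub// eqmx_opp.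
exact: h_sub_G.
Qed.

(** Write r = r (D h)^T + (r - r (D h)^T). The first term annihilates Delta
    since D h kills Delta; the second annihilates Gamma since 1 - D h maps Gamma
    into Delta :&: Gamma. *)
Lemma ann_space_I (r : 'rV[R]_n) : r *m SI^T = 0 ->
  (r <= kermx (kermx D)^T + kermx G^T)%MS.
Proof.
move=> rI.
have -> : r = r *m (D *m h)^T + (r - r *m (D *m h)^T) by rewrite addrC subrK.
apply: addmx_sub_adds; rewrite sub_kermx.
  by rewrite -mulmxA -trmx_mul mulmxA mulmx_ker mul0mx trmx0 mulmx0.
have /submxP[Y eY] := sub_Dh_I (submx_refl G).
apply/eqP; rewrite mulmxBl -mulmxA -trmx_mul mulmxA -mulmxBr -linearB/= eY.
by rewrite trmx_mul mulmxA rI mul0mx.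
Qed.

Lemma ann_sub_I (r : 'rV[R]_n) :
  (r <= kermx (kermx D)^T + kermx G^T)%MS -> r *m SI^T = 0.
Proof.
case/sub_addsmxP=> -[u v] /= ->; rewrite mulmxDl.
have /submxP[X eX] : (SI <= kermx D)%MS by rewrite capmxSl.
have /submxP[Y eY] : (SI <= G)%MS by rewrite capmxSr.
rewrite {1}eX [in X in _ + X]eY; move: (kermx D) => K.
rewrite !trmx_mul -!(mulmxA _ (kermx _)).
by rewrite !(mulmxA (kermx _)) !mulmx_ker !mul0mx !mulmx0 addr0.
Qed.

(** The horizontal momenta are those of the form k(w): a vector v of space_III
    is recovered from its image by v = v D h. *)
Lemma Pstar_III_k (p : 'rV[R]_n) :
  exists w, p *m Pstar_III g D G = w *m k_map g D G.
Proof.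
exists (p *m invmx g *m orth_proj g SIII *m D).
rewrite /Pstar_III /dual_proj /k_map [RHS]mulmxA !(mulmxA p); congr (_ *m _).
by apply: space_III_h => //; exact: orth_proj_sub.
Qed.

Lemma k_Pstar_III : k_map g D G *m Pstar_III g D G = k_map g D G.
Proof.
rewrite /Pstar_III /dual_proj /k_map.
rewrite [LHS]mulmxA [X in X *m g = _]mulmxA mulmxK ?posdef_unit//.
by rewrite orth_proj_id// h_sub.
Qed.

End Splitting.

(** Reaction covectors are recognized by one linear equation, which is smooth in
    the base point. *)
Lemma ann_Pstar_I (R : realType) (n m : nat) (g : 'M[R]_n) (D : 'M[R]_(n, m))
    (G : 'M[R]_n) (r : 'rV[R]_n) : posdef g -> row_full D ->
  row_full (kermx D + G)%MS ->
  (r <= kermx (kermx D)^T + kermx G^T)%MS <-> r *m Pstar_I g D G = 0.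
Proof.
move=> pg fD fDG; rewrite Pstar_IE//; split=> [rI|rP].
  have /submxP[Y eY] : (P_I g D G <= space_I D G)%MS.
    by have := orth_proj_sub g 1%:M (space_I D G); rewrite mul1mx.
  by rewrite eY trmx_mul mulmxA (ann_sub_I rI) mul0mx.
apply: (ann_space_I pg fD fDG).
have <- : space_I D G *m P_I g D G = space_I D G by exact: orth_proj_id.
by rewrite trmx_mul mulmxA rP mul0mx.
Qed.

Section FrameFormulas.
Context (R : realType) (n m r : nat) (g : 'M[R]_n) (D : 'M[R]_(n, m))
  (G : 'M[R]_n) (E : 'M[R]_(r, n)).
Hypothesis g_pd : posdef g.
Hypothesis D_full : row_full D.
Hypothesis DG_full : row_full (kermx D + G)%MS.
Hypothesis E_free : row_free E.
Hypothesis EG : (E :=: G)%MS.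

Definition frame_gram := E *m g *m E^T.
(** The rows are the g-gradients, within Gamma, of the components of
    v |-> v D. They are g-orthogonal to Delta :&: Gamma, span space_III, and
    are rational in g, D and E. *)
Definition frame_III := (E *m D)^T *m invmx frame_gram *m E.

Lemma frame_gram_pd : posdef frame_gram.
Proof.
split; first by rewrite /frame_gram !trmx_mul trmxK g_pd.1 mulmxA.
move=> a a0; have : a *m E != 0 by rewrite mulmx_free_eq0.
by move=> /g_pd.2; rewrite /frame_gram trmx_mul !mulmxA.
Qed.

Lemma frame_III_gE : frame_III *m g *m E^T = (E *m D)^T.
Proof.
rewrite /frame_III -[X in X *m E^T]mulmxA -[LHS]mulmxA -/frame_gram.
by rewrite mulmxKV//; exact/posdef_unit/frame_gram_pd.
Qed.

Lemma frame_III_sub : (frame_III <= space_III g D G)%MS.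
Proof.
rewrite sub_capmx -EG submxMl andbT sub_perp.
have : (space_I D G <= E)%MS by rewrite EG capmxSr.
case/submxP=> X eX; have /eqP : X *m E *m D = 0.
  rewrite -eX; apply/eqP; have := submx_refl (space_I D G).
  by rewrite {2}/space_I sub_capmx sub_kermx => /andP[].
rewrite eX trmx_mul mulmxA frame_III_gE -trmx_mul mulmxA => /eqP ->.
by rewrite trmx0.
Qed.

Lemma frame_D_full : row_full (E *m D).
Proof.
have := space_III_onto g_pd D_full DG_full; rewrite -!sub1mx => /submx_trans; apply.
by rewrite submxMr// EG capmxSr.
Qed.

(** With gamma the Gram matrix of E and T = E D, the product is
    T^T gamma^-1 T, which is definite because T has full column rank. *)
Lemma frame_III_D_unit : frame_III *m D \in unitmx.
Proof.
have gi := posdef_unit frame_gram_pd.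
rewrite -row_free_unit -kermx_eq0; apply/eqP/row_matrixP => i; rewrite row0.
set w := row i _; have : w *m (frame_III *m D) = 0.
  by rewrite -row_mul mulmx_ker row0.
rewrite /frame_III -!mulmxA.
have := frame_D_full; move: (E *m D) => T T_full e.
have : w *m T^T = 0.
  have a0 : w *m T^T *m invmx frame_gram = 0.
    apply: (posdef_eq0 frame_gram_pd).
    rewrite mulmxKV// !trmx_mul trmxK trmx_inv frame_gram_pd.1.
    by rewrite (mulmxA (invmx _)) mulmxA -(mulmxA w) e mul0mx.
  by rewrite -[LHS](mulmxKV gi) a0 mul0mx.
by move/eqP; rewrite mulmx_free_eq0 ?/row_free ?mxrank_tr// => /eqP.
Qed.

Lemma h_frame : h_map g D G = invmx (frame_III *m D) *m frame_III.
Proof.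
apply: h_unique => //; last by rewrite -mulmxA mulVmx ?frame_III_D_unit.
exact: submx_trans (submxMl _ _) frame_III_sub.
Qed.

(** PG projects orthogonally on Gamma; inside Gamma the component along
    Delta :&: Gamma is then removed by v |-> v - v D h. *)
Lemma P_I_frame : let PG := g *m E^T *m invmx frame_gram *m E in
  P_I g D G = PG - PG *m D *m h_map g D G.
Proof.
move=> PG; have PG_sub : (PG <= G)%MS by rewrite -EG submxMl.
apply: orth_proj_unique => //; first exact: sub_Dh_I.
rewrite opprB addrCA addmx_sub//.
  apply: submx_trans (submxMl _ _) _.
  by apply: submx_trans (h_sub _ _ _) _; exact: capmxSl.
have /submxP[X eX] : (space_I D G <= E)%MS by rewrite EG capmxSr.
rewrite sub_perp eX trmx_mul mulmxA mulmxBl mul1mx mulmxBl.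
rewrite /PG -[X in _ - X]mulmxA -[X in _ - X]mulmxA (mulmxA E) -/frame_gram.
by rewrite mulmxKV ?subrr ?mul0mx//; exact: posdef_unit frame_gram_pd.
Qed.

End FrameFormulas.

(** A and B hold the coordinate vectors of two charts at a point; primed objects
    are the coordinate expressions of g, D and G there. *)
Section Covariance.
Context (R : realType) (n m : nat) (g : 'M[R]_n) (D : 'M[R]_(n, m))
  (G A : 'M[R]_n) (B : 'M[R]_m).
Hypothesis g_pd : posdef g.
Hypothesis D_full : row_full D.
Hypothesis DG_full : row_full (kermx D + G)%MS.
Hypothesis A_unit : A \in unitmx.
Hypothesis B_unit : B \in unitmx.

Local Notation g' := (A *m g *m A^T).
Local Notation D' := (A *m D *m invmx B).
Local Notation G' := (G *m invmx A).

Lemma posdef_change : posdef g'.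
Proof.
split; first by rewrite !trmx_mul trmxK g_pd.1 mulmxA.
move=> v v0; have /g_pd.2 : v *m A != 0 by rewrite mulmx_free_eq0 ?row_free_unit.
by rewrite trmx_mul !mulmxA.
Qed.

Lemma sub_change (k : nat) (V : 'M[R]_(k, n)) (p : nat) (W : 'M[R]_(p, n)) :
  (V <= W *m invmx A)%MS = (V *m A <= W)%MS.
Proof.
apply/idP/idP => [/(submxMr A)|/(submxMr (invmx A))]; first by rewrite mulmxKV.
by rewrite mulmxK.
Qed.

Lemma space_I_change (k : nat) (V : 'M[R]_(k, n)) :
  (V <= space_I D' G')%MS = (V *m A <= space_I D G)%MS.
Proof.
rewrite /space_I !sub_capmx !sub_kermx sub_change !mulmxA; congr (_ && _).
by rewrite mulmx_free_eq0 // row_free_unit unitmx_inv.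
Qed.

Lemma perp_change (k : nat) (V : 'M[R]_(k, n)) :
  (V <= perp g' (space_I D' G'))%MS = (V *m A <= perp g (space_I D G))%MS.
Proof.
rewrite !sub_perp.
have /submxP[X eX] : (space_I D' G' *m A <= space_I D G)%MS.
  by rewrite -space_I_change.
have /submxP[Y eY] : (space_I D G <= space_I D' G' *m A)%MS.
  by rewrite -[X in (X <= _)%MS](mulmxKV A_unit) submxMr// space_I_change mulmxKV.
rewrite -!mulmxA -trmx_mul !mulmxA; apply/eqP/eqP => h0.
  by rewrite eY trmx_mul mulmxA h0 mul0mx.
by rewrite eX trmx_mul mulmxA h0 mul0mx.
Qed.

Lemma space_III_change (k : nat) (V : 'M[R]_(k, n)) :
  (V <= space_III g' D' G')%MS = (V *m A <= space_III g D G)%MS.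
Proof. by rewrite /space_III !(sub_capmx, sub_change) perp_change. Qed.

Lemma row_full_change : row_full D'.
Proof.
rewrite -sub1mx -(mulmxV B_unit) submxMr//.
have /submxP[X eX] : (B <= D)%MS by rewrite submx_full.
by rewrite {1}eX -{1}(mulmxKV A_unit X) -(mulmxA (X *m _)) submxMl.
Qed.

Lemma transversal_change : row_full (kermx D' + G')%MS.
Proof.
rewrite -sub1mx -(mulmxV A_unit).
have /sub_addsmxP[[u v] /= e] : (A <= kermx D + G)%MS by rewrite submx_full.
rewrite {1}e mulmxDl addmx_sub_adds//; last by rewrite -mulmxA submxMl.
rewrite sub_kermx mulmxA (mulmxA _ A D) mulmxKV// -(mulmxA u) mulmx_ker.
by rewrite mulmx0 mul0mx.
Qed.

Lemma h_change : h_map g' D' G' = B *m h_map g D G *m invmx A.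
Proof.
apply: h_unique; [exact: posdef_change|exact: row_full_change|
  exact: transversal_change| |].
  rewrite space_III_change mulmxKV//.
  exact: submx_trans (submxMl _ _) (h_sub _ _ _).
rewrite mulmxA (mulmxA _ A) mulmxKV// -(mulmxA B) h_mulD// mulmx1.
exact: mulmxV.
Qed.

Lemma k_change : k_map g' D' G' = B *m k_map g D G *m A^T.
Proof. by rewrite /k_map h_change !mulmxA mulmxKV. Qed.

End Covariance.

(** * Calculus of C^k maps *)

Section DiffEps.
Context (R : realType) (V W : normedModType R).

Lemma cvg_sub0 (x : V) : y - x @[y --> x] --> (0 : V).
Proof. by rewrite -[X in _ --> X](subrr x); apply: cvgB; [exact: cvg_id|exact: cvg_cst]. Qed.

Lemma cvg_add0 (x : V) : y + x @[y --> (0 : V)] --> x.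
Proof. by rewrite -[X in _ --> X](add0r x); apply: cvgD; [exact: cvg_id|exact: cvg_cst]. Qed.

(** Differentiability as an estimate on increments, which composes and transfers
    to one-sided derivatives more easily than Landau symbols. *)
Lemma diff_eps (f : V -> W) (x : V) (e : R) : differentiable f x -> 0 < e ->
  \forall y \near x, `|f y - f x - 'd f x (y - x)| <= e * `|y - x|.
Proof.
move=> df e0.
have /eqaddoP/(_ _ e0) h := diff_locally df.
apply: (@filterS _ (nbhs x) _ _ _ _ (@cvg_sub0 x _ h)) => y /=.
by rewrite !fctE /= subrK opprD addrA.
Qed.

Lemma eps_diff (f : V -> W) (x : V) (L : {linear V -> W}) : continuous L ->
  (forall e : R, 0 < e ->
     \forall y \near x, `|f y - f x - L (y - x)| <= e * `|y - x|) ->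
  differentiable f x /\ ('d f x : V -> W) = L.
Proof.
move=> cL H.
have e : f \o shift x = cst (f x) + L +o_ 0 id.
  apply/eqaddoP => e e0.
  apply: (@filterS _ (nbhs 0) _ _ _ _ (@cvg_add0 x _ (H e e0))) => y /=.
  by rewrite !fctE/= opprD addrA addrK.
have dL := diff_unique cL e.
by split => //; apply/diff_locallyP; rewrite dL.
Qed.

Lemma near_eq_diff (f g : V -> W) (x : V) : (\near x, f x = g x) ->
  differentiable f x -> differentiable g x.
Proof.
move=> fg df; have [|//] := @eps_diff g x ('d f x) (diff_continuous df).
move=> e e0; near=> y.
have <- : f y = g y by near: y.
have <- : f x = g x by exact: nbhs_singleton fg.
by near: y; exact: diff_eps.
Unshelve. all: by end_near. Qed.

Lemma deriveDv (f : V -> W) x v w : differentiable f x ->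
  'D_(v + w) f x = 'D_v f x + 'D_w f x.
Proof. by move=> df; rewrite !deriveE// linearD. Qed.

Lemma deriveZv (f : V -> W) x (a : R) v : differentiable f x ->
  'D_(a *: v) f x = a *: 'D_v f x.
Proof. by move=> df; rewrite !deriveE// linearZ. Qed.

End DiffEps.

Section FiniteDimension.
Context (R : realType) (n : nat).

Lemma row_delta_sum (x : 'rV[R]_n) : x = \sum_i x 0 i *: delta_mx 0 i.
Proof. by rewrite [LHS]matrix_sum_delta big_ord1. Qed.

Lemma cvg_sum_fun (T : Type) (F : set_system T) {FF : Filter F} (W : normedModType R)
    (k : nat) (f : 'I_k -> T -> W) (l : 'I_k -> W) :
  (forall i, f i x @[x --> F] --> l i) ->
  \sum_i f i x @[x --> F] --> \sum_i l i.
Proof.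
move=> H; elim: k f l H => [|k IH] f l H.
  under eq_fun do rewrite big_ord0; rewrite big_ord0; exact: cvg_cst.
under eq_fun do rewrite big_ord_recl; rewrite big_ord_recl.
by apply: cvgD; [exact: H|apply: IH => i; exact: H].
Qed.

Lemma linear_rV_continuous (W : normedModType R) (L : {linear 'rV[R]_n -> W}) :
  continuous L.
Proof.
move=> x; have LE : (L : _ -> _) = fun y : 'rV[R]_n => \sum_i y 0 i *: L (delta_mx 0 i).
  apply/funext => y; rewrite {1}(row_delta_sum y) linear_sum.
  by apply: eq_bigr => i _; rewrite linearZ.
rewrite /continuous_at LE; apply: (@cvg_sum_fun _ (nbhs x)) => i.
by apply: cvgZr_tmp; exact: coord_continuous.
Qed.

(** Directional derivatives along moving directions become sums of products
    of smooth functions. *)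
Lemma derive_rV (W : normedModType R) (f : 'rV[R]_n -> W) x v :
  differentiable f x -> 'D_v f x = \sum_i v 0 i *: 'D_(delta_mx 0 i) f x.
Proof.
move=> df; rewrite deriveE// {1}(row_delta_sum v) linear_sum.
by apply: eq_bigr => i _; rewrite linearZ deriveE.
Qed.

End FiniteDimension.

Section Rules.
Context (R : realType) (V : normedModType R).

Lemma derive_bilin (U1 U2 W : normedModType R) (B : {bilinear U1 -> U2 -> W})
    (f : V -> U1) (g : V -> U2) (x : V) :
  continuous (fun p => B p.1 p.2) -> differentiable f x -> differentiable g x ->
  differentiable (fun y => B (f y) (g y)) x /\
  forall v, 'D_v (fun y => B (f y) (g y)) x = B ('D_v f x) (g x) + B (f x) ('D_v g x).
Proof.
move=> cB df dg.
pose p := (fun y => (f y, g y)); pose b := fun q : U1 * U2 => B q.1 q.2.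
have dp : differentiable p x by exact: differentiable_pair.
have db : differentiable b (p x) by exact: differentiable_bilin.
have e : (fun y => B (f y) (g y)) = b \o p by [].
have d : differentiable (b \o p) x by exact: differentiable_comp.
split => [|v]; first by rewrite e.
rewrite [X in 'D_v X _]e deriveE// diff_comp//= diff_bilin// diff_pair//= !deriveE//.
by rewrite addrC.
Qed.

Lemma derive_compE (U W : normedModType R) (f : V -> U) (g : U -> W) (x v : V) :
  differentiable f x -> differentiable g (f x) ->
  'D_v (g \o f) x = 'D_('D_v f x) g (f x).
Proof.
move=> df dg; rewrite !deriveE//; first by rewrite diff_comp.
exact: differentiable_comp.
Qed.

Lemma derive_linE (U W : normedModType R) (L : {linear U -> W}) (f : V -> U)
    (x v : V) : continuous L -> differentiable f x ->
  differentiable (L \o f) x /\ 'D_v (L \o f) x = L ('D_v f x).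
Proof.
move=> cL df; have dL := linear_differentiable (f x) cL.
split; first exact: differentiable_comp.
by rewrite derive_compE// deriveE// diff_lin.
Qed.

End Rules.

Lemma scale_is_bilinear (R : realType) (W : normedModType R) :
  bilinear_for (GRing.Scale.Law.clone _ _ ( *:%R ) _)
    (GRing.Scale.Law.clone _ _ ( *:%R ) _) (@GRing.scale R W : R -> W -> W).
Proof.
split => [u a x y|u a x y] /=.
  by rewrite scalerDl scalerA.
by rewrite scalerDr !scalerA mulrC.
Qed.

HB.instance Definition _ (R : realType) (W : normedModType R) :=
  bilinear_isBilinear.Build R R W W _ _ (@GRing.scale R W) (@scale_is_bilinear R W).

Lemma cvg_mxP (R : realType) (T : Type) (F : set_system T) {FF : Filter F} (m n : nat)
    (f : T -> 'M[R]_(m, n)) (l : 'M[R]_(m, n)) :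
  (forall i j, f x i j @[x --> F] --> l i j) -> f x @[x --> F] --> l.
Proof.
move=> H; apply/cvgrPdist_le => /= e e0; near=> x.
rewrite /Num.Def.normr/= mx_normrE (bigmax_le _ (ltW e0))//= => i _.
rewrite !mxE/=.
move: i; near: x; apply: filter_forall => /= i.
exact: ((cvgrPdist_le _ _).1 (H i.1 i.2)).
Unshelve. all: by end_near. Qed.

Lemma cvg_coord (R : realType) (T : Type) (F : set_system T) {FF : Filter F}
    (m n : nat) (f : T -> 'M[R]_(m, n)) (l : 'M[R]_(m, n)) i j :
  f x @[x --> F] --> l -> f x i j @[x --> F] --> l i j.
Proof.
move=> fl.
exact: (@cvg_comp _ _ _ f (fun M : 'M[R]_(m, n) => M i j) _ _ _ fl (@coord_continuous _ _ _ _ _ _)).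
Qed.

Lemma cvg_mulmx (R : realType) (T : Type) (F : set_system T) {FF : Filter F}
    (m n p : nat) (f : T -> 'M[R]_(m, n)) (g : T -> 'M[R]_(n, p))
    (a : 'M[R]_(m, n)) (b : 'M[R]_(n, p)) :
  f x @[x --> F] --> a -> g x @[x --> F] --> b -> f x *m g x @[x --> F] --> a *m b.
Proof.
move=> fa gb; apply: cvg_mxP => i k; under eq_fun do rewrite mxE; rewrite mxE.
by apply: cvg_sum_fun => j; apply: cvgM; exact: cvg_coord.
Qed.

Lemma mulmx_continuous (R : realType) (m n p : nat) :
  continuous (fun q : 'M[R]_(m, n) * 'M[R]_(n, p) => q.1 *m q.2).
Proof. by move=> q; apply: cvg_mulmx; [exact: cvg_fst|exact: cvg_snd]. Qed.

Lemma scale_continuous2 (R : realType) (W : normedModType R) :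
  continuous (fun q : R * W => q.1 *: q.2).
Proof. by move=> q; apply: cvgZ; [exact: cvg_fst|exact: cvg_snd]. Qed.

Section Ck.
Context (R : realType) (V : normedModType R).

Lemma Ck_sub (W : normedModType R) k (D D' : set V) (f : V -> W) :
  D' `<=` D -> Ck k D f -> Ck k D' f.
Proof.
move=> DD; elim: k f => [f H x /DD /H//|k IH f [H1 H2]].
by split=> [x /DD /H1//|v]; apply: IH; exact: H2.
Qed.

Lemma CkW (W : normedModType R) k (D : set V) (f : V -> W) : Ck k.+1 D f -> Ck k D f.
Proof.
elim: k f => [f [H _] x /H|k IH f [H1 H2]]; first exact: differentiable_continuous.
by split=> // v; apply: IH.
Qed.

Lemma Ck_le (W : normedModType R) j k (D : set V) (f : V -> W) : (j <= k)%N ->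
  Ck k D f -> Ck j D f.
Proof.
elim: k => [|k IH]; first by rewrite leqn0 => /eqP ->.
by rewrite leq_eqVlt => /predU1P[-> //|jk] /CkW; apply: IH.
Qed.

Lemma Ck_ext (W : normedModType R) k (D : set V) (f g : V -> W) : open D ->
  (forall x, D x -> f x = g x) -> Ck k D f -> Ck k D g.
Proof.
move=> oD; have nD x : D x -> \forall y \near x, D y by move=> Dx; exact: open_nbhs_nbhs.
elim: k f g => [f g fg H x Dx|k IH f g fg [H1 H2]].
  have nfg : \near x, f x = g x by apply: filterS (nD _ Dx).
  rewrite /prop_for /continuous_at -(fg _ Dx); apply: cvg_trans (H x Dx).
  exact: near_eq_cvg.
have nfg x : D x -> \near x, f x = g x by move=> /nD; apply: filterS.
split=> [x Dx|v]; first exact: near_eq_diff (nfg _ Dx) (H1 _ Dx).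
apply: IH (H2 v) => x Dx; exact/near_eq_derive/nfg.
Qed.

Lemma Ck_cst (W : normedModType R) k (D : set V) (w : W) : Ck k D (fun _ => w).
Proof.
elim: k w => [w x _|k IH w]; first exact: cvg_cst.
split=> [x _|v]; first exact: differentiable_cst.
have -> : 'D_v (fun _ : V => w) = (fun _ => 0).
  by apply/funext => x; exact: derive_cst.
exact: IH.
Qed.

Lemma Ck_lin (U W : normedModType R) k (D : set V) (L : {linear U -> W}) (f : V -> U) :
  open D -> continuous L -> Ck k D f -> Ck k D (fun x => L (f x)).
Proof.
move=> oD cL; elim: k f => [f H x /H fx|k IH f [H1 H2]].
  by apply: (continuous_comp fx); exact: cL.
split=> [x /H1 dx|v]; first by have [] := derive_linE 0 cL dx.
apply: Ck_ext (IH _ (H2 v)) => // x /H1 dx; by have [] := derive_linE v cL dx.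
Qed.

Lemma Ck_add (W : normedModType R) k (D : set V) (f g : V -> W) :
  open D -> Ck k D f -> Ck k D g -> Ck k D (fun x => f x + g x).
Proof.
move=> oD; elim: k f g => [f g Hf Hg x Dx|k IH f g [Hf Hf'] [Hg Hg']].
  by apply: cvgD; [exact: Hf|exact: Hg].
split=> [x Dx|v]; first by apply: differentiableD; [exact: Hf|exact: Hg].
apply: Ck_ext (IH _ _ (Hf' v) (Hg' v)) => // x Dx.
have df : derivable f x v by apply: diff_derivable; exact: Hf.
have dg : derivable g x v by apply: diff_derivable; exact: Hg.
by rewrite -[LHS](deriveD df dg).
Qed.

Lemma Ck_sum (W : normedModType R) k (D : set V) (I : finType) (f : I -> V -> W) :
  open D -> (forall i, Ck k D (f i)) -> Ck k D (fun x => \sum_i f i x).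
Proof.
move=> oD H; elim: (index_enum I) => [|i s IH].
  under eq_fun do rewrite big_nil; exact: Ck_cst.
by under eq_fun do rewrite big_cons; apply: Ck_add.
Qed.

(** Induction on k works because, by the Leibniz rule, a directional derivative
    of B (f, g) is a sum of two terms of the same shape. *)
Lemma Ck_bilin (U1 U2 W : normedModType R) k (D : set V)
    (B : {bilinear U1 -> U2 -> W}) (f : V -> U1) (g : V -> U2) :
  open D -> continuous (fun p => B p.1 p.2) -> Ck k D f -> Ck k D g ->
  Ck k D (fun x => B (f x) (g x)).
Proof.
move=> oD cB; elim: k f g => [f g Hf Hg x Dx|k IH f g Hf Hg].
  apply: (@continuous_comp _ _ _ (fun y => (f y, g y)) (fun p => B p.1 p.2)); last exact: cB.
  by apply: cvg_pair; [exact: Hf|exact: Hg].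
have Bd x (Dx : D x) := derive_bilin cB (Hf.1 x Dx) (Hg.1 x Dx).
split=> [x /Bd[]//|v].
apply: (@Ck_ext _ _ _ (fun x => B ('D_v f x) (g x) + B (f x) ('D_v g x))) => //.
  by move=> x /Bd[_ ->].
apply: Ck_add => //; apply: IH; [exact: Hf.2|exact: CkW|exact: CkW|exact: Hg.2].
Qed.

Lemma Ck_mulmx k (D : set V) m n p (f : V -> 'M[R]_(m, n)) (g : V -> 'M[R]_(n, p)) :
  open D -> Ck k D f -> Ck k D g -> Ck k D (fun x => f x *m g x).
Proof. by move=> oD; apply: Ck_bilin => //; exact: mulmx_continuous. Qed.

Lemma Ck_scale (W : normedModType R) k (D : set V) (s : V -> R) (f : V -> W) :
  open D -> Ck k D s -> Ck k D f -> Ck k D (fun x => s x *: f x).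
Proof. by move=> oD; apply: Ck_bilin => //; exact: scale_continuous2. Qed.

Lemma Ck_mul k (D : set V) (f g : V -> R) :
  open D -> Ck k D f -> Ck k D g -> Ck k D (fun x => f x * g x).
Proof. exact: Ck_scale. Qed.

Lemma Ck_opp (W : normedModType R) k (D : set V) (f : V -> W) :
  open D -> Ck k D f -> Ck k D (fun x => - f x).
Proof.
move=> oD Hf; under eq_fun do rewrite -scaleN1r.
by apply: Ck_scale => //; exact: Ck_cst.
Qed.

(** The derivative is again a polynomial in 1/f and a derivative of f. *)
Lemma Ck_inv k (D : set V) (f : V -> R) : open D ->
  (forall x, D x -> f x != 0) -> Ck k D f -> Ck k D (fun x => (f x)^-1).
Proof.
move=> oD f0; elim: k => [Hf x Dx|k IH Hf].
  by apply: cvgV; [exact: f0|exact: Hf].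
split=> [x Dx|v]; first by apply: differentiableV; [exact: Hf.1|exact: f0].
apply: (@Ck_ext _ _ _ (fun x => - ((f x)^-1 * (f x)^-1 * 'D_v f x))) => //.
  move=> x Dx; rewrite deriveV ?f0//; last exact/diff_derivable/Hf.1.
  by rewrite scaleNr /= expr2 invfM.
apply: Ck_opp => //; apply: Ck_mul => //; last exact: Hf.2.
by apply: Ck_mul => //; apply: IH; exact: CkW.
Qed.

Lemma Ck_entry k (D : set V) m n (f : V -> 'M[R]_(m, n)) i j : open D ->
  Ck k D f -> Ck k D (fun x => f x i j).
Proof.
move=> oD Hf.
have lE : linear (fun M : 'M[R]_(m, n) => M i j : R).
  by move=> a x y; rewrite !mxE.
pose L := HB.pack_for {linear 'M[R]_(m, n) -> R} (fun M : 'M[R]_(m, n) => M i j : R)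
  (GRing.isLinear.Build _ _ _ _ _ lE).
by apply: (@Ck_lin _ _ _ _ L) => //; exact: coord_continuous.
Qed.

Lemma Ck_mx k (D : set V) m n (f : V -> 'M[R]_(m, n)) : open D ->
  (forall i j, Ck k D (fun x => f x i j)) -> Ck k D f.
Proof.
move=> oD H.
have -> : f = (fun x => \sum_i \sum_j f x i j *: delta_mx i j).
  by apply/funext => x; exact: matrix_sum_delta.
do 2!(apply: Ck_sum => // ?).
by apply: Ck_scale => //; exact: Ck_cst.
Qed.

Lemma Ck_prod k (D : set V) (I : finType) (f : I -> V -> R) :
  open D -> (forall i, Ck k D (f i)) -> Ck k D (fun x => \prod_i f i x).
Proof.
move=> oD H; elim: (index_enum I) => [|i s IH].
  under eq_fun do rewrite big_nil; exact: Ck_cst.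
by under eq_fun do rewrite big_cons; apply: Ck_mul.
Qed.

Lemma Ck_det k (D : set V) n (f : V -> 'M[R]_n) :
  open D -> Ck k D f -> Ck k D (fun x => \det (f x)).
Proof.
move=> oD Hf; apply: Ck_sum => // s; apply: Ck_mul => //; first exact: Ck_cst.
by apply: Ck_prod => // i; exact: Ck_entry.
Qed.

(** Cramer's rule reduces this to determinants and a scalar inverse. *)
Lemma Ck_invmx k (D : set V) n (f : V -> 'M[R]_n) : open D ->
  (forall x, D x -> f x \in unitmx) -> Ck k D f -> Ck k D (fun x => invmx (f x)).
Proof.
move=> oD fu Hf.
apply: (@Ck_ext _ _ _ (fun x => (\det (f x))^-1 *: \adj (f x))) => //.
  by move=> x Dx; rewrite /invmx fu.
apply: Ck_scale => //.
  apply: Ck_inv => //; last exact: Ck_det.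
  by move=> x /fu; rewrite unitmxE unitfE.
apply: Ck_mx => // i j; under eq_fun do rewrite mxE /cofactor.
apply: Ck_mul => //; first exact: Ck_cst.
apply: Ck_det => //; apply: Ck_mx => // i' j'; under eq_fun do rewrite !mxE.
exact: Ck_entry.
Qed.

Lemma Ck_tr k (D : set V) m n (f : V -> 'M[R]_(m, n)) : open D ->
  Ck k D f -> Ck k D (fun x => (f x)^T).
Proof.
move=> oD Hf; apply: Ck_mx => // i j; under eq_fun do rewrite mxE.
exact: Ck_entry.
Qed.

(** The chain rule in coordinates: derivatives of f o h are sums of products of
    entries of D h with partial derivatives of f composed with h. *)
Lemma Ck_comp (W : normedModType R) k m (D : set V) (E : set 'rV[R]_m)
    (h : V -> 'rV[R]_m) (f : 'rV[R]_m -> W) :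
  open D -> (forall x, D x -> E (h x)) -> Ck k D h -> Ck k E f ->
  Ck k D (fun x => f (h x)).
Proof.
move=> oD DE; elim: k f => [f Hh Hf x Dx|k IH f Hh Hf].
  by apply: (continuous_comp (Hh x Dx)); exact/Hf/DE.
split=> [x Dx|v].
  by apply: (differentiable_comp (Hh.1 x Dx)); exact/Hf.1/DE.
apply: (@Ck_ext _ _ _ (fun x => \sum_i ('D_v h x) 0 i *: 'D_(delta_mx 0 i) f (h x))) => //.
  move=> x Dx; have dh := Hh.1 x Dx; have df := Hf.1 _ (DE _ Dx).
  by rewrite -derive_rV// -(derive_compE v dh df).
apply: Ck_sum => // i; apply: Ck_scale => //.
  by apply: Ck_entry => //; exact: Hh.2.
by apply: (IH ('D_(delta_mx 0 i) f)); [exact: CkW|exact: Hf.2].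
Qed.

Lemma Ck_id k (D : set V) : Ck k D (fun x => x).
Proof.
case: k => [x _|k]; first exact: cvg_id.
split=> [x _|v].
  by apply: (@linear_differentiable _ _ _ idfun) => y; exact: cvg_id.
have -> : 'D_v (fun x : V => x) = (fun _ => v).
  by apply/funext => x; exact: derive_id.
exact: Ck_cst.
Qed.

End Ck.

(** * Mean value inequalities *)

Lemma filter_forall_nbhs (T : topologicalType) (I : finType) (P : I -> T -> Prop) (x : T) :
  (forall i, \forall y \near x, P i y) -> \forall y \near x, forall i, P i y.
Proof. exact: filter_forall. Qed.

Section MeanValue.
Context (R : realType) (n m : nat).
Implicit Types (f : 'rV[R]_n -> 'rV[R]_m).

Lemma is_derive_line (V W : normedModType R) (f : V -> W) (x v : V) (t : R) :
  differentiable f (x + t *: v) ->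
  is_derive t 1 (fun s => f (x + s *: v)) ('D_v f (x + t *: v)).
Proof.
move=> df.
pose l : R -> V := fun s => x + s *: v.
have [dl dlE] : differentiable l t /\ 'd l t = (fun s : R => s *: v) :> (R -> V).
  have dc : differentiable (cst x : R -> V) t by exact: differentiable_cst.
  have di : differentiable (fun s : R => s) t by apply/derivable1_diffP; exact: derivable_id.
  have dv : differentiable (fun s : R => s *: v) t by exact: differentiableZl.
  split; first exact: differentiableD.
  have -> : l = cst x + (fun s => s *: v) by [].
  rewrite diffD// diff_cst diffZl//; apply/funext => s.
  by rewrite -[LHS]/(0 + 'd (fun s : R => s) t s *: v) add0r -deriveE// derive_id.
have d : differentiable (f \o l) t by apply: differentiable_comp.
apply: DeriveDef; first exact: diff_derivable.
rewrite -[LHS]/('D_1 (f \o l) t) derive_compE//.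
by congr ('D_ _ f _); rewrite deriveE// dlE scale1r.
Qed.

Lemma mx_norm_entry (p q : nat) (M : 'M[R]_(p, q)) i j : `|M i j| <= `|M|.
Proof.
rewrite [leRHS]/Num.Def.normr/= mx_normrE.
by apply: le_trans (le_bigmax _ _ (i, j)).
Qed.

Lemma mx_norm_le (p q : nat) (M : 'M[R]_(p, q)) (c : R) : 0 <= c ->
  (forall i j, `|M i j| <= c) -> `|M| <= c.
Proof.
move=> c0 H; rewrite /Num.Def.normr/= mx_normrE.
by apply: bigmax_le => // i _; exact: H.
Qed.

(** The norm is the maximum norm, so the scalar theorem applies entry by entry. *)
Lemma MVT_norm (y : R -> 'rV[R]_m) (dy : R -> 'rV[R]_m) (a b c : R) : a <= b -> 0 <= c ->
  (forall t, t \in `]a, b[ -> is_derive t 1 y (dy t)) ->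
  {within `[a, b], continuous y} ->
  (forall t, t \in `]a, b[ -> `|dy t| <= c) ->
  `|y b - y a| <= c * (b - a).
Proof.
rewrite le_eqVlt => /predU1P[->|ab] c0 H cy dc; first by rewrite !subrr normr0 mulr0.
apply: mx_norm_le => [|i j]; first by rewrite mulr_ge0// subr_ge0 ltW.
have Hi t : t \in `]a, b[ -> is_derive t 1 (fun s => y s i j) (dy t i j).
  move=> /H[dt dE]; apply: DeriveDef; first by move/derivable_mxP : dt; apply.
  by have := derive_mx dt; rewrite dE => ->; rewrite mxE.
have ci : {within `[a, b], continuous (fun s => y s i j)}.
  move=> t; have := cy t; exact: cvg_coord.
have [s sab e] := MVT ab Hi ci.
rewrite !mxE e normrM (gtr0_norm (_ : 0 < b - a)) ?subr_gt0//.
apply: ler_wpM2r; first by rewrite subr_ge0 ltW.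
exact: le_trans (mx_norm_entry _ _ _) (dc _ sab).
Qed.

(** Restrict f to the segment from x to y. *)
Lemma lipschitz_convex (f : 'rV[R]_n -> 'rV[R]_m) (B : set 'rV[R]_n) (c : R) : 0 <= c ->
  (forall x y t, B x -> B y -> 0 <= t <= 1 -> B (x + t *: (y - x))) ->
  (forall x, B x -> differentiable f x) ->
  (forall x v, B x -> `|'D_v f x| <= c * `|v|) ->
  forall x y, B x -> B y -> `|f y - f x| <= c * `|y - x|.
Proof.
move=> c0 cB df Df x y Bx By.
have H (t : R) : 0 <= t <= 1 -> is_derive t 1 (fun s => f (x + s *: (y - x)))
    ('D_(y - x) f (x + t *: (y - x))).
  by move=> t01; apply/is_derive_line/df/cB.
have := @MVT_norm (fun s => f (x + s *: (y - x)))
  (fun t => 'D_(y - x) f (x + t *: (y - x))) 0 1 (c * `|y - x|) ler01.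
rewrite scale0r addr0 scale1r (addrC x) subrK subr0 mulr1; apply.
- by rewrite mulr_ge0.
- by move=> t; rewrite in_itv /= => /andP[t0 t1]; apply: H; rewrite !ltW.
- apply: derivable_within_continuous => t; rewrite in_itv/= => t01.
  by have [] := H t t01.
- move=> t; rewrite in_itv/= => /andP[t0 t1]; apply/Df/cB => //.
  by rewrite !ltW.
Qed.

Lemma ball_convex (x0 : 'rV[R]_n) (r : R) x y t : `|x - x0| < r -> `|y - x0| < r ->
  0 <= t <= 1 -> `|x + t *: (y - x) - x0| < r.
Proof.
move=> xr yr /andP[t0 t1].
have -> : x + t *: (y - x) - x0 = (1 - t) *: (x - x0) + t *: (y - x0).
  rewrite scalerBl scale1r !scalerBr opprB !addrA.
  by rewrite -[RHS]addrA -/(_ + _) [in RHS]addrA; apply/rowP => i; rewrite !mxE; ring.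
apply: le_lt_trans (ler_normD _ _) _; rewrite !normrZ ger0_norm ?subr_ge0// ger0_norm//.
have [->|tn1] := eqVneq t 1; first by rewrite subrr mul0r add0r mul1r.
have t1' : 0 < 1 - t by rewrite subr_gt0 lt_neqAle tn1.
have -> : r = (1 - t) * r + t * r by ring.
by rewrite ltr_leD// ?ltr_pM2l// ler_wpM2l// ltW.
Qed.

(** Only the n coordinate directions have to be controlled, at the price of
    dividing e by n + 1. *)
Lemma C1_near (W : normedModType R) (D : set 'rV[R]_n) (f : 'rV[R]_n -> W) (x0 : 'rV[R]_n) (e : R) : open D ->
  Ck 1 D f -> D x0 -> 0 < e ->
  \forall x \near x0, forall v, `|'D_v f x - 'D_v f x0| <= e * `|v|.
Proof.
move=> oD [df cf] Dx0 e0.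
have Dn : \forall x \near x0, D x by exact: open_nbhs_nbhs.
have e'0 : 0 < e / n.+1%:R by rewrite divr_gt0.
have H : \forall x \near x0, forall i : 'I_n,
    `|'D_(delta_mx 0 i) f x - 'D_(delta_mx 0 i) f x0| <= e / n.+1%:R.
  apply: filter_forall_nbhs => i.
  by have /cvgrPdist_le/(_ _ e'0) := cf (delta_mx 0 i) x0 Dx0; apply: filterS => x; rewrite distrC.
near=> x => v.
have Dx : D x by near: x.
rewrite (derive_rV v (df _ Dx)) (derive_rV v (df _ Dx0)) -sumrB.
apply: le_trans (ler_norm_sum _ _ _) _.
apply: (@le_trans _ _ (\sum_(i < n) (`|v| * (e / n.+1%:R)))).
  apply: ler_sum => i _; rewrite -scalerBr normrZ ler_pM// ?mx_norm_entry//.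
  by move: i; near: x.
rewrite sumr_const card_ord -[X in X <= _]mulr_natr -mulrA [leRHS]mulrC ler_wpM2l//.
by rewrite mulrAC ler_pdivrMr// ler_wpM2l ?ler_nat// ltW.
Unshelve. all: by end_near. Qed.

End MeanValue.

(** * Symmetry of second derivatives *)

Section Schwarz.
Context (R : realType) (n : nat).

(** Two applications of the mean value theorem, in the v direction and then
    in the w direction. *)
Lemma second_difference (f : 'rV[R]_n -> R) (x v w : 'rV[R]_n) (D : set 'rV[R]_n) (s : R) :
  Ck 2 D f -> 0 < s ->
  (forall a b, 0 <= a <= s -> 0 <= b <= s -> D (x + a *: v + b *: w)) ->
  exists a b, [/\ 0 <= a <= s, 0 <= b <= s &
    f (x + s *: v + s *: w) - f (x + s *: v) - f (x + s *: w) + f x =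
    s * s * 'D_w ('D_v f) (x + a *: v + b *: w)].
Proof.
move=> [df cf] s0 HD; have dfv := (cf v).1.
pose phi (a : R) := f (x + s *: w + a *: v) - f (x + a *: v).
have D0 (a : R) : 0 <= a <= s -> D (x + a *: v).
  move=> a0; have := HD a 0 a0; rewrite scale0r addr0 lexx; apply.
  exact: ltW.
have Ds (a : R) : 0 <= a <= s -> D (x + s *: w + a *: v).
  by move=> a0; rewrite addrAC; apply: HD => //; rewrite lexx ltW.
have dphi (a : R) : 0 <= a <= s ->
    is_derive a 1 phi ('D_v f (x + s *: w + a *: v) - 'D_v f (x + a *: v)).
  by move=> a0; apply: is_deriveB; apply: is_derive_line; apply: df; [exact: Ds|exact: D0].
have cphi : {within `[0, s], continuous phi}.
  by apply: derivable_within_continuous => t; rewrite in_itv => /dphi[].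
have [t|a] := @MVT R phi (fun a => 'D_v f (x + s *: w + a *: v) - 'D_v f (x + a *: v)) 0 s s0 _ cphi.
  by rewrite in_itv => /andP[t0 ts]; apply: dphi; rewrite !ltW.
rewrite in_itv/= => /andP[a0 as_]; have a0s : 0 <= a <= s by rewrite !ltW.
rewrite subr0 => ephi.
pose psi (b : R) := 'D_v f (x + a *: v + b *: w).
have dpsi (b : R) : 0 <= b <= s -> is_derive b 1 psi ('D_w ('D_v f) (x + a *: v + b *: w)).
  by move=> b0; apply: is_derive_line; apply: dfv; exact: HD.
have cpsi : {within `[0, s], continuous psi}.
  by apply: derivable_within_continuous => b; rewrite in_itv => /dpsi[].
have [t|b] := @MVT R psi (fun b => 'D_w ('D_v f) (x + a *: v + b *: w)) 0 s s0 _ cpsi.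
  by rewrite in_itv => /andP[t0 ts]; apply: dpsi; rewrite !ltW.
rewrite in_itv/= => /andP[b0 bs] epsi; exists a, b; split; rewrite ?ltW//.
move: ephi epsi; rewrite /phi /psi !scale0r !addr0 subr0 (addrAC x (a *: v)) => ephi epsi.
rewrite (addrAC x (s *: v)) -mulrA mulrC (mulrC s) -epsi -ephi.
by ring.
Qed.

(** The second difference is symmetric in v and w, so small squares give points
    arbitrarily close to x at which the two mixed derivatives agree. *)
Lemma schwarz_scalar (f : 'rV[R]_n -> R) (D : set 'rV[R]_n) (x v w : 'rV[R]_n) :
  open D -> Ck 2 D f -> D x -> 'D_w ('D_v f) x = 'D_v ('D_w f) x.
Proof.
move=> oD Cf Dx.
have cvw (u u' : 'rV[R]_n) : {for x, continuous ('D_u' ('D_u f))}.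
  by have [_ /(_ u) [_ /(_ u')]] := Cf; exact.
apply/eqP; rewrite -subr_eq0 -normr_le0; apply/ler_addgt0Pr => e e0; rewrite add0r.
have e2 : 0 < e / 2 by rewrite divr_gt0.
have nb : \forall y \near x, [/\ D y, `|'D_w ('D_v f) x - 'D_w ('D_v f) y| <= e / 2
    & `|'D_v ('D_w f) x - 'D_v ('D_w f) y| <= e / 2].
  have Dn : \forall y \near x, D y by exact: open_nbhs_nbhs.
  have /cvgrPdist_le/(_ _ e2) h1 := cvw v w.
  have /cvgrPdist_le/(_ _ e2) h2 := cvw w v.
  apply: (@filterS _ (nbhs x) _ _ _ _ (filterI Dn (filterI h1 h2))) => y [Dy [a b]].
  by split; [exact: Dy|exact: a|exact: b].
have /nbhs_normP[r /= r0 br] := nb.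
pose s := r / (2 * (1 + `|v| + `|w|)).
have N0 : 0 < 1 + `|v| + `|w| by rewrite ltr_wpDr// ltr_wpDr.
have s0 : 0 < s by rewrite divr_gt0// mulr_gt0.

have HB (a b : R) : 0 <= a <= s -> 0 <= b <= s -> `|x - (x + a *: v + b *: w)| < r.
  move=> /andP[a0 as_] /andP[b0 bs].
  rewrite -(addrA x) opprD addrA subrr sub0r normrN.
  apply: le_lt_trans (ler_normD _ _) _; rewrite !normrZ !ger0_norm//.
  apply: (@le_lt_trans _ _ (s * (1 + `|v| + `|w|))).
    rewrite !mulrDr mulr1 -addrA ler_wpDl ?(ltW s0)//.
    by rewrite lerD// ler_wpM2r.
  by rewrite /s invfM mulrA mulfVK ?gt_eqF// ltr_pdivrMr// ltr_pMr// ltr1n.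
have HB' (a b : R) : 0 <= a <= s -> 0 <= b <= s -> `|x - (x + a *: w + b *: v)| < r.
  by move=> a0 b0; rewrite addrAC; exact: HB.
have [a [b [a0 b0 e1]]] := @second_difference f x v w D s Cf s0
  (fun a b a0 b0 => let: And3 h _ _ := br _ (HB a b a0 b0) in h).
have [a' [b' [a0' b0' e1']]] := @second_difference f x w v D s Cf s0
  (fun a b a0 b0 => let: And3 h _ _ := br _ (HB' a b a0 b0) in h).
have ee : 'D_w ('D_v f) (x + a *: v + b *: w) = 'D_v ('D_w f) (x + a' *: w + b' *: v).
  apply: (@mulfI _ (s * s)); first by rewrite mulf_neq0// gt_eqF.
  apply: etrans (esym e1) _; apply: etrans _ e1'; rewrite (addrAC x (s *: w)).
  by move: (f _) (f _) (f _) (f _) => A1 A2 A3 A4; ring.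
have [_ h1 _] := br _ (HB a b a0 b0); have [_ _ h2] := br _ (HB' a' b' a0' b0').
rewrite -ee in h2.
have tri (A B C : R) : `|A - C| <= e / 2 -> `|B - C| <= e / 2 -> `|A - B| <= e.
  move=> k1 k2; rewrite -(subrKA C) -[C - B]opprB.
  by apply: le_trans (ler_normB _ _) _; rewrite (splitr e); exact: lerD.
exact: tri h1 h2.
Unshelve. all: by end_near. Qed.

Lemma schwarz m (f : 'rV[R]_n -> 'rV[R]_m) (D : set 'rV[R]_n) (x v w : 'rV[R]_n) :
  open D -> Ck 2 D f -> D x -> 'D_w ('D_v f) x = 'D_v ('D_w f) x.
Proof.
move=> oD Cf Dx; apply/rowP => i.
have Ce : Ck 2 D (fun y => f y 0 i) by exact: Ck_entry.
have dD (u : 'rV[R]_n) (y : 'rV[R]_n) : D y -> 'D_u f y 0 i = 'D_u (fun y => f y 0 i) y.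
  by move=> Dy; rewrite derive_mx ?mxE//; apply: diff_derivable; exact: Cf.1.
have ddD (u u' : 'rV[R]_n) : 'D_u' ('D_u f) x 0 i = 'D_u' ('D_u (fun y => f y 0 i)) x.
  rewrite derive_mx ?mxE//; last by apply: diff_derivable; exact: (Cf.2 u).1.
  apply: near_eq_derive; have : \forall y \near x, D y by exact: open_nbhs_nbhs.
  by apply: filterS => y /dD.
apply: etrans (ddD v w) _; apply: etrans (esym (ddD w v)).
exact: (schwarz_scalar v w oD Ce Dx).
Qed.

End Schwarz.

(** * Derivatives along a time interval *)

Section DerivIn.
Context (R : realType).
Implicit Types (I : set R).

(** The relational form of deriv_in: it can be transported along the rules of
    calculus, and the value of deriv_in is extracted only at the end. *)
Definition is_deriv_in (V : normedModType R) I (f : R -> V) (t : R) (l : V) : Prop :=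
  diff_quot f t s @[s --> within I t^'] --> l.

(** This form makes no case distinction between interior and end points. *)
Lemma is_deriv_inP (V : normedModType R) I (f : R -> V) (t : R) (l : V) :
  is_deriv_in I f t l <->
  forall e : R, 0 < e ->
    \forall s \near t, I s -> `|f s - f t - (s - t) *: l| <= e * `|s - t|.
Proof.
split=> [/cvgrPdist_le H e e0|H].
  have := H e e0; rewrite !near_withinE; apply: filterS => s Hs Is.
  have [->|st] := eqVneq s t; first by rewrite !subrr scale0r subr0 !normr0 mulr0.
  have st0 : s - t != 0 by rewrite subr_eq0.
  have := Hs st Is; rewrite /diff_quot distrC => h.
  have -> : f s - f t - (s - t) *: l = (s - t) *: ((s - t)^-1 *: (f s - f t) - l).
    by rewrite scalerBr scalerA mulfV// scale1r.
  by rewrite normrZ mulrC ler_wpM2r.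
apply/cvgrPdist_le => e e0; rewrite !near_withinE.
apply: filterS (H e e0) => s Hs st Is.
have st0 : s - t != 0 by rewrite subr_eq0.
have := Hs Is; rewrite /diff_quot distrC => h.
rewrite -(@ler_pM2r _ `|s - t|) ?normr_gt0// mulrC -normrZ scalerBr scalerA.
by rewrite mulfV// scale1r.
Qed.

(** A nondegenerate interval accumulates at each of its points, so one-sided
    derivatives are unique. *)
Lemma time_interval_proper I t : time_interval I -> I t ->
  ProperFilter (within I t^').
Proof.
move=> [itv [a [b [Ia Ib ab]]]] It.
have [c Ic ct] : exists2 c, I c & c != t.
  have [<-|] := eqVneq a t; last by exists a.
  by exists b; rewrite // gt_eqF.
have FF : Filter (within I t^') by exact: within_filter.
apply: Build_ProperFilter.
rewrite -[within _ _ _]/(\forall s \near within I t^', False) !near_withinE.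
move=> /nbhs_ballP[e /= e0 He].
pose k := Num.min 1 (e / 2 / `|c - t|).
have n0 : 0 < `|c - t| by rewrite normr_gt0 subr_eq0.
have k0 : 0 < k by rewrite lt_min ltr01 !divr_gt0.
have k1 : k <= 1 by rewrite ge_min lexx.
pose s := t + k * (c - t).
have st : s != t.
  by rewrite -subr_eq0 /s addrAC subrr add0r mulf_neq0 ?subr_eq0// gt_eqF.
apply: (He s) => //.
  rewrite /ball/= /s opprD addrA subrr sub0r normrN normrM gtr0_norm//.
  apply: (@le_lt_trans _ _ (e / 2)); last by rewrite ltr_pdivrMr// ltr_pMr// ltr1n.
  by rewrite -ler_pdivlMr// ge_min lexx orbT.
have [tc|ct'] := leP t c.
  by apply: (itv t c) => //; apply/andP; rewrite /s; split; nra.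
by apply: (itv c t) => //; apply/andP; rewrite /s; split; nra.
Qed.

Lemma deriv_inE (V : normedModType R) I (f : R -> V) t l : time_interval I -> I t ->
  is_deriv_in I f t l -> deriv_in I f t = l.
Proof.
move=> TI It H; have pf := time_interval_proper TI It.
by apply: cvg_lim => //; exact: norm_hausdorff.
Qed.

Lemma is_deriv_in_derivable (V : normedModType R) I (f : R -> V) t l :
  is_deriv_in I f t l -> derivable_in I f t.
Proof. by move=> H; apply/cvg_ex; exists l. Qed.

Lemma derivable_in_is (V : normedModType R) I (f : R -> V) t :
  derivable_in I f t -> is_deriv_in I f t (deriv_in I f t).
Proof. by []. Qed.

Lemma is_deriv_in_bound (V : normedModType R) I (f : R -> V) t l :
  is_deriv_in I f t l ->
  \forall s \near t, I s -> `|f s - f t| <= (`|l| + 1) * `|s - t|.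
Proof.
move=> /is_deriv_inP/(_ 1 ltr01); apply: filterS => s H Is.
rewrite -[f s - f t](subrK ((s - t) *: l)).
apply: le_trans (ler_normD _ _) _; rewrite mulrDl addrC lerD//; last exact: H.
by rewrite normrZ mulrC.
Qed.

Lemma is_deriv_in_cont (V : normedModType R) I (f : R -> V) t l :
  is_deriv_in I f t l -> cont_in I f t.
Proof.
move=> /is_deriv_in_bound H; apply/cvgrPdist_le => e e0; rewrite near_withinE.
have K0 : 0 < `|l| + 1 by rewrite ltr_wpDl.
have small : \forall s \near t, `|s - t| <= e / (`|l| + 1).
  near=> s; rewrite distrC; near: s; apply: cvgr_dist_le; first exact: cvg_id.
  by rewrite divr_gt0.
apply: filterS2 H small => s Hs Ss Is; rewrite distrC.
by apply: le_trans (Hs Is) _; rewrite mulrC -ler_pdivlMr.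
Unshelve. all: by end_near. Qed.

Lemma is_deriv_in_ext (V : normedModType R) I (f g : R -> V) t l :
  (\forall s \near t, I s -> f s = g s) -> I t ->
  is_deriv_in I f t l -> is_deriv_in I g t l.
Proof.
move=> fg It /is_deriv_inP H; apply/is_deriv_inP => e e0.
have ft := nbhs_singleton fg It.
apply: filterS2 fg (H e e0) => s fgs Hs Is.
by rewrite -ft -fgs//; exact: Hs.
Qed.

Lemma is_deriv_in_comp (V W : normedModType R) I (y : R -> V) (f : V -> W) t l :
  is_deriv_in I y t l -> differentiable f (y t) ->
  is_deriv_in I (fun s => f (y s)) t ('D_l f (y t)).
Proof.
move=> Hy df; rewrite deriveE//; apply/is_deriv_inP => e e0.
have [K K0 HK] := linear_lipschitz (diff_continuous df).
have Kl : 0 < `|l| + 1 by rewrite ltr_wpDl.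
have e1 : 0 < e / 2 / (`|l| + 1) by rewrite !divr_gt0.
have e2 : 0 < e / 2 / K by rewrite !divr_gt0.
have cy : y s @[s --> within I (nbhs t)] --> y t by exact: is_deriv_in_cont Hy.
have h1 : \forall s \near t, I s -> `|f (y s) - f (y t) - 'd f (y t) (y s - y t)|
    <= e / 2 / (`|l| + 1) * `|y s - y t|.
  exact: cy (diff_eps df e1).
have h2 := is_deriv_in_bound Hy.
have /is_deriv_inP/(_ _ e2) h3 := Hy.
apply: filterS3 h1 h2 h3 => s H1 H2 H3 Is.
move: (H1 Is) (H2 Is) (H3 Is) => {}H1 {}H2 {}H3.
have -> : f (y s) - f (y t) - (s - t) *: 'd f (y t) l =
    (f (y s) - f (y t) - 'd f (y t) (y s - y t)) +
    'd f (y t) (y s - y t - (s - t) *: l).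
  rewrite (_ : 'd f (y t) (y s - y t - (s - t) *: l) =
    'd f (y t) (y s - y t) - (s - t) *: 'd f (y t) l).
    by rewrite addrA subrK.
  by rewrite -linearZ -linearB.
apply: le_trans (ler_normD _ _) _; rewrite [e]splitr mulrDl lerD//.
  apply: le_trans H1 _; rewrite -mulrA ler_pM2l ?divr_gt0//.
  by rewrite mulrC ler_pdivrMr// mulrC.
apply: le_trans (HK _) _; rewrite mulrC -ler_pdivlMr// mulrAC; exact: H3.
Qed.

Lemma is_deriv_in_lin (V W : normedModType R) (L : {linear V -> W}) I (f : R -> V) t l :
  continuous L -> is_deriv_in I f t l -> is_deriv_in I (fun s => L (f s)) t (L l).
Proof.
move=> cL H; have dL := linear_differentiable (f t) cL.
by have := is_deriv_in_comp H dL; rewrite deriveE// diff_lin.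
Qed.

Lemma is_deriv_in_pair (V W : normedModType R) I (f : R -> V) (g : R -> W) t l m :
  is_deriv_in I f t l -> is_deriv_in I g t m ->
  is_deriv_in I (fun s => (f s, g s)) t (l, m).
Proof.
move=> /is_deriv_inP Hf /is_deriv_inP Hg; apply/is_deriv_inP => e e0.
apply: filterS2 (Hf e e0) (Hg e e0) => s h1 h2 Is.
rewrite prod_normE/= ge_max.
by rewrite h1// h2.
Qed.

Lemma is_deriv_in_bilin (U1 U2 W : normedModType R) (B : {bilinear U1 -> U2 -> W})
    I (f : R -> U1) (g : R -> U2) t l m :
  continuous (fun p => B p.1 p.2) ->
  is_deriv_in I f t l -> is_deriv_in I g t m ->
  is_deriv_in I (fun s => B (f s) (g s)) t (B l (g t) + B (f t) m).
Proof.
move=> cB Hf Hg.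
have dB := differentiable_bilin (f t, g t) cB.
have := is_deriv_in_comp (is_deriv_in_pair Hf Hg) dB.
by rewrite deriveE// diff_bilin//= addrC.
Qed.

Lemma is_deriv_in_mulmx m n p I (f : R -> 'M[R]_(m, n)) (g : R -> 'M[R]_(n, p)) t
    (f' : 'M[R]_(m, n)) (g' : 'M[R]_(n, p)) :
  is_deriv_in I f t f' -> is_deriv_in I g t g' ->
  is_deriv_in I (fun s => f s *m g s) t (f' *m g t + f t *m g').
Proof. by move=> Hf Hg; apply: is_deriv_in_bilin Hf Hg; exact: mulmx_continuous. Qed.

Lemma is_deriv_in_cst (V : normedModType R) I (c : V) t : is_deriv_in I (fun _ => c) t 0.
Proof.
apply/is_deriv_inP => e e0; near=> s => _.
by rewrite subrr sub0r scaler0 oppr0 normr0 mulr_ge0// ltW.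
Unshelve. all: by end_near.
Qed.

Lemma is_derive_in (V : normedModType R) I (f : R -> V) (t : R) l :
  is_derive t 1 f l -> is_deriv_in I f t l.
Proof.
move=> [df dl]; apply/is_deriv_inP => e e0.
have dd : differentiable f t by apply/derivable1_diffP.
apply: filterS (diff_eps dd e0) => s Hs _.
suff -> : (s - t) *: l = 'd f t (s - t) by [].
by rewrite -[s - t in RHS]mulr1 -[_ * 1]/((s - t) *: 1) linearZ /= -deriveE// dl.
Qed.

Lemma is_deriv_in_derive (V : normedModType R) I (f : R -> V) (t : R) l :
  nbhs t I -> is_deriv_in I f t l -> is_derive t 1 f l.
Proof.
move=> nI /is_deriv_inP H.
pose L := ( *:%R^~ l : R -> V).
have lL : linear L by move=> a x y; rewrite /L scalerDl scalerA.
pose L' := HB.pack_for {linear R -> V} L (GRing.isLinear.Build _ _ _ _ _ lL).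
have [||df dE] := @eps_diff _ _ _ f t L'; first exact: scalel_continuous.
  move=> e e0; apply: filterS2 nI (H e e0) => s Is; exact.
apply: DeriveDef; first by apply/derivable1_diffP.
by rewrite deriveE// dE /L' /= /L scale1r.
Qed.

Lemma cont_in_within (T : topologicalType) I J (f : R -> T) :
  J `<=` I -> (forall t, J t -> cont_in I f t) -> {within J, continuous f}.
Proof.
move=> JI H; apply/subspace_continuousP => t Jt.
by apply: cvg_trans (H t Jt); apply: cvg_app; exact: within_subset.
Qed.

Lemma MVT_in m I (y dy : R -> 'rV[R]_m) (a b c : R) : is_interval I -> I a -> I b ->
  a <= b -> 0 <= c ->
  (forall t, a <= t <= b -> is_deriv_in I y t (dy t)) ->
  (forall t, a <= t <= b -> `|dy t| <= c) ->
  `|y b - y a| <= c * (b - a).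
Proof.
move=> itv Ia Ib ab c0 H dc.
have sub t : t \in `[a, b] -> I t by rewrite in_itv => t01; exact: (itv a b).
apply: (@MVT_norm _ _ y dy) => //.
- move=> t tab; apply: (@is_deriv_in_derive _ I).
    apply: filterS (near_in_itvoo tab) => s; rewrite in_itv => /andP[s1 s2].
    by apply: sub; rewrite in_itv/= !ltW.
  by apply: H; move: tab; rewrite in_itv => /andP[? ?]; rewrite !ltW.
- apply: (@cont_in_within _ I); first by move=> t; exact: sub.
  move=> t /=; rewrite in_itv => tab; exact: is_deriv_in_cont (H t tab).
- by move=> t; rewrite in_itv => /andP[? ?]; apply: dc; rewrite !ltW.
Qed.

(** Let the maximum of |y| between t0 and t be reached at s. If |t - t0| <= k
    with C k <= 1/2, the mean value inequality gives |y s| <= |y s| / 2. *)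
Lemma gronwall_zero m I (y dy : R -> 'rV[R]_m) (t0 C d : R) : is_interval I ->
  I t0 -> 0 <= C -> 0 < d -> y t0 = 0 ->
  (forall t, I t -> `|t - t0| < d -> is_deriv_in I y t (dy t)) ->
  (forall t, I t -> `|t - t0| < d -> `|dy t| <= C * `|y t|) ->
  \forall t \near t0, I t -> y t = 0.
Proof.
move=> itv It0 C0 d0 y0 H dC.
have C1 : 0 < C + 1 by rewrite ltr_wpDl.
(* C + 1 avoids a division by zero when C = 0. *)
pose k := Num.min (d / 2) (2^-1 / (C + 1)).
have k0 : 0 < k by rewrite lt_min !divr_gt0// invr_gt0.
have kd : k < d.
  by rewrite gt_min [d / 2 < d]ltr_pdivrMr// ltr_pMr// ltr1n.
have kC : C * k <= 2^-1.
  apply: (@le_trans _ _ ((C + 1) * k)); first by rewrite ler_wpM2r ?lerDl// ltW.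
  by rewrite mulrC -ler_pdivlMr// ge_min lexx orbT.
near=> t => It.
have tk : `|t - t0| < k by rewrite distrC; near: t; apply: cvgr_dist_lt; first exact: cvg_id.
pose a := Num.min t t0; pose b := Num.max t t0.
have Ia : I a by rewrite /a; case: leP.
have Ib : I b by rewrite /b; case: leP.
have ab : a <= b by rewrite /a /b ge_min le_max lexx.
have sub s : a <= s <= b -> I s by move=> sab; exact: (itv a b).
have near0 s : a <= s <= b -> `|s - t0| <= `|t - t0|.
  rewrite /a /b; case: (leP t t0) => tt0 /andP[s1 s2].
    by rewrite !ler0_norm ?subr_le0// lerN2 lerB.
  by rewrite !ger0_norm ?subr_ge0// ?lerB// ltW.
have cy : {within `[a, b], continuous (fun s => `|y s|)}.
  apply: (@cont_in_within _ I); first by move=> s /=; rewrite in_itv => /sub.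
  move=> s /=; rewrite in_itv => sab.
  apply: cvg_norm; apply: (is_deriv_in_cont (H _ _ _)); first exact: sub.
  by rewrite (le_lt_trans (near0 _ sab))// (lt_trans tk).
have [s sab smax] := EVT_max ab cy; rewrite in_itv/= in sab.
have t0ab : a <= t0 <= b by rewrite /a /b ge_min le_max lexx !orbT.
have tab : a <= t <= b by rewrite /a /b ge_min le_max lexx.
have c0 : 0 <= C * `|y s| by rewrite mulr_ge0.
have HH r : a <= r <= b -> is_deriv_in I y r (dy r).
  by move=> rab; apply: H; [exact: sub|rewrite (le_lt_trans (near0 _ rab))// (lt_trans tk)].
have DD r : a <= r <= b -> `|dy r| <= C * `|y s|.
  move=> rab; apply: le_trans (dC r _ _) _; first exact: sub.
    by rewrite (le_lt_trans (near0 _ rab))// (lt_trans tk).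
  by rewrite ler_wpM2l// smax// in_itv.
have ys : `|y s| <= C * `|y s| * `|s - t0|.
  have Is := sub _ sab.
  have [st|ts] := leP t0 s.
    have := @MVT_in _ I y dy t0 s (C * `|y s|) itv It0 Is st c0.
    rewrite y0 subr0 ger0_norm ?subr_ge0//; apply=> r /andP[r1 r2]; [apply: HH|apply: DD];
      by case/andP: sab t0ab => s1 s2 /andP[t1 t2]; rewrite (le_trans t1)//= (le_trans r2).
  have := @MVT_in _ I y dy s t0 (C * `|y s|) itv Is It0 (ltW ts) c0.
  rewrite y0 sub0r normrN ltr0_norm ?subr_lt0// opprB; apply=> r /andP[r1 r2]; [apply: HH|apply: DD];
    by case/andP: sab t0ab => s1 s2 /andP[t1 t2]; rewrite (le_trans s1)//= (le_trans r2).
have ys0 : `|y s| <= 0.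
  have : `|y s| <= 2^-1 * `|y s|.
    apply: le_trans ys _; rewrite mulrAC ler_wpM2r// (le_trans _ kC)// ler_wpM2l//.
    by rewrite (le_trans (near0 _ sab))// ltW.
  rewrite -subr_le0 -[X in X - _]mul1r -mulrBl => h.
  by rewrite -(@pmulr_rle0 _ (1 - 2^-1))// subr_gt0 invf_lt1// ltr1n.
by apply/eqP; rewrite -normr_le0 (le_trans _ ys0)// smax// in_itv.
Unshelve. all: by end_near. Qed.

End DerivIn.

Lemma cont_in_bounded (R : realType) (V : normedModType R) (I : set R) (f : R -> V) t :
  cont_in I f t -> \forall s \near t, I s -> `|f s| <= `|f t| + 1.
Proof.
move=> cf; have cn : `|f s| @[s --> within I (nbhs t)] --> `|f t| by exact: cvg_norm.
have h : `|f t| < `|f t| + 1 by rewrite ltrDl.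
by have := cvgr_le _ cn _ h; rewrite near_withinE; apply.
Qed.

Lemma gronwall_near (R : realType) m (I : set R) (y dy : R -> 'rV[R]_m) (t0 C : R) :
  is_interval I -> I t0 -> 0 <= C -> y t0 = 0 ->
  (\forall t \near t0, I t -> is_deriv_in I y t (dy t) /\ `|dy t| <= C * `|y t|) ->
  \forall t \near t0, I t -> y t = 0.
Proof.
move=> itv It0 C0 y0 /nbhs_ballP[dd /= dd0 Hd].
apply: (@gronwall_zero _ _ I y dy t0 C dd) => // t It td.
  by apply: (Hd t _ It).1; rewrite /ball /= distrC.
by apply: (Hd t _ It).2; rewrite /ball /= distrC.
Qed.

(** Connectedness, for a predicate that is locally constant on I. *)
Lemma interval_clopen (R : realType) (I : set R) (P : R -> Prop) : is_interval I ->
  (forall t, I t -> (\forall s \near t, I s -> P s) \/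
                    (\forall s \near t, I s -> ~ P s)) ->
  forall t0 t, I t0 -> P t0 -> I t -> P t.
Proof.
move=> itv loc t0 t It0 Pt0 It.
have cI : connected I by exact/connected_intervalP.
pose C1 := [set s : R | I s -> P s]^°; pose C2 := [set s : R | I s -> ~ P s]^°.
have CP s : I s -> C1 s <-> P s.
  move=> Is; split=> [/interior_subset/(_ Is)//|Ps].
  by have [//|/nbhs_singleton/(_ Is)] := loc s Is.
suff e : [set s | I s /\ P s] = I by move: It; rewrite -e => -[].
apply: cI; first by exists t0.
  exists C1; first exact: open_interior.
  by apply/seteqP; split=> s [Is Hs]; split=> //; exact/CP.
exists (~` C2); first by apply: open_closedC; exact: open_interior.
apply/seteqP; split=> s [Is Hs]; split=> //.
  by move=> /interior_subset/(_ Is).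
have [/nbhs_singleton/(_ Is)//|nP] := loc s Is.
by exfalso; exact: Hs.
Qed.

(** * Ordinary differential equations *)

Section Primitive.
Context (R : realType).
Notation mu := (@lebesgue_measure R).

Lemma primitive_scalar (f : R -> R) (b : R) : 0 < b -> continuous f ->
  exists F : R -> R, F 0 = 0 /\ forall t : R, `|t| < b -> is_derive t 1 F (f t).
Proof.
move=> b0 cf; pose F (x : R) := (\int[mu]_(t in [set` `[- b, x]]) (f t))%R.
exists (fun x => F x - F 0); split=> [|t tb]; first by rewrite subrr.
have fi : mu.-integrable `[- b, b] (EFin \o f).
  apply: continuous_compact_integrable; first exact: segment_compact.
  by apply: continuous_subspaceT => x; exact: cf.
have [t1 t2] : - b < t /\ t < b by move: tb; rewrite ltr_norml => /andP.
have [dF eF] := continuous_FTC1_closed t2 fi t1 (cf t).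
have dF' : is_derive t 1 F (f t).
  exact: (DeriveDef dF (etrans (esym (derive1E _ _)) eF)).
by rewrite -[f t]subr0; apply: is_deriveB.
Qed.

Lemma is_derive_mx m n (f : R -> 'M[R]_(m, n)) (l : 'M[R]_(m, n)) (t : R) :
  (forall i j, is_derive t 1 (fun s => f s i j) (l i j)) -> is_derive t 1 f l.
Proof.
move=> H; have d : derivable f t 1 by apply/derivable_mxP => i j; have [] := H i j.
by apply: DeriveDef => //; rewrite derive_mx//; apply/matrixP => i j; rewrite mxE; have [] := H i j.
Qed.

Lemma primitive n (f : R -> 'rV[R]_n) (b : R) : 0 < b -> continuous f ->
  exists F : R -> 'rV[R]_n, F 0 = 0 /\ forall t : R, `|t| < b -> is_derive t 1 F (f t).
Proof.
move=> b0 cf.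
have /choice[F HF] : forall i : 'I_n, exists F : R -> R,
    F 0 = 0 /\ forall t : R, `|t| < b -> is_derive t 1 F (f t 0 i).
  move=> i; apply: primitive_scalar => // t; apply: cvg_coord; exact: cf.
exists (fun t => \row_i F i t); split.
  by apply/rowP => i; rewrite !mxE (HF i).1.
move=> t tb; apply: is_derive_mx => i j; rewrite (ord1 i).
under eq_fun do rewrite mxE; exact: (HF j).2.
Qed.

End Primitive.

Section Clamp.
Context (R : realType).

(** The nearest-point retraction on [a - r, a + r], used to turn local data into
    global data. *)
Definition clamp (a r x : R) : R := Num.max (a - r) (Num.min (a + r) x).

Lemma clamp_in (a r x : R) : 0 <= r -> `|clamp a r x - a| <= r.
Proof.
move=> r0; rewrite ler_distl /clamp le_max lexx /= ge_max ge_min lexx /= andbT.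
by rewrite lerBlDr -addrA lerDl addr_ge0.
Qed.

Lemma clamp_id (a r x : R) : `|x - a| <= r -> clamp a r x = x.
Proof.
rewrite ler_distl => /andP[h1 h2]; rewrite /clamp (min_idPr h2).
exact: max_idPr.
Qed.

Lemma clamp_lip a r x y : `|clamp a r x - clamp a r y| <= `|x - y|.
Proof.
have max_lip (c u v d : R) : `|u - v| <= d -> `|Num.max c u - Num.max c v| <= d.
  rewrite !ler_norml => /andP[d1 d2]; apply/andP.
  by case: (leP c u) => ?; case: (leP c v) => ?; split; lra.
have min_lip (c u v d : R) : `|u - v| <= d -> `|Num.min c u - Num.min c v| <= d.
  rewrite !ler_norml => /andP[d1 d2]; apply/andP.
  by case: (leP c u) => ?; case: (leP c v) => ?; split; lra.
exact/max_lip/min_lip.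

Qed.

Definition clampv n (a : 'rV[R]_n) (r : R) (x : 'rV[R]_n) : 'rV[R]_n :=
  \row_i clamp (a 0 i) r (x 0 i).

Lemma clampv_in n (a : 'rV[R]_n) r x : 0 <= r -> `|clampv a r x - a| <= r.
Proof.
by move=> r0; apply: mx_norm_le => // i j; rewrite (ord1 i) !mxE clamp_in.
Qed.

Lemma clampv_id n (a : 'rV[R]_n) r x : `|x - a| <= r -> clampv a r x = x.
Proof.
move=> xr; apply/rowP => i; rewrite mxE clamp_id//.
by apply: le_trans xr; have := mx_norm_entry (x - a) 0 i; rewrite !mxE.
Qed.

Lemma clampv_lip n (a : 'rV[R]_n) r x y : `|clampv a r x - clampv a r y| <= `|x - y|.
Proof.
apply: mx_norm_le => // i j; rewrite (ord1 i) !mxE.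
apply: le_trans (clamp_lip _ _ _ _) _.
by have := mx_norm_entry (x - y) 0 j; rewrite !mxE.
Qed.

End Clamp.

HB.instance Definition _ (R : realType) (n : nat) := Complete.on 'rV[R]_n.

Section SeqLimit.
Context (R : realType) (n : nat).

(** The explicit distance to the limit serves to pass to the limit in fixed
    point equations. *)
Lemma geometric_cauchy (u : nat -> 'rV[R]_n) (C : R) : 0 <= C ->
  (forall k, `|u k.+1 - u k| <= C * (2^-1) ^+ k) ->
  exists l : 'rV[R]_n, u @ \oo --> l /\ forall k, `|l - u k| <= C * 2 * (2^-1) ^+ k.
Proof.
move=> C0 H.
have half : `|2^-1 : R| < 1 by rewrite ger0_norm ?invr_ge0// invf_lt1// ltr1n.
have cv : cvgn (series (telescope u)).
  apply: normed_cvg; apply: (series_le_cvg (v_ := geometric C 2^-1)) => k.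
  - exact: normr_ge0.
  - by rewrite /= mulr_ge0// exprn_ge0// invr_ge0.
  - exact: H.
  - exact: is_cvg_geometric_series.
have cu : u @ \oo --> u 0%N + limn (series (telescope u)).
  rewrite [X in X @ _ --> _](_ : u = (fun k => u 0%N + series (telescope u) k)).
    by apply: cvgD; [exact: cvg_cst|exact: cv].
  by apply/funext => k; exact: eq_sum_telescope.
exists (u 0%N + limn (series (telescope u))); split=> // k.
have B m : `|u (k + m)%N - u k| <= C * 2 * (2^-1) ^+ k * (1 - (2^-1) ^+ m).
  elim: m => [|m IH]; first by rewrite addn0 expr0 !subrr normr0 mulr0.
  rewrite addnS -(subrKA (u (k + m)%N)) addrC.
  apply: le_trans (ler_normD _ _) _; apply: le_trans (lerD IH (H _)) _.
  rewrite le_eqVlt; apply/orP; left; apply/eqP.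
  by rewrite exprD exprS; field.
have : \forall m \near \oo, `|u m - u k| <= C * 2 * (2^-1) ^+ k.
  exists k => // m /= km; rewrite -(subnKC km); apply: le_trans (B _) _.
  rewrite ler_piMr//; first by rewrite !mulr_ge0// exprn_ge0// invr_ge0.
move=> Hn; have cn : `|u m - u k| @[m --> \oo] --> `|u 0%N + limn (series (telescope u)) - u k|.
  by apply: cvg_norm; apply: cvgB; [exact: cu|exact: cvg_cst].
exact: ler_cvg_to cn (cvg_cst (C * 2 * 2^-1 ^+ k)) Hn.
Qed.

End SeqLimit.

Lemma le_geometric (R : realType) (a b D : R) : (forall k, a <= b + D * 2^-1 ^+ k) -> a <= b.
Proof.
move=> H; apply/ler_addgt0Pr => e e0.
have half : `|2^-1 : R| < 1 by rewrite ger0_norm ?invr_ge0// invf_lt1// ltr1n.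
have /cvgrPdist_le/(_ _ e0)[k _ /(_ k (leqnn k))] := cvg_geometric D half.
rewrite sub0r normrN /= => h; apply: le_trans (H k) _.
by rewrite lerD2l; apply: le_trans h; exact: ler_norm.
Qed.

Section Picard.
Context (R : realType) (n : nat).

Lemma lipschitz_continuous (V W : normedModType R) (f : V -> W) (K : R) : 0 <= K ->
  (forall x y, `|f x - f y| <= K * `|x - y|) -> continuous f.
Proof.
move=> K0 H x; apply/cvgrPdist_le => d d0; near=> y.
apply: le_trans (H _ _) _; apply: (@le_trans _ _ ((K + 1) * `|x - y|)).
  by rewrite ler_wpM2r// lerDl.
rewrite mulrC -ler_pdivlMr ?ltr_wpDl//; near: y.
by apply: cvgr_dist_le; [exact: cvg_id|rewrite divr_gt0// ltr_wpDl].
Unshelve. all: by end_near. Qed.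

Lemma displacement (F f : R -> 'rV[R]_n) (e c s t : R) : 0 <= c ->
  (forall r : R, `|r| <= e -> is_derive r 1 F (f r)) ->
  (forall r : R, `|r| <= e -> `|f r| <= c) ->
  `|s| <= e -> `|t| <= e -> `|F t - F s| <= c * `|t - s|.
Proof.
move=> c0 HF fc; wlog st : s t / s <= t.
  move=> H se te; have [st|/ltW ts] := leP s t; first exact: H.
  by rewrite distrC (distrC t); apply: H.
move=> se te; rewrite (ger0_norm (_ : 0 <= t - s)) ?subr_ge0//.
have se2 r : s <= r <= t -> `|r| <= e.
  move: se te; rewrite !ler_norml => /andP[s1 s2] /andP[t1 t2] /andP[r1 r2].
  by rewrite (le_trans s1)//= (le_trans r2).
apply: (@MVT_norm _ _ F f) => //.
- by move=> r; rewrite in_itv => /andP[? ?]; apply/HF/se2; rewrite !ltW.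
- by apply: derivable_within_continuous => r; rewrite in_itv => /se2/HF[].
- by move=> r; rewrite in_itv => /andP[? ?]; apply/fc/se2; rewrite !ltW.
Qed.

(** Picard iteration. The time argument of the primitives is clamped to [-e, e],
    so that all iterates are continuous on the whole line. *)
Lemma picard_lipschitz (Y : 'rV[R]_n -> 'rV[R]_n) (x0 : 'rV[R]_n) (K M e : R) :
  0 <= K -> 0 <= M ->
  (forall x y, `|Y x - Y y| <= K * `|x - y|) -> (forall x, `|Y x| <= M) ->
  0 < e -> e * K <= 2^-1 ->
  exists x : R -> 'rV[R]_n, x 0 = x0 /\
    forall t : R, `|t| < e -> is_derive t 1 x (Y (x t)).
Proof.
move=> K0 M0 YK YM e0 eK.
have Yc : continuous Y by exact: lipschitz_continuous YK.
pose tau := clamp (0 : R) e.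
have tau_e t : `|tau t| <= e by have := clamp_in 0 t (ltW e0); rewrite subr0.
have tau_id t : `|t| <= e -> tau t = t by move=> te; apply: clamp_id; rewrite subr0.
have ee1 : e < e + 1 by rewrite ltrDl.
have e1 : 0 < e + 1 by exact: lt_trans ee1.
(* A choice of primitives; only their derivatives on [-e, e] matter. *)
have [P HP] : exists P : (R -> 'rV[R]_n) -> R -> 'rV[R]_n, forall f, continuous f ->
    P f 0 = 0 /\ forall t : R, `|t| <= e -> is_derive t 1 (P f) (f t).
  have /choice[P HP] : forall f : R -> 'rV[R]_n, exists F : R -> 'rV[R]_n,
      continuous f -> F 0 = 0 /\ forall t : R, `|t| <= e -> is_derive t 1 F (f t).
    move=> f; have [cf|ncf] := pselect (continuous f); last by exists (fun _ => 0).
    have [F [F0 HF]] := primitive e1 cf; exists F => _; split=> // t te.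
    by apply: HF; exact: le_lt_trans ee1.
  by exists P.
pose T (f : R -> 'rV[R]_n) t := x0 + P (Y \o f) (tau t).
have cYf (f : R -> 'rV[R]_n) : continuous f -> continuous (Y \o f).
  by move=> cf t; apply: continuous_comp; [exact: cf|exact: Yc].
have norm0e : `|0 : R| <= e by rewrite normr0 ltW.
have T_lip (f : R -> 'rV[R]_n) s t : continuous f -> `|T f s - T f t| <= M * `|s - t|.
  move=> cf; rewrite /T addrAC opprD addrA subrr sub0r addrC.
  apply: (@le_trans _ _ (M * `|tau s - tau t|)); last by rewrite ler_wpM2l// clamp_lip.
  apply: (@displacement _ (Y \o f) e) => //; first exact: (HP _ (cYf _ cf)).2.
  by move=> r _; exact: YM.
have T_cont (f : R -> 'rV[R]_n) : continuous f -> continuous (T f).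
  by move=> cf; apply: (lipschitz_continuous M0) => s t; exact: T_lip.
have T_contr (f g : R -> 'rV[R]_n) c : continuous f -> continuous g -> 0 <= c ->
    (forall t, `|f t - g t| <= c) -> forall t, `|T f t - T g t| <= c / 2.
  move=> cf cg c0 fg t; rewrite /T addrAC opprD addrA subrr sub0r addrC.
  have := @displacement (fun r => P (Y \o f) r - P (Y \o g) r)
    (fun r => Y (f r) - Y (g r)) e (K * c) 0 (tau t) (mulr_ge0 K0 c0).
  rewrite (HP _ (cYf _ cf)).1 (HP _ (cYf _ cg)).1 subrr !subr0 => H.
  apply: le_trans (H _ _ norm0e (tau_e t)) _.
  - move=> r re; apply: is_deriveB; first exact: (HP _ (cYf _ cf)).2.
    exact: (HP _ (cYf _ cg)).2.
  - by move=> r _; apply: le_trans (YK _ _) _; rewrite ler_wpM2l.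
  apply: (@le_trans _ _ (K * c * e)); first by rewrite ler_wpM2l ?mulr_ge0.
  by rewrite (_ : K * c * e = c * (e * K)) ?ler_wpM2l//; ring.
pose u k := iter k T (fun _ => x0).
have u_cont k : continuous (u k).
  elim: k => [|k IH]; last exact: T_cont.
  by move=> t; exact: cvg_cst.
pose C := M * e.
have C0 : 0 <= C by rewrite mulr_ge0// ltW.
have u_step k t : `|u k.+1 t - u k t| <= C * 2^-1 ^+ k.
  elim: k t => [|k IH] t.
    rewrite /= /T addrC addKr expr0 mulr1.
    have := @displacement (P (Y \o (fun _ => x0))) (Y \o (fun _ => x0)) e M 0 (tau t) M0.
    rewrite (HP _ (cYf _ (u_cont 0%N))).1 !subr0 => H; apply: le_trans (H _ _ _ _) _ => //.
      exact: (HP _ (cYf _ (u_cont 0%N))).2.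
      by move=> r _; exact: YM.
    by rewrite ler_wpM2l.
  rewrite exprSr mulrA; apply: (T_contr _ _ _ (u_cont k.+1) (u_cont k) _ IH).
  by rewrite mulr_ge0// exprn_ge0// invr_ge0.
have /choice[x Hx] : forall t, exists l : 'rV[R]_n, (fun k => u k t) @ \oo --> l /\
    forall k, `|l - u k t| <= C * 2 * 2^-1 ^+ k.
  by move=> t; apply: geometric_cauchy.
have x_u t k : `|x t - u k t| <= C * 2 * 2^-1 ^+ k by exact: (Hx t).2.
have x_lip s t : `|x s - x t| <= M * `|s - t|.
  apply: (@le_geometric _ _ _ (C * 4)) => k.
  have -> : x s - x t = (x s - u k.+1 s) + (u k.+1 s - u k.+1 t) - (x t - u k.+1 t).
    by rewrite subrKA opprB addrA subrK.
  apply: le_trans (ler_normB _ _) _.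
  apply: le_trans (lerD (ler_normD _ _) (lexx _)) _.
  apply: le_trans (lerD (lerD (x_u _ _) (T_lip _ _ _ (u_cont k))) (x_u _ _)) _.
  rewrite addrAC addrC lerD2l exprS.
  by have : 0 <= C * 2^-1 ^+ k by [rewrite mulr_ge0// exprn_ge0// invr_ge0]; lra.
have x_cont : continuous x by exact: lipschitz_continuous x_lip.
have x_fix t : x t = T x t.
  apply/eqP; rewrite -subr_eq0 -normr_le0.
  apply: (@le_geometric _ _ _ (C * 4)) => k; rewrite add0r.
  rewrite -(subrKA (u k.+1 t)).
  apply: le_trans (ler_normD _ _) _.
  have h : `|u k.+1 t - T x t| <= C * 2 * 2^-1 ^+ k / 2.
    apply: (T_contr _ _ _ (u_cont k) x_cont) => [|s].
      apply: mulr_ge0; first exact: mulr_ge0.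
      by apply: exprn_ge0; rewrite invr_ge0.
    by rewrite distrC.
  apply: le_trans (lerD (x_u _ _) h) _; rewrite exprS.
  by have : 0 <= C * 2^-1 ^+ k by [rewrite mulr_ge0// exprn_ge0// invr_ge0]; lra.
exists x; split.
  by rewrite x_fix /T tau_id// (HP _ (cYf _ x_cont)).1 addr0.
move=> t te.
have near_t : \forall s \near t, x0 + P (Y \o x) s = x s.
  have : \forall s \near t, `|s| < e.
    have cn : `|s| @[s --> t] --> `|t| by apply: cvg_norm; exact: cvg_id.
    exact: cvgr_lt cn _ te.
  by apply: filterS => s se; rewrite [RHS]x_fix /T tau_id// ltW.
apply: (near_eq_is_derive near_t).
rewrite -[Y (x t)]add0r; apply: is_deriveD.
exact: (HP _ (cYf _ x_cont)).2 (ltW te).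
Unshelve. all: by end_near. Qed.

(** Composing X with the retraction on a small cube gives a bounded globally
    Lipschitz field; its solution stays in the cube for a short time. *)
Theorem ode_exists (X : 'rV[R]_n -> 'rV[R]_n) (D : set 'rV[R]_n) (x0 : 'rV[R]_n) :
  open D -> Ck 1 D X -> D x0 ->
  exists e : R, 0 < e /\ exists x : R -> 'rV[R]_n, x 0 = x0 /\
    forall t : R, `|t| < e -> D (x t) /\ is_derive t 1 x (X (x t)).
Proof.
move=> oD CX Dx0.
have Dn : \forall y \near x0, D y by exact: open_nbhs_nbhs.
have Hn := C1_near oD CX Dx0 ltr01.
have HI : \forall y \near x0, D y /\ forall v, `|'D_v X y - 'D_v X x0| <= 1 * `|v|.
  exact: filterI Dn Hn.
have /nbhs_normP[r0 /= r00 Hr] := HI.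
have BD x : `|x - x0| < r0 -> D x by rewrite distrC => /Hr[].
have BL x : `|x - x0| < r0 -> forall v, `|'D_v X x - 'D_v X x0| <= `|v|.
  by rewrite distrC => /Hr[_ H] v; have := H v; rewrite mul1r.
have [K0 K00 HK0] := linear_lipschitz (diff_continuous (CX.1 _ Dx0)).
pose K := K0 + 1.
have K1 : 0 < K by rewrite ltr_wpDr.
have lipX : forall x y, `|x - x0| < r0 -> `|y - x0| < r0 -> `|X y - X x| <= K * `|y - x|.
  apply: (@lipschitz_convex _ _ _ X (fun x => `|x - x0| < r0) K (ltW K1)).
  - by move=> x y t; exact: ball_convex.
  - by move=> x /BD; exact: CX.1.
  - move=> x v /BL/(_ v) h; rewrite -[derive X x v](subrK ('D_v X x0)).
    apply: le_trans (ler_normD _ _) _; rewrite /K mulrDl mul1r addrC lerD//.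
    by rewrite deriveE//; exact: CX.1.
pose r := r0 / 2.
have r_gt0 : 0 < r by rewrite divr_gt0.
have rr0 : r < r0 by rewrite ltr_pdivrMr// ltr_pMr// ltr1n.
(* r < r0 leaves room for the strict bounds defining the Lipschitz region. *)
pose c := clampv x0 r.
have c_in x : `|c x - x0| < r0 by rewrite (le_lt_trans _ rr0)//; exact/clampv_in/ltW.
pose Y x := X (c x).
pose M := K * r + `|X x0|.
have M0 : 0 <= M by rewrite addr_ge0// mulr_ge0// ltW.
have x0in : `|x0 - x0| < r0 by rewrite subrr normr0.
have YM x : `|Y x| <= M.
  rewrite -[Y x](subrK (X x0)); apply: le_trans (ler_normD _ _) _.
  rewrite lerD2r; apply: le_trans (lipX _ _ x0in (c_in x)) _.
  by rewrite ler_wpM2l ?(ltW K1)//; exact/clampv_in/ltW.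
have YK x y : `|Y x - Y y| <= K * `|x - y|.
  apply: le_trans (lipX _ _ (c_in y) (c_in x)) _.
  by rewrite ler_wpM2l ?(ltW K1)//; exact: clampv_lip.
pose e := Num.min (2^-1 / K) (r / (M + 1)).
have M1 : 0 < M + 1 by rewrite ltr_wpDl.
have e0 : 0 < e by rewrite lt_min !divr_gt0// invr_gt0.
have eK : e * K <= 2^-1 by rewrite -ler_pdivlMr// ge_min lexx.
have eM : M * e <= r.
  apply: (@le_trans _ _ ((M + 1) * e)); first by rewrite ler_wpM2r ?lerDl// ltW.
  by rewrite mulrC -ler_pdivlMr// ge_min lexx orbT.
have [x [xx0 Hx]] := picard_lipschitz x0 (ltW K1) M0 YK YM e0 eK.
have x_in t : `|t| < e -> `|x t - x0| <= r.
  move=> te; have sub s : `|s| <= `|t| -> `|s| < e by move=> st; exact: le_lt_trans te.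
  have := @displacement x (fun s => Y (x s)) `|t| M 0 t M0.
  rewrite xx0 subr0 => H; apply: le_trans (H _ _ _ _) _ => //.
  - by move=> s /sub; exact: Hx.
  - by rewrite normr0.
  by apply: le_trans eM; rewrite ler_wpM2l// ltW.
exists e; split=> //; exists x; split=> // t te; split.
  by apply: BD; exact: le_lt_trans (x_in _ te) rr0.
by have := Hx t te; rewrite /Y /c clampv_id//; exact: x_in.
Qed.

End Picard.

(** * The inverse function theorem *)

Lemma cvg_pt (T : topologicalType) (x : T) : y @[y --> x] --> x.
Proof. exact: cvg_id. Qed.

Lemma dist_continuous (R : realType) (V : normedModType R) (a : V) :
  continuous (fun y : V => `|y - a|).
Proof. by move=> x; apply: cvg_norm; apply: cvgB; [exact: cvg_pt|exact: cvg_cst]. Qed.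

Lemma near_dist_lt (R : realType) (V : normedModType R) (x a : V) (r : R) :
  `|x - a| < r -> \forall y \near x, `|y - a| < r.
Proof. by move=> xr; exact: (cvgr_lt _ (@dist_continuous _ _ a x) _ xr). Qed.

Lemma lipschitz_at_continuous (R : realType) (V W : normedModType R) (f : V -> W)
    (x : V) (K : R) : 0 < K ->
  (\forall z \near x, `|f z - f x| <= K * `|z - x|) -> {for x, continuous f}.
Proof.
move=> K0 H; apply/cvgrPdist_le => e e0.
have /near_dist_lt small : `|x - x| < e / K by rewrite subrr normr0 divr_gt0.
apply: filterS2 H small => z Hz zs; rewrite distrC; apply: le_trans Hz _.
by rewrite mulrC -ler_pdivlMr// ltW.
Qed.

Section InverseFunction.
Context (R : realType) (n : nat).
Implicit Types (f : 'rV[R]_n -> 'rV[R]_n).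

Lemma jacobian_entry m (f : 'rV[R]_n -> 'rV[R]_m) x i j : differentiable f x ->
  ('J f x) i j = ('D_(delta_mx 0 i) f x) 0 j.
Proof. by move=> df; rewrite deriveEjacobian// -rowE [RHS]mxE. Qed.

Lemma Ck_jacobian m k (D : set 'rV[R]_n) (f : 'rV[R]_n -> 'rV[R]_m) : open D ->
  Ck k.+1 D f -> Ck k D (fun x => 'J f x).
Proof.
move=> oD Hf; apply: Ck_mx => // i j.
apply: (@Ck_ext _ _ _ _ _ (fun x => ('D_(delta_mx 0 i) f x) 0 j)) => //.
  by move=> x Dx; rewrite jacobian_entry//; exact: Hf.1.
by apply: Ck_entry => //; exact: Hf.2.
Qed.

Lemma mulmxr_continuous p q (A : 'M[R]_(p, q)) : continuous (fun x : 'rV[R]_p => x *m A).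
Proof. exact: (@linear_rV_continuous R p _ (mulmxr A)). Qed.

Lemma mulmxr_bound p q (A : 'M[R]_(p, q)) :
  exists2 K : R, 0 < K & forall x : 'rV[R]_p, `|x *m A| <= K * `|x|.
Proof.
have c : continuous (mulmxr A : 'rV[R]_p -> 'rV[R]_q) by exact: mulmxr_continuous.
by have [K K0 H] := linear_lipschitz c; exists K.
Qed.

(** The iterates stay in the ball, and halve their steps. *)
Lemma contraction_fixed (psi : 'rV[R]_n -> 'rV[R]_n) (x0 : 'rV[R]_n) (r : R) : 0 <= r ->
  (forall x, `|x - x0| <= r -> `|psi x - x0| <= r) ->
  (forall x y, `|x - x0| <= r -> `|y - x0| <= r -> `|psi x - psi y| <= 2^-1 * `|x - y|) ->
  exists p, `|p - x0| <= r /\ psi p = p.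
Proof.
move=> r0 Hr Hc; pose u k := iter k psi x0.
have ur k : `|u k - x0| <= r by elim: k => [|k IH]; [rewrite subrr normr0|exact: Hr].
pose C := `|psi x0 - x0|.
have us k : `|u k.+1 - u k| <= C * 2^-1 ^+ k.
  elim: k => [|k IH]; first by rewrite expr0 mulr1.
  apply: le_trans (Hc _ _ (ur k.+1) (ur k)) _.
  by rewrite exprS mulrCA ler_wpM2l// invr_ge0.
have [l [ul lu]] := geometric_cauchy (normr_ge0 _) us.
have lr : `|l - x0| <= r.
  have cn : `|u k - x0| @[k --> \oo] --> `|l - x0|.
    exact: (cvg_comp _ _ ul (@dist_continuous _ _ x0 l)).
  by apply: ler_cvg_to cn (cvg_cst r) _; near=> k; exact: ur.
exists l; split=> //; apply/eqP; rewrite -subr_eq0 -normr_le0.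
apply: (@le_geometric _ _ _ (C * 2)) => k; rewrite add0r.
rewrite -(subrKA (u k.+1)); apply: le_trans (ler_normD _ _) _.
apply: (@le_trans _ _ (2^-1 * (C * 2 * 2^-1 ^+ k) + C * 2 * 2^-1 ^+ k.+1)).
  apply: lerD; last by rewrite distrC.
  by apply: le_trans (Hc _ _ lr (ur k)) _; rewrite ler_wpM2l// invr_ge0.
by rewrite exprS le_eqVlt; apply/orP; left; apply/eqP; field.
Unshelve. all: by end_near. Qed.

(** With A the inverse of the Jacobian at x0, the map phi x = x - f x A has small
    derivative near x0. Hence f is injective there with a Lipschitz inverse, and
    f x = y is the fixed point equation of phi x + y A. The formula
    D_v G y = v (J f (G y))^-1 then gives smoothness of the inverse by induction. *)
Theorem inverse_function f (D : set 'rV[R]_n) x0 :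
  open D -> smooth_on D f -> D x0 -> 'J f x0 \in unitmx ->
  exists (O : set 'rV[R]_n) (G : 'rV[R]_n -> 'rV[R]_n),
    [/\ open O, O x0, O `<=` D, open (f @` O)
      & (forall x, O x -> G (f x) = x) /\ smooth_on (f @` O) G].
Proof.
move=> oD sf Dx0 Ju; pose A := invmx ('J f x0).
have df x : D x -> differentiable f x by exact: (sf 1%N).1.
pose phi x := x - f x *m A.
have Cphi : Ck 1 D phi.
  apply: Ck_add => //; first exact: Ck_id.
  by apply: Ck_opp => //; apply: Ck_mulmx => //; exact: Ck_cst.
have dphi x v : D x -> 'D_v phi x = v - 'D_v f x *m A.
  move=> Dx; have dL := @derive_linE _ _ _ _ (mulmxr A) f x v (@mulmxr_continuous _ _ A) (df _ Dx).
  rewrite [LHS](@deriveB _ _ _ (fun x => x) (mulmxr A \o f)).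
  - by rewrite derive_id dL.2.
  - exact: derivable_id.
  - exact/diff_derivable/dL.1.
have dphi0 v : 'D_v phi x0 = 0.
  by rewrite dphi// deriveEjacobian ?mulmxK ?subrr//; exact: df.
have half0 : 0 < 2^-1 :> R by rewrite invr_gt0.
have HI : \forall y \near x0, D y /\ forall v, `|'D_v phi y - 'D_v phi x0| <= 2^-1 * `|v|.
  apply: filterI; first exact: open_nbhs_nbhs.
  exact: C1_near oD Cphi Dx0 half0.
have /nbhs_normP[r0 /= r00 Hr] := HI.
have BD x : `|x - x0| < r0 -> D x by rewrite distrC => /Hr[].
have BL x v : `|x - x0| < r0 -> `|'D_v phi x| <= 2^-1 * `|v|.
  by rewrite distrC => /Hr[_ /(_ v)]; rewrite dphi0 subr0.
have lipphi x y : `|x - x0| < r0 -> `|y - x0| < r0 -> `|phi y - phi x| <= 2^-1 * `|y - x|.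
  apply: (@lipschitz_convex _ _ _ phi (fun x => `|x - x0| < r0)).
  - exact: ltW.
  - by move=> z w t; exact: ball_convex.
  - by move=> z /BD; exact: Cphi.1.
  - by move=> z v; exact: BL.
(* y - x is recovered from phi y - phi x and f y - f x; absorb half of it. *)
have inj_bound x y : `|x - x0| < r0 -> `|y - x0| < r0 ->
    `|y - x| <= 2 * `|(f y - f x) *m A|.
  move=> xr yr; have e : y - x = (phi y - phi x) + (f y - f x) *m A.
    rewrite /phi mulmxBl; move: (f y *m A) (f x *m A) => a b.
    by apply/rowP => i; rewrite !mxE; ring.
  have h : `|y - x| <= 2^-1 * `|y - x| + `|(f y - f x) *m A|.
    by rewrite {1}e; apply: le_trans (ler_normD _ _) _; rewrite lerD2r lipphi.
  by lra.
pose r := r0 / 2.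
have r_gt0 : 0 < r by rewrite divr_gt0.
have rr0 : r < r0 by rewrite ltr_pdivrMr// ltr_pMr// ltr1n.
(* O and B are chosen so that f maps O onto B exactly. *)
pose O x := `|x - x0| < r /\ `|(f x - f x0) *m A| < r / 2.
pose B y := `|(y - f x0) *m A| < r / 2.
have Or0 x : O x -> `|x - x0| < r0 by case=> /lt_trans + _; apply.
have cA (y : 'rV[R]_n) : {for y, continuous (fun y : 'rV[R]_n => `|(y - f x0) *m A|)}.
  apply: (@cvg_norm _ _ _ (nbhs y)); apply: (@cvg_mulmx _ _ (nbhs y)); last exact: cvg_cst.
  by apply: cvgB; [exact: cvg_pt|exact: cvg_cst].
have oB : open B.
  rewrite openE => y By; rewrite /interior.
  exact: (cvgr_lt _ (cA y) _ By).
have oO : open O.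
  rewrite openE => x [xr xB]; rewrite /interior.

  have c2 : {for x, continuous (fun y => `|(f y - f x0) *m A|)}.
    apply: (@continuous_comp _ _ _ f (fun y => `|(y - f x0) *m A|)); last exact: cA.
    by apply: differentiable_continuous; apply/df/BD; exact: lt_trans rr0.
  exact: filterI (near_dist_lt xr) (cvgr_lt _ c2 _ xB).
have onto y : B y -> exists x, O x /\ f x = y.
  move=> By; pose psi x := phi x + y *m A.
  have x0in : `|x0 - x0| < r0 by rewrite subrr normr0.
  have psi_x0 x : `|x - x0| <= r -> `|psi x - x0| <= r / 2 + `|(y - f x0) *m A|.
    move=> xr; have -> : psi x - x0 = (phi x - phi x0) + (y - f x0) *m A.
      have e0 : phi x0 = x0 - f x0 *m A by [].
      rewrite /psi e0 mulmxBl; move: (phi x) (f x0 *m A) (y *m A) => a b c.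
      by apply/rowP => i; rewrite !mxE; ring.
    apply: le_trans (ler_normD _ _) _; rewrite lerD2r.
    apply: le_trans (lipphi _ _ x0in (le_lt_trans xr rr0)) _.
    by rewrite mulrC ler_wpM2r// invr_ge0.
  have [||p [pr pp]] := @contraction_fixed psi x0 r (ltW r_gt0).
  - move=> x xr; apply: le_trans (psi_x0 _ xr) _.
    by rewrite [leRHS]splitr lerD2l ltW.
  - move=> x z xr zr; rewrite /psi opprD addrACA subrr addr0.
    by apply: lipphi; exact: le_lt_trans rr0.
  have fp : f p = y.
    move/eqP: pp; rewrite /psi /phi -addrA -[X in _ == X]addr0 (inj_eq (addrI p)).
    rewrite addrC subr_eq0 => /eqP /(congr1 (mulmx^~ ('J f x0))).
    by rewrite !mulmxKV.
  exists p; split=> //; split; last by rewrite fp.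
  rewrite -[X in `|X - _|]pp; apply: le_lt_trans (psi_x0 _ pr) _.
  by rewrite [ltRHS]splitr ltrD2l.
have fOB : f @` O = B.
  rewrite eqEsubset; split=> [_ [x [_ xB] <-]//|y /onto[x [Ox <-]]].
  by exists x.
have /choice[G HG] : forall y, exists x, B y -> O x /\ f x = y.
  move=> y; have [/onto[x Hx]|nB] := pselect (B y); first by exists x.
  by exists x0.
have GO y : B y -> O (G y) by move=> /HG[].
have fG y : B y -> f (G y) = y by move=> /HG[].
have OB x : O x -> B (f x) by case.
have Gf x : O x -> G (f x) = x.
  move=> Ox; have By := OB _ Ox; have := inj_bound _ _ (Or0 _ Ox) (Or0 _ (GO _ By)).
  rewrite fG// subrr mul0mx normr0 mulr0 normr_le0 subr_eq0.
  by move/eqP.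
have [KA KA0 HKA] := mulmxr_bound A.
have Glip y y' : B y -> B y' -> `|G y' - G y| <= 2 * KA * `|y' - y|.
  move=> By By'; apply: le_trans (inj_bound _ _ (Or0 _ (GO _ By)) (Or0 _ (GO _ By'))) _.
  by rewrite !fG// -mulrA ler_wpM2l.
have Jx x : O x -> 'J f x \in unitmx.
  move=> Ox; rewrite -row_free_unit -kermx_eq0; apply/eqP/row_matrixP => i.
  rewrite row0; set v := row i _.
  have v0 : v *m 'J f x = 0 by rewrite -row_mul mulmx_ker row0.
  have Dx : D x by exact/BD/Or0.
  have := BL x v (Or0 _ Ox); rewrite dphi// deriveEjacobian ?v0 ?mul0mx ?subr0; last exact: df.
  move=> h; apply/eqP; rewrite -normr_le0; lra.
have Gc y : B y -> {for y, continuous G}.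
  move=> By; apply: (@lipschitz_at_continuous _ _ _ G y (2 * KA)); first by rewrite mulr_gt0.
  have nB : \forall z \near y, B z by exact: open_nbhs_nbhs.
  by apply: filterS nB => z; exact: Glip.
have dG y : B y -> differentiable G y /\ forall v, 'D_v G y = v *m invmx ('J f (G y)).
  move=> By; set x := G y; have Ox : O x := GO _ By.
  pose L : {linear 'rV[R]_n -> 'rV[R]_n} := mulmxr (invmx ('J f x)).
  have cL : continuous L by exact: mulmxr_continuous.
  have [KL KL0 HKL] := mulmxr_bound (invmx ('J f x)).
  have dfx : differentiable f x by exact/df/BD/Or0.
  have dE v : 'd f x v = v *m 'J f x by rewrite mul_rV_lin1.
  have [|dGy GE] := @eps_diff _ _ _ G y L cL.
    move=> e e0; have e1 : 0 < e / KL / (2 * KA) by rewrite !divr_gt0// mulr_gt0.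
    have nB : \forall z \near y, B z by exact: open_nbhs_nbhs.
    have h : \forall z \near y, `|f (G z) - f x - 'd f x (G z - x)| <= e / KL / (2 * KA) * `|G z - x|.
      exact: (Gc _ By) (diff_eps dfx e1).
    apply: filterS2 nB h => z Bz; rewrite fG// /x fG// -/x => hz.
    have -> : G z - x - L (z - y) = - L (z - y - 'd f x (G z - x)).
      have LE : L ('d f x (G z - x)) = G z - x.
        by rewrite dE; exact: (mulmxK (Jx _ Ox)).
      by rewrite [L (z - y - _)](linearB L) LE opprB.
    rewrite normrN; apply: le_trans (HKL _) _.
    apply: le_trans (ler_wpM2l (ltW KL0) hz) _.
    apply: (@le_trans _ _ (KL * (e / KL / (2 * KA) * (2 * KA * `|z - y|)))).
      rewrite ler_wpM2l ?(ltW KL0)// ler_wpM2l ?(ltW e1)//; exact: Glip.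
    rewrite le_eqVlt; apply/orP; left; apply/eqP; field.
    by rewrite !gt_eqF.
  split=> [|v]; first exact: dGy.
  by apply: etrans (deriveE v dGy) _; rewrite GE.
exists O, G; split=> //.
- by split; rewrite subrr ?mul0mx normr0// divr_gt0.
- by move=> x /Or0 /BD.
- by rewrite fOB.
(* The derivative of G is a smooth function of G itself. *)
split=> //; rewrite fOB; elim=> [|k IH]; first exact: Gc.
split=> [y /dG[]//|v].
apply: (@Ck_ext _ _ _ _ _ (fun y => v *m invmx ('J f (G y)))) => //.
  by move=> y /dG[_ ->].
apply: (Ck_mulmx oB); first exact: Ck_cst.
apply: (Ck_invmx oB); first by move=> y By; exact/Jx/GO.
have CJ : Ck k O (fun x => 'J f x).
  apply: Ck_jacobian => //; apply: Ck_sub (sf k.+1).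
  by move=> x /Or0 /BD.
apply: (Ck_mx oB) => i j.
apply: (@Ck_comp _ _ _ k _ B O G (fun x => ('J f x) i j) oB GO IH).
exact: (Ck_entry i j oO CJ).
Qed.

End InverseFunction.

(** * Charts, frames and adapted charts *)

Section Jacobians.
Context (R : realType).

Lemma jacobian_comp n m p (f : 'rV[R]_n -> 'rV[R]_m) (g : 'rV[R]_m -> 'rV[R]_p) x :
  differentiable f x -> differentiable g (f x) ->
  'J (g \o f) x = 'J f x *m 'J g (f x).
Proof.
move=> df dg; have dgf := differentiable_comp df dg.
apply/row_matrixP => i; rewrite row_mul !rowE.
rewrite -(deriveEjacobian _ dgf) derive_compE//.
by rewrite -(deriveEjacobian _ df) -(deriveEjacobian _ dg).
Qed.

Lemma jacobian_ext n m (f g : 'rV[R]_n -> 'rV[R]_m) x :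
  (\near x, f x = g x) -> differentiable f x -> 'J f x = 'J g x.
Proof.
move=> fg df; have dg := near_eq_diff fg df.
have key (v : 'rV[R]_n) : v *m 'J f x = v *m 'J g x.
  apply: etrans (esym (deriveEjacobian v df)) _.
  by apply: etrans _ (deriveEjacobian v dg); exact: near_eq_derive.
apply/row_matrixP => i; apply: etrans (rowE i _) _.
by apply: etrans (key _) _; exact: esym (rowE i _).
Qed.

Lemma jacobian_id n (x : 'rV[R]_n) : 'J id x = 1%:M.
Proof.
have di : differentiable (id : 'rV[R]_n -> 'rV[R]_n) x.
  by apply: (@linear_differentiable _ _ _ idfun) => y; exact: cvg_pt.
apply/row_matrixP => i; rewrite !rowE -(deriveEjacobian _ di) derive_id.
by rewrite mulmx1.
Qed.

End Jacobians.

Section Charts.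
Context (R : realType) (n : nat) (T : topologicalType).
Implicit Types c : chart R n T.

Lemma cimg_map c q : cdom c q -> cimg c (cmap c q).
Proof. by move=> cq; exists q. Qed.

Lemma cinv_dom c x : cimg c x -> cdom c (cinv c x).
Proof. by case=> q cq <-; rewrite cmapK. Qed.

Lemma cinvK c x : cimg c x -> cmap c (cinv c x) = x.
Proof. by case=> q cq <-; rewrite cmapK. Qed.

Lemma cimg_open_set c : open (cimg c).
Proof. exact: cimg_open. Qed.

Lemma near_cdom c q : cdom c q -> \forall q' \near q, cdom c q'.
Proof. by move=> cq; apply: open_nbhs_nbhs; split=> //; exact: cdom_open. Qed.

Lemma near_cimg c x : cimg c x -> \forall y \near x, cimg c y.
Proof. by move=> cx; apply: open_nbhs_nbhs; split=> //; exact: cimg_open. Qed.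

Lemma restrict_imgP c (A : set T) x :
  (cmap c @` (cdom c `&` A)) x <-> cimg c x /\ A (cinv c x).
Proof.
split=> [[q [cq Aq] <-]|[cx Ax]]; first by split; [exact: cimg_map|rewrite cmapK].
by exists (cinv c x); [split=> //; exact: cinv_dom|exact: cinvK].
Qed.

Lemma restrict_img_open c (A : set T) : open A -> open (cmap c @` (cdom c `&` A)).
Proof.
move=> oA; rewrite openE => x /restrict_imgP[cx Ax]; rewrite /interior.
have nA : \forall y \near x, A (cinv c y).
  by apply: (cinv_cont cx); apply: open_nbhs_nbhs.
by apply: filterS2 (near_cimg cx) nA => y cy Ay; apply/restrict_imgP.
Qed.

End Charts.

Section Manifolds.
Context (R : realType) (n : nat) (Q : manifold R n).
Implicit Types c : chart R n Q.

Definition trans c c' := cmap c' \o cinv c.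

Lemma trans_Ck k c c' : atlas c -> atlas c' ->
  Ck k (cmap c @` (cdom c `&` cdom c')) (trans c c').
Proof. by move=> ac ac'; exact: atlas_compat. Qed.

Lemma trans_diff c c' q : atlas c -> atlas c' -> cdom c q -> cdom c' q ->
  differentiable (trans c c') (cmap c q).
Proof.
move=> ac ac' cq c'q; apply: (trans_Ck 1 ac ac').1.
by exists q.
Qed.

Lemma near_overlap c c' q : cdom c q -> cdom c' q ->
  \forall y \near cmap c q, cimg c y /\ cdom c' (cinv c y).
Proof.
move=> cq c'q; have o : open (cmap c @` (cdom c `&` cdom c')).
  exact/restrict_img_open/cdom_open.
have : \forall y \near cmap c q, (cmap c @` (cdom c `&` cdom c')) y.
  by apply: open_nbhs_nbhs; split=> //; exists q.
by apply: filterS => y /restrict_imgP.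
Qed.

(** The cocycle rule, by the chain rule on the triple overlap. *)
Lemma trans_jacobian c c' c'' q : atlas c -> atlas c' -> atlas c'' ->
  cdom c q -> cdom c' q -> cdom c'' q ->
  'J (trans c c'') (cmap c q) =
  'J (trans c c') (cmap c q) *m 'J (trans c' c'') (cmap c' q).
Proof.
move=> ac ac' ac'' cq c'q c''q.
have d1 := trans_diff ac ac' cq c'q.
have e : trans c c' (cmap c q) = cmap c' q by rewrite /trans /= cmapK.
have d2 : differentiable (trans c' c'') (trans c c' (cmap c q)).
  by rewrite e; exact: trans_diff.
rewrite -e; apply: etrans _ (jacobian_comp d1 d2).
apply: jacobian_ext; last exact: trans_diff.
apply: filterS (near_overlap cq c'q) => y [cy c'y].
by rewrite /trans /= cmapK.
Qed.

Lemma trans_jacobian_id c q : atlas c -> cdom c q -> 'J (trans c c) (cmap c q) = 1%:M.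
Proof.
move=> ac cq; rewrite -(jacobian_id (cmap c q)); apply: jacobian_ext; last exact: trans_diff.
by apply: filterS (near_cimg (cimg_map cq)) => y cy; exact: cinvK.
Qed.

Lemma trans_jacobianK c c' q : atlas c -> atlas c' -> cdom c q -> cdom c' q ->
  'J (trans c c') (cmap c q) *m 'J (trans c' c) (cmap c' q) = 1%:M.
Proof. by move=> *; rewrite -trans_jacobian// trans_jacobian_id. Qed.

Lemma trans_unit c c' q : atlas c -> atlas c' -> cdom c q -> cdom c' q ->
  'J (trans c c') (cmap c q) \in unitmx.
Proof. by move=> *; apply: (mulmx1_unit (trans_jacobianK _ _ _ _)).1. Qed.

Lemma frameE c q : frame c q = 'J (trans c (chart_at q)) (cmap c q).
Proof. by []. Qed.

Lemma frame_unit c q : atlas c -> cdom c q -> frame c q \in unitmx.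
Proof.
move=> ac cq; rewrite frameE; apply: trans_unit => //.
  exact: chart_at_atlas.
exact: chart_at_dom.
Qed.

(** All comparisons between charts go through this identity. *)
Lemma frame_change c c' q : atlas c -> atlas c' -> cdom c q -> cdom c' q ->
  frame c q = 'J (trans c c') (cmap c q) *m frame c' q.
Proof.
move=> ac ac' cq c'q; rewrite !frameE.
by apply: trans_jacobian => //; [exact: chart_at_atlas|exact: chart_at_dom].
Qed.

Section Curves.
Context (I : set R) (q : R -> Q).
Hypothesis TI : time_interval I.

Lemma cont_near c t : cont_in I q t -> cdom c (q t) ->
  \forall s \near t, I s -> cdom c (q s).
Proof. by move=> cq ct; have := cq _ (near_cdom ct). Qed.

Lemma is_deriv_trans c c' t (v : 'rV[R]_n) : atlas c -> atlas c' -> I t ->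
  cont_in I q t -> cdom c (q t) -> cdom c' (q t) ->
  is_deriv_in I (cmap c \o q) t v ->
  is_deriv_in I (cmap c' \o q) t (v *m 'J (trans c c') (cmap c (q t))).
Proof.
move=> ac ac' It cq ct c't Hv.
have d := trans_diff ac ac' ct c't.
rewrite -(deriveEjacobian _ d).
apply: is_deriv_in_ext It (is_deriv_in_comp Hv d).
apply: filterS (cont_near cq ct) => s cs /cs cqs.
by rewrite /trans /= cmapK.
Qed.

Lemma velocity_chart c t (v : 'rV[R]_n) : atlas c -> I t -> cont_in I q t ->
  cdom c (q t) -> is_deriv_in I (cmap c \o q) t v ->
  velocity I q t = v *m frame c (q t).
Proof.
move=> ac It cq ct Hv; apply: deriv_inE => //; rewrite frameE.
apply: is_deriv_trans => //; first exact: chart_at_atlas.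
exact: chart_at_dom.
Qed.

Lemma diff_curve_is c t : diff_curve I q -> atlas c -> I t -> cdom c (q t) ->
  is_deriv_in I (cmap c \o q) t (deriv_in I (cmap c \o q) t).
Proof. by move=> [_ H] ac It ct; exact/derivable_in_is/H. Qed.

Lemma velocity_deriv c t : diff_curve I q -> atlas c -> I t -> cdom c (q t) ->
  velocity I q t = deriv_in I (cmap c \o q) t *m frame c (q t).
Proof.
move=> dq ac It ct; apply: velocity_chart => //; first exact: dq.1.
exact: diff_curve_is.
Qed.

End Curves.
End Manifolds.

Section Maps.
Context (R : realType) (n m : nat) (Q : manifold R n) (U : manifold R m) (f : Q -> U).
Hypothesis sf : smooth_map f.
Implicit Types (c : chart R n Q) (d : chart R m U).

Definition loc_map c d := cmap d \o f \o cinv c.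

Lemma map_preim_open d : open (f @^-1` cdom d).
Proof. by apply: open_comp; [move=> x _; exact: sf.1|exact: cdom_open]. Qed.

Lemma loc_map_diff c d q : atlas c -> atlas d -> cdom c q -> cdom d (f q) ->
  differentiable (loc_map c d) (cmap c q).
Proof.
move=> ac ad cq dq; have := (sf.2 c d ac ad 1%N).1; apply.
by exists q.
Qed.

(** Both sides differentiate the same map, from the coordinates c of the source
    to the reference coordinates at f q. *)
Lemma tangent_map_chart c d q : atlas c -> atlas d -> cdom c q -> cdom d (f q) ->
  frame c q *m tangent_map f q = loc_tangent_map f c d (cmap c q) *m frame d (f q).
Proof.
move=> ac ad cq dq.
set c0 := chart_at q; set d0 := chart_at (f q).
have ac0 : atlas c0 := chart_at_atlas q.
have ad0 : atlas d0 := chart_at_atlas (f q).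
have c0q : cdom c0 q := chart_at_dom q.
have d0q : cdom d0 (f q) := chart_at_dom (f q).
have e1 : trans c c0 (cmap c q) = cmap c0 q by rewrite /trans /= cmapK.
have e2 : loc_map c d (cmap c q) = cmap d (f q) by rewrite /loc_map /= cmapK.
have D1 := trans_diff ac ac0 cq c0q.
have D2 : differentiable (loc_map c0 d0) (trans c c0 (cmap c q)).
  by rewrite e1; exact: loc_map_diff.
have D3 := loc_map_diff ac ad cq dq.
have D4 : differentiable (trans d d0) (loc_map c d (cmap c q)).
  by rewrite e2; exact: trans_diff.
rewrite /tangent_map /loc_tangent_map !frameE -/c0 -/d0 -e1 -e2.
apply: etrans (esym (jacobian_comp D1 D2)) _; apply: etrans _ (jacobian_comp D3 D4).
apply: jacobian_ext; last exact: differentiable_comp D1 D2.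
have o : open (cmap c @` (cdom c `&` (f @^-1` cdom d))).
  exact/restrict_img_open/map_preim_open.
have n1 : \forall y \near cmap c q, (cmap c @` (cdom c `&` (f @^-1` cdom d))) y.
  by apply: open_nbhs_nbhs; split=> //; exists q.
apply: filterS2 (near_overlap cq c0q) n1 => y [cy c0y] /restrict_imgP[_ dy].
by rewrite /trans /loc_map /= !cmapK.
Qed.

End Maps.

Section AdaptedCharts.
Context (R : realType) (N M : nat) (Q : manifold R (N + M)) (U : manifold R M)
  (pi : Q -> U).
Hypothesis pi_subm : submersion pi.

(** Completed by the transpose of a basis of a complement of the column
    space. *)
Lemma complete_columns (J : 'M[R]_(N + M, M)) : row_full J ->
  exists L : 'M[R]_(N + M, N), row_mx L J \in unitmx.
Proof.
move=> Jf; have rJ : \rank (J^T)%R = M by rewrite mxrank_tr; apply/eqP.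
have rC : \rank ((J^T)^C)%MS = N by rewrite mxrank_compl rJ addnK.
pose B : 'M[R]_(N, N + M) := castmx (rC, erefl) (row_base (J^T)^C%MS).
have eB : (B :=: (J^T)^C)%MS.
  by apply: eqmx_trans (eq_row_base _); rewrite /B; exact: eqmx_cast.
exists B^T; rewrite -unitmx_tr tr_row_mx trmxK -row_full_unit -sub1mx.
apply: (@submx_trans _ _ _ _ _ _ (J^T + (J^T)^C)%MS).
  by rewrite submx_full ?addsmx_compl_full.
by rewrite -addsmxE addsmxC addsmxS// eB.
Qed.

(** Keep N linear combinations of the coordinates of a given chart and replace
    the remaining ones by the coordinates of pi. The combinations are chosen so
    that the Jacobian is invertible; the inverse function theorem makes this a
    chart, and the atlas contains it by maximality. *)
Lemma adapted_chart_exists (q0 : Q) :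
  exists c d, adapted pi c d /\ cdom c q0.
Proof.
set c0 := chart_at q0; set d := chart_at (pi q0).
have ac0 : atlas c0 := chart_at_atlas q0.
have ad : atlas d := chart_at_atlas (pi q0).
have c0q : cdom c0 q0 := chart_at_dom q0.
have dq0 : cdom d (pi q0) := chart_at_dom (pi q0).
have sf := pi_subm.1.
pose X := cmap c0 @` (cdom c0 `&` pi @^-1` cdom d).
have oX : open X by exact/restrict_img_open/map_preim_open.
pose f := loc_map pi c0 d.
have sX : smooth_on X f by exact: sf.2.
have Xx0 : X (cmap c0 q0) by exists q0.
have [L Lu] := complete_columns (pi_subm.2 q0).
(* Phi x = (x L, f x), written additively so that the C^k calculus applies. *)
pose PL : 'M[R]_(N + M, N + M) := row_mx L 0.
pose PR : 'M[R]_(M, N + M) := row_mx 0 1%:M.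
pose Phi x := x *m PL + f x *m PR.
have sPhi : smooth_on X Phi.
  move=> k; apply: (Ck_add oX).
    by apply: (Ck_mulmx oX); [exact: Ck_id|exact: Ck_cst].
  by apply: (Ck_mulmx oX); [exact: sX|exact: Ck_cst].
have rPhi x : rsubmx (Phi x) = f x.
  by rewrite /Phi /PL /PR !mul_mx_row !mulmx0 mulmx1 add_row_mx row_mxKr add0r.
have JPhi : 'J Phi (cmap c0 q0) = row_mx L (tangent_map pi q0).
  have dPhi := (sPhi 1%N).1 _ Xx0; have df := (sX 1%N).1 _ Xx0.
  apply/row_matrixP => i.
  rewrite (rowE i ('J _ _)) (rowE i (row_mx _ _)).
  rewrite -(deriveEjacobian _ dPhi) mul_mx_row.
  set v := delta_mx 0 i.
  have [d1 e1] := @derive_linE R _ _ _ (mulmxr PL) (fun x => x) (cmap c0 q0) v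
    (@linear_rV_continuous R _ _ (mulmxr PL)) ((Ck_id 1 X).1 _ Xx0).
  have [d2 e2] := @derive_linE R _ _ _ (mulmxr PR) f (cmap c0 q0) v
    (@linear_rV_continuous R _ _ (mulmxr PR)) df.
  have D1 : derivable (mulmxr PL \o (fun x => x)) (cmap c0 q0) v by exact: diff_derivable.
  have D2 : derivable (mulmxr PR \o f) (cmap c0 q0) v by exact: diff_derivable.
  apply: etrans (deriveD D1 D2) _; rewrite e1 e2 derive_id /=.
  rewrite /PL /PR !mul_mx_row !mulmx0 mulmx1 add_row_mx addr0 add0r.
  by congr row_mx; rewrite deriveEjacobian.
have JU : 'J Phi (cmap c0 q0) \in unitmx by rewrite JPhi.
have [W [Gi [oO Oq0 OX oPO [GiK sGi]]]] := inverse_function oX sPhi Xx0 JU.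
pose D := cdom c0 `&` cmap c0 @^-1` W.
have XC x : X x -> cimg c0 x by case/restrict_imgP.
have OC x : W x -> cimg c0 x by move=> /OX /XC.
have oD : open D.
  rewrite openE => q [cq Oq]; rewrite /interior.
  apply: filterI; first exact: near_cdom.
  by apply: (cmap_cont cq); apply: open_nbhs_nbhs.
have img : (Phi \o cmap c0) @` D = Phi @` W.
  rewrite eqEsubset; split=> [_ [q [cq Oq] <-]|_ [x Ox <-]]; first by exists (cmap c0 q).
  exists (cinv c0 x); last by rewrite /= cinvK//; exact: OC.
  by split; [exact/cinv_dom/OC|rewrite /= cinvK//; exact: OC].
have oI : open ((Phi \o cmap c0) @` D) by rewrite img.
have K q : D q -> (cinv c0 \o Gi) ((Phi \o cmap c0) q) = q.
  by move=> [cq Oq]; rewrite /= GiK// cmapK.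
have C1 q : D q -> {for q, continuous (Phi \o cmap c0)}.
  move=> [cq Oq]; apply: continuous_comp; first exact: cmap_cont.
  by apply: (sPhi 0%N); exact: OX.
have GiO y : (Phi @` W) y -> W (Gi y) by case=> x Ox <-; rewrite GiK.
have C2 y : ((Phi \o cmap c0) @` D) y -> {for y, continuous (cinv c0 \o Gi)}.
  rewrite img => Hy; apply: continuous_comp; first exact: (sGi 0%N).
  by apply: cinv_cont; exact/OC/GiO.
pose c := Chart oD oI K C1 C2.
exists c, d; split; last by split.
split=> //.
(* Transition maps with c are compositions of Phi or its inverse with those
   of c0. *)
- apply: atlas_maximal => c' ac'; split=> k.
    have o1 : open (cmap c @` (cdom c `&` cdom c')) by exact/restrict_img_open/cdom_open.
    have H y : (cmap c @` (cdom c `&` cdom c')) y ->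
        (Phi @` W) y /\ (cmap c0 @` (cdom c0 `&` cdom c')) (Gi y).
      case=> q [[cq Oq] c'q] <-; split; first by exists (cmap c0 q).
      by rewrite /= GiK//; exists q.
    apply: (@Ck_comp _ _ _ k _ _ (cmap c0 @` (cdom c0 `&` cdom c')) Gi (trans c0 c') o1).
    - by move=> y /H[].
    - by apply: Ck_sub (sGi k) => y /H[].
    - exact: trans_Ck.
  have o1 : open (cmap c' @` (cdom c' `&` cdom c)) by exact/restrict_img_open/cdom_open.
  have H y : (cmap c' @` (cdom c' `&` cdom c)) y ->
      W (trans c' c0 y) /\ (cmap c' @` (cdom c' `&` cdom c0)) y.
    case=> q [c'q [cq Oq]] <-; split; last by exists q.
    by rewrite /trans /= cmapK.
  apply: (@Ck_comp _ _ _ k _ _ X (trans c' c0) Phi o1).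
  - by move=> y /H[/OX].
  - by apply: Ck_sub (trans_Ck k ac' ac0) => y /H[].
  - exact: sPhi.
- move=> q [cq Oq]; have /restrict_imgP[_] := OX _ Oq; rewrite /= cmapK// => dq.
  by split=> //; rewrite rPhi /f /loc_map /= cmapK.
Qed.

End AdaptedCharts.

(** * The bilinear map theta *)

Section LocalCk.
Context (R : realType) (V : normedModType R).

(** Smoothness is checked on the domains of local frames of Gamma. *)
Lemma Ck_local (W : normedModType R) k (D : set V) (f : V -> W) :
  (forall x, D x -> exists O : set V, [/\ open O, O x & Ck k O f]) -> Ck k D f.
Proof.
elim: k f => [f H x Dx|k IH f H].
  by have [B [_ Ox cf]] := H x Dx; exact: cf.
split=> [x Dx|v]; first by have [B [_ Ox cf]] := H x Dx; exact: cf.1.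
by apply: IH => x /H[B [oO Ox cf]]; exists B; split=> //; exact: cf.2.
Qed.

Lemma quad_derive m n (f : V -> 'M[R]_(m, n)) (p : 'rV[R]_m) (s : 'rV[R]_n) x v :
  differentiable f x ->
  differentiable (fun y => (p *m f y *m s^T) 0 0) x /\
  'D_v (fun y => (p *m f y *m s^T) 0 0) x = (p *m 'D_v f x *m s^T) 0 0.
Proof.
move=> df.
have lE : linear (fun M : 'M[R]_(m, n) => (p *m M *m s^T) 0 0 : R).
  by move=> a M1 M2; rewrite mulmxDr mulmxDl -scalemxAr -scalemxAl !mxE.
pose L := HB.pack_for {linear 'M[R]_(m, n) -> R}
  (fun M : 'M[R]_(m, n) => (p *m M *m s^T) 0 0 : R) (GRing.isLinear.Build _ _ _ _ _ lE).
have cL : continuous L.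
  move=> M; apply: (@cvg_coord _ _ (nbhs M)).
  apply: (@cvg_mulmx _ _ (nbhs M)); last exact: cvg_cst.
  by apply: (@cvg_mulmx _ _ (nbhs M)); [exact: cvg_cst|exact: cvg_pt].
exact: (derive_linE v cL df).
Qed.

End LocalCk.

Section QuadraticForms.
Context (R : realType) (n : nat).

Lemma grad_quadratic (S : 'M[R]_n) (v : 'rV[R]_n) : S^T = S ->
  grad (fun w => 2^-1 * (w *m S *m w^T) 0 0) v = v *m S.
Proof.
move=> sS; apply/rowP => i; rewrite mxE; set e := delta_mx 0 i.
have d1 := @derive_linE R _ _ _ (mulmxr S) (fun w : 'rV[R]_n => w) v e
  (@linear_rV_continuous R n _ (mulmxr S)) ((Ck_id 1 setT).1 v I).
have d2 := @derive_linE R _ _ _ (@trmx R 1 n) (fun w : 'rV[R]_n => w) v e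
  (@linear_rV_continuous R n _ (@trmx R 1 n)) ((Ck_id 1 setT).1 v I).
have [d3 e3] := derive_bilin (@mulmx_continuous R 1 n 1) d1.1 d2.1.
have lE : linear (fun M : 'M[R]_1 => 2^-1 * M 0 0 : R).
  by move=> a M1 M2; rewrite !mxE mulrDr mulrCA.
pose L := HB.pack_for {linear 'M[R]_1 -> R} (fun M : 'M[R]_1 => 2^-1 * M 0 0 : R)
  (GRing.isLinear.Build _ _ _ _ _ lE).
have cL : continuous L.
  move=> M; apply: (@cvgM _ _ (nbhs M)); first exact: cvg_cst.
  exact: coord_continuous.
apply: etrans (derive_linE e cL d3).2 _; rewrite e3 d1.2 d2.2 derive_id /= /L /=.
have -> : e *m S *m v^T = (v *m S *m e^T)^T.
  by rewrite !trmx_mul !trmxK sS mulmxA.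
have : (v *m S *m e^T) 0 0 = (v *m S) 0 i.
  by rewrite /e trmx_delta -colE mxE.
move=> <-; move: (v *m S *m e^T) => A.
by rewrite mxE [A^T 0 0]mxE; field.
Qed.

End QuadraticForms.

Section Theta.
Context (R : realType) (n : nat).

Lemma row_quad_linl (Dm : 'I_n -> 'M[R]_n) (a : R) (p q s : 'rV[R]_n) :
  \row_(i < n) (((a *: p + q) *m Dm i *m s^T) 0 0) =
  a *: \row_(i < n) ((p *m Dm i *m s^T) 0 0) + \row_(i < n) ((q *m Dm i *m s^T) 0 0).
Proof.
apply/rowP => i.
by rewrite [LHS]mxE [RHS]mxE [X in _ = X + _]mxE !mulmxDl -!scalemxAl ![(\row_i _) 0 i]mxE [LHS]mxE [X in X + _ = _]mxE.
Qed.

Lemma row_quad_linr (Dm : 'I_n -> 'M[R]_n) (a : R) (p q s : 'rV[R]_n) :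
  \row_(i < n) ((s *m Dm i *m (a *: p + q)^T) 0 0) =
  a *: \row_(i < n) ((s *m Dm i *m p^T) 0 0) + \row_(i < n) ((s *m Dm i *m q^T) 0 0).
Proof.
apply/rowP => i.
by rewrite [LHS]mxE [RHS]mxE [X in _ = X + _]mxE linearD linearZ /= mulmxDr -!scalemxAr ![(\row_i _) 0 i]mxE [LHS]mxE [X in X + _ = _]mxE.
Qed.

(** The formula of theta_I for arbitrary matrix fields P and ginv in place of
    P*_I and g^-1. *)
Definition theta (P ginv : 'rV[R]_n -> 'M[R]_n) (x p p' : 'rV[R]_n) : 'rV[R]_n :=
  p' *m 'D_(p *m ginv x) P x
  - 2^-1 *: (grad (fun y => (p *m ginv y *m p'^T) 0 0) x *m P x).

Context (X : set 'rV[R]_n) (P ginv : 'rV[R]_n -> 'M[R]_n).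
Hypothesis oX : open X.
Hypothesis sP : smooth_on X P.
Hypothesis sg : smooth_on X ginv.

Lemma theta_gradE (x p p' : 'rV[R]_n) : X x ->
  grad (fun y => (p *m ginv y *m p'^T) 0 0) x =
  \row_(i < n) ((p *m 'D_(delta_mx 0 i) ginv x *m p'^T) 0 0).
Proof.
move=> Xx; apply/rowP => i; rewrite !mxE.
apply: etrans (quad_derive p p' _ ((sg 1%N).1 x Xx)).2 _.
by rewrite mxE.
Qed.

Lemma theta_linl (x : 'rV[R]_n) (a : R) (p q p' : 'rV[R]_n) : X x ->
  theta P ginv x (a *: p + q) p' = a *: theta P ginv x p p' + theta P ginv x q p'.
Proof.
move=> Xx; have dP := (sP 1%N).1 x Xx.
rewrite /theta 3?theta_gradE// mulmxDl -scalemxAl (deriveDv _ _ dP) (deriveZv _ _ dP).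
rewrite mulmxDr -scalemxAr scalerBr addrACA; congr (_ + _).
rewrite -opprD scalerA mulrC -scalerA -scalerDr; congr (- (_ *: _)).
rewrite scalemxAl -mulmxDl; congr (_ *m _); exact: row_quad_linl.
Qed.

Lemma theta_linr (x : 'rV[R]_n) (a : R) (p q q' : 'rV[R]_n) : X x ->
  theta P ginv x p (a *: q + q') = a *: theta P ginv x p q + theta P ginv x p q'.
Proof.
move=> Xx.
rewrite /theta 3?theta_gradE// mulmxDl -scalemxAl.
rewrite scalerBr addrACA; congr (_ + _).
rewrite -opprD scalerA mulrC -scalerA -scalerDr; congr (- (_ *: _)).
rewrite scalemxAl -mulmxDl; congr (_ *m _); exact: row_quad_linr.
Qed.

Lemma biadditive_expand (V W : zmodType) (f : V -> V -> W) (y z : V) :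
  f (y + z) (y + z) = f y (y + z) + f z (y + z) -> f y (y + z) = f y y + f y z ->
  f z (y + z) = f z y + f z z ->
  f (y + z) (y + z) = f y y + f y z + f z y + f z z.
Proof. by move=> -> -> ->; rewrite !addrA. Qed.

Lemma theta_expand (x y z : 'rV[R]_n) : X x ->
  theta P ginv x (y + z) (y + z) = theta P ginv x y y + theta P ginv x y z +
    theta P ginv x z y + theta P ginv x z z.
Proof.
move=> Xx; have e1 := theta_linl 1 y z (y + z) Xx.
have e2 := theta_linr 1 y y z Xx; have e3 := theta_linr 1 z y z Xx.
apply: (@biadditive_expand _ _ (theta P ginv x)).
- by move: e1; rewrite !scale1r.
- by move: e2; rewrite !scale1r.
- by move: e3; rewrite !scale1r.
Qed.

Lemma theta_Ck k (p p' : 'rV[R]_n) : Ck k X (fun x => theta P ginv x p p').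
Proof.
pose F x := p' *m (\sum_i (p *m ginv x) 0 i *: 'D_(delta_mx 0 i) P x)
  - 2^-1 *: ((\row_(i < n) ((p *m 'D_(delta_mx 0 i) ginv x *m p'^T) 0 0)) *m P x).
apply: (@Ck_ext _ _ _ _ _ F _ oX).
  move=> x Xx; rewrite /F /theta theta_gradE//; congr (_ *m _ - _).
  apply: esym; apply: derive_rV; exact: (sP 1%N).1.
apply: (Ck_add oX).
  apply: (Ck_mulmx oX); first exact: Ck_cst.
  apply: (Ck_sum oX) => i; apply: (Ck_scale oX); last exact: (sP k.+1).2.
  apply: (Ck_entry _ _ oX); apply: (Ck_mulmx oX); first exact: Ck_cst.
  exact: sg.
apply: (Ck_opp oX); apply: (Ck_scale oX); first exact: Ck_cst.
apply: (Ck_mulmx oX); last exact: sP.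
apply: (Ck_mx oX) => i j; under eq_fun do rewrite mxE.
apply: (Ck_entry _ _ oX); apply: (Ck_mulmx oX); last exact: Ck_cst.
apply: (Ck_mulmx oX); first exact: Ck_cst.
exact: (sg k.+1).2.
Qed.

Lemma near_bounded (V W : normedModType R) (f : V -> W) (x : V) : {for x, continuous f} ->
  \forall y \near x, `|f y| <= `|f x| + 1.
Proof.
move=> cf; have cn : `|f y| @[y --> x] --> `|f x| by exact: cvg_norm.
by apply: (cvgr_le _ cn); rewrite ltrDl.
Qed.

(** Bilinearity reduces the bound to the finitely many continuous functions
    theta[e_i, e_j]. *)
Lemma theta_bound x0 : X x0 ->
  exists2 C : R, 0 <= C & \forall x \near x0, forall p p',
    `|theta P ginv x p p'| <= C * `|p| * `|p'|.
Proof.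
move=> Xx0.
pose th (ij : 'I_n * 'I_n) x := theta P ginv x (delta_mx 0 ij.1) (delta_mx 0 ij.2).
pose C := \sum_(ij : 'I_n * 'I_n) (`|th ij x0| + 1).
have H : \forall x \near x0, forall ij, `|th ij x| <= `|th ij x0| + 1.
  apply: filter_forall_nbhs => ij; apply: near_bounded.
  have H0 := @theta_Ck 0 (delta_mx 0 ij.1) (delta_mx 0 ij.2).
  exact: (H0 x0 Xx0).
have nX : \forall x \near x0, X x by exact: open_nbhs_nbhs.
exists C; first by apply: sumr_ge0 => ij _; rewrite addr_ge0.
apply: filterS2 nX H => x Xx Hx p p'.
have e : theta P ginv x p p' = \sum_(ij : 'I_n * 'I_n) (p 0 ij.1 * p' 0 ij.2) *: th ij x.
  have Ll : linear (fun q => theta P ginv x q p') by move=> a u w; exact: theta_linl.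
  pose L := HB.pack_for {linear 'rV[R]_n -> 'rV[R]_n} (fun q => theta P ginv x q p')
    (GRing.isLinear.Build _ _ _ _ _ Ll).
  rewrite -(pair_bigA _ (fun i j => (p 0 i * p' 0 j) *: th (i, j) x)) /=.
  rewrite {1}(row_delta_sum p) -[LHS]/(L _) linear_sum; apply: eq_bigr => i _.
  rewrite linearZ /L /=.
  have Lr : linear (fun q => theta P ginv x (delta_mx 0 i) q) by move=> a u w; exact: theta_linr.
  pose L' := HB.pack_for {linear 'rV[R]_n -> 'rV[R]_n} (fun q => theta P ginv x (delta_mx 0 i) q)
    (GRing.isLinear.Build _ _ _ _ _ Lr).
  rewrite {1}(row_delta_sum p') -[X in _ *: X]/(L' _) linear_sum scaler_sumr.
  by apply: eq_bigr => j _; rewrite linearZ scalerA.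
rewrite e; apply: le_trans (ler_norm_sum _ _ _) _.
rewrite /C !mulr_suml; apply: ler_sum => ij _.
rewrite normrZ normrM -[leRHS]mulrA [leRHS]mulrC.
apply: ler_pM (Hx ij); [by rewrite mulr_ge0|by []|].
by apply: ler_pM; rewrite ?mx_norm_entry.
Qed.

End Theta.

(** * Smooth dependence of the splitting on the base point *)

Section LocalSystem.
Context (R : realType) (n m r : nat) (X : set 'rV[R]_n).
Context (gh : 'rV[R]_n -> 'M[R]_n) (Dh : 'rV[R]_n -> 'M[R]_(n, m))
  (Gh : 'rV[R]_n -> 'M[R]_n).
Hypothesis oX : open X.
Hypothesis sg : smooth_on X gh.
Hypothesis pdg : forall x, X x -> posdef (gh x).
Hypothesis sD : smooth_on X Dh.
Hypothesis fD : forall x, X x -> row_full (Dh x).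
Hypothesis tDG : forall x, X x -> row_full (kermx (Dh x) + Gh x)%MS.
Hypothesis sG : forall x, X x ->
  exists (W : set 'rV[R]_n) (E : 'rV[R]_n -> 'M[R]_(r, n)),
    [/\ open W, W x, W `<=` X, smooth_on W E
      & forall y, W y -> row_free (E y) /\ (E y :=: Gh y)%MS].

Lemma ginv_smooth : smooth_on X (fun x => invmx (gh x)).
Proof.
move=> k; apply: (Ck_invmx oX) => [x Xx|]; last exact: sg.
exact/posdef_unit/pdg.
Qed.

Lemma frame_gram_smooth (W : set 'rV[R]_n) (E : 'rV[R]_n -> 'M[R]_(r, n)) :
  open W -> W `<=` X -> smooth_on W E ->
  (forall y, W y -> row_free (E y) /\ (E y :=: Gh y)%MS) ->
  smooth_on W (fun y => invmx (frame_gram (gh y) (E y))).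
Proof.
move=> oW WX sE HE k; apply: (Ck_invmx oW) => [y Wy|].
  exact/posdef_unit/frame_gram_pd/(HE y Wy).1/pdg/WX.
apply: (Ck_mulmx oW); last by apply: (Ck_tr oW); exact: sE.
by apply: (Ck_mulmx oW); [exact: sE|exact: Ck_sub (sg k)].
Qed.

(** In a local frame E of Gamma, h is a rational expression in the entries of g,
    D and E. *)
Lemma h_smooth : smooth_on X (fun x => h_map (gh x) (Dh x) (Gh x)).
Proof.
move=> k; apply: Ck_local => x /sG[W [E [oW Wx WX sE HE]]]; exists W; split=> //.
have sI : Ck k W (fun y => frame_III (gh y) (Dh y) (E y)).
  apply: (Ck_mulmx oW); last exact: sE.
  apply: (Ck_mulmx oW); last exact: (frame_gram_smooth oW WX sE HE k).
  by apply: (Ck_tr oW); apply: (Ck_mulmx oW); [exact: sE|exact: Ck_sub (sD k)].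
apply: (@Ck_ext _ _ _ _ _
  (fun y => invmx (frame_III (gh y) (Dh y) (E y) *m Dh y) *m frame_III (gh y) (Dh y) (E y))
  _ oW).
  move=> y Wy; have [E1 E2] := HE y Wy; have Xy := WX y Wy; apply: esym.
  by apply: h_frame => //; [exact: pdg|exact: fD|exact: tDG].
apply: (Ck_mulmx oW) => //; apply: (Ck_invmx oW) => [y Wy|].
  have [E1 E2] := HE y Wy; have Xy := WX y Wy.
  by apply: (frame_III_D_unit (G := Gh y)) => //; [exact: pdg|exact: fD|exact: tDG].
by apply: (Ck_mulmx oW) => //; exact: Ck_sub (sD k).
Qed.

Lemma k_smooth : smooth_on X (fun x => k_map (gh x) (Dh x) (Gh x)).
Proof. by move=> k; apply: (Ck_mulmx oX); [exact: h_smooth|exact: sg]. Qed.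

Lemma P_I_smooth : smooth_on X (fun x => P_I (gh x) (Dh x) (Gh x)).
Proof.
move=> k; apply: Ck_local => x /sG[W [E [oW Wx WX sE HE]]]; exists W; split=> //.
pose PG y := gh y *m (E y)^T *m invmx (frame_gram (gh y) (E y)) *m E y.
have sPG : Ck k W PG.
  apply: (Ck_mulmx oW); last exact: sE.
  apply: (Ck_mulmx oW); last exact: (frame_gram_smooth oW WX sE HE k).
  by apply: (Ck_mulmx oW); [exact: Ck_sub (sg k)|apply: (Ck_tr oW); exact: sE].
apply: (@Ck_ext _ _ _ _ _
  (fun y => PG y - PG y *m Dh y *m h_map (gh y) (Dh y) (Gh y)) _ oW).
  move=> y Wy; have [E1 E2] := HE y Wy; have Xy := WX y Wy; apply: esym.
  by apply: P_I_frame => //; [exact: pdg|exact: fD|exact: tDG].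
apply: (Ck_add oW) => //; apply: (Ck_opp oW); apply: (Ck_mulmx oW).
  by apply: (Ck_mulmx oW) => //; exact: Ck_sub (sD k).
exact: Ck_sub (h_smooth k).
Qed.

Lemma Pstar_I_smooth : smooth_on X (fun x => Pstar_I (gh x) (Dh x) (Gh x)).
Proof.
move=> k; apply: (@Ck_ext _ _ _ _ _ (fun x => (P_I (gh x) (Dh x) (Gh x))^T) _ oX).
  by move=> x Xx; rewrite Pstar_IE//; exact: pdg.
by apply: (Ck_tr oX); exact: P_I_smooth.
Qed.

Local Notation P := (fun x => Pstar_I (gh x) (Dh x) (Gh x)).
Local Notation ginv := (fun x => invmx (gh x)).

(** The position gradient of the Hamiltonian p g^-1 p / 2. *)
Definition dH (x p : 'rV[R]_n) : 'rV[R]_n :=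
  2^-1 *: grad (fun y => (p *m ginv y *m p^T) 0 0) x.

(** The identity behind the theorem. Differentiating p P(x) gives
    l P + p D_v P with v = p g^-1, and theta[p, p] + dH P is p D_v P. *)
Lemma momentum_split (I : set R) (x p : R -> 'rV[R]_n) (t : R) (l : 'rV[R]_n) :
  X (x t) -> is_deriv_in I x t (p t *m ginv (x t)) -> is_deriv_in I p t l ->
  is_deriv_in I (fun s => p s *m P (x s)) t
    (theta P ginv (x t) (p t) (p t) + (l + dH (x t) (p t)) *m P (x t)).
Proof.
move=> Xx Hx Hp.
have Hq := is_deriv_in_mulmx Hp (is_deriv_in_comp Hx ((Pstar_I_smooth 1%N).1 _ Xx)).
suff -> : theta P ginv (x t) (p t) (p t) + (l + dH (x t) (p t)) *m P (x t) =
  l *m P (x t) + p t *m 'D_(p t *m ginv (x t)) P (x t) by [].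
rewrite /theta /dH.
move: ('D_(p t *m ginv (x t)) P (x t)) => A.
move: (grad _ _) (P (x t)) => B C.
by rewrite mulmxDl -scalemxAl addrC -addrA [2^-1 *: _ + _]addrC subrK.
Qed.

(** The position gradients of the Hamiltonian and of the kinetic energy are
    opposite, because D (g^-1) = - g^-1 (D g) g^-1. *)
Lemma grad_ginv (x v : 'rV[R]_n) : X x ->
  dH x (v *m gh x) = - (2^-1 *: grad (fun y => (v *m gh y *m v^T) 0 0) x).
Proof.
move=> Xx; rewrite /dH -scalerN; congr (_ *: _).
apply/rowP => i; rewrite [in RHS]mxE [LHS]mxE [in RHS]mxE; set e := delta_mx 0 i.
have dg := (sg 1%N).1 x Xx; have di := (ginv_smooth 1%N).1 x Xx.
have [_ ->] := quad_derive v v e dg.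
have [_ ->] := quad_derive (v *m gh x) (v *m gh x) e di.
have gu : gh x \in unitmx by exact/posdef_unit/pdg.
have : 'D_e (fun y => gh y *m invmx (gh y)) x = 0.
  rewrite -(@derive_cst _ _ _ (1%:M : 'M[R]_n) x e); apply: near_eq_derive.
  have nX : \forall y \near x, X y by exact: open_nbhs_nbhs.
  by apply: filterS nX => y Xy; rewrite mulmxV//; exact/posdef_unit/pdg.
have [_ ->] := @derive_bilin R _ _ _ _ mulmx gh (fun y => invmx (gh y)) x
  (@mulmx_continuous R n n n) dg di.
move: ('D_e gh x) ('D_e (fun y => invmx (gh y)) x) => A B e0.
have [gs _] := pdg Xx; rewrite trmx_mul gs mulmxA.
have : v *m (A *m invmx (gh x) + gh x *m B) *m (gh x *m v^T) = 0.
  by rewrite e0 mulmx0 mul0mx.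
rewrite mulmxDr mulmxDl !mulmxA mulmxKV// => /(congr1 (fun Z : 'M[R]_1 => Z 0 0)).
rewrite mxE [RHS]mxE => /eqP; rewrite addrC addr_eq0 => /eqP ->.
by [].
Qed.

End LocalSystem.

(** * The splitting in a chart of the manifold *)

Section LocalData.
Context (R : realType) (N M r : nat) (Q : manifold R (N + M)) (U : manifold R M).
Context (g : Q -> 'M[R]_(N + M)) (pi : Q -> U) (G : Q -> 'M[R]_(N + M)).
Hypothesis g_metric : riemannian_metric g.
Hypothesis pi_subm : submersion pi.
Hypothesis G_distr : smooth_distribution r G.
Hypothesis transv : forall q, row_full (kermx (tangent_map pi q) + G q)%MS.

Lemma metric_posdef q : posdef (g q).
Proof. by have [H1 H2 _] := g_metric; exact: (conj (H1 q) (H2 q)). Qed.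

Lemma loc_metric_sym c x : (loc_metric g c x)^T = loc_metric g c x.
Proof.
by have [gs _ _] := g_metric; rewrite /loc_metric !trmx_mul trmxK gs mulmxA.
Qed.

Lemma loc_metricE c q : cdom c q ->
  loc_metric g c (cmap c q) = frame c q *m g q *m (frame c q)^T.
Proof. by move=> cq; rewrite /loc_metric cmapK. Qed.

Lemma loc_distributionE c q : cdom c q ->
  loc_distribution G c (cmap c q) = G q *m invmx (frame c q).
Proof. by move=> cq; rewrite /loc_distribution cmapK. Qed.

Lemma loc_tangentE c d q : atlas c -> atlas d -> cdom c q -> cdom d (pi q) ->
  loc_tangent_map pi c d (cmap c q) =
  frame c q *m tangent_map pi q *m invmx (frame d (pi q)).
Proof.
move=> ac ad cq dq; rewrite (tangent_map_chart pi_subm.1 ac ad cq dq).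
by rewrite mulmxK// frame_unit.
Qed.

Lemma loc_posdef c x : atlas c -> cimg c x -> posdef (loc_metric g c x).
Proof.
move=> ac [q cq <-]; rewrite loc_metricE//.
by apply: posdef_change; [exact: metric_posdef|exact: frame_unit].
Qed.

Section Adapted.
Context (c : chart R (N + M) Q) (d : chart R M U).
Hypothesis cd : adapted pi c d.

Let ac : atlas c. Proof. by case: cd. Qed.
Let ad : atlas d. Proof. by case: cd. Qed.
Let cdq q : cdom c q -> cdom d (pi q). Proof. by case: cd => _ _ H /H[]. Qed.
Local Notation gh := (loc_metric g c).
Local Notation Dh := (loc_tangent_map pi c d).
Local Notation Gh := (loc_distribution G c).

Lemma loc_tangent_full x : cimg c x -> row_full (Dh x).
Proof.
move=> [q cq <-]; rewrite loc_tangentE//; last exact: cdq.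
apply: row_full_change; first exact: pi_subm.2.
  exact: frame_unit.
by apply: frame_unit => //; exact: cdq.
Qed.

Lemma loc_transversal x : cimg c x -> row_full (kermx (Dh x) + Gh x)%MS.
Proof.
move=> [q cq <-]; rewrite loc_tangentE//; last exact: cdq.
rewrite loc_distributionE//; apply: transversal_change; first exact: transv.
exact: frame_unit.
Qed.

(** In adapted charts pi is the projection on the last M coordinates. *)
Lemma loc_tangent_cst x : cimg c x -> Dh x = rsubmx 1%:M.
Proof.
move=> cx; have df : differentiable (fun y : 'rV[R]_(N + M) => rsubmx y) x.
  by apply: linear_differentiable; exact: linear_rV_continuous.
have -> : Dh x = 'J (fun y : 'rV[R]_(N + M) => rsubmx y) x.
  apply: esym; apply: jacobian_ext => //.
  apply: filterS (near_cimg cx) => y cy; have [_ _ H] := cd.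
  by have [_] := H _ (cinv_dom cy); rewrite cinvK.
apply/row_matrixP => i; rewrite (rowE i ('J _ x)) -(deriveEjacobian _ df).
rewrite deriveE//.
have -> := @diff_lin _ _ _ (@rsubmx R 1 N M) x (@linear_rV_continuous _ _ _ _).
by rewrite rowE mulmx_rsub mulmx1.
Qed.

Lemma loc_tangent_smooth : smooth_on (cimg c) Dh.
Proof.
move=> k; apply: (@Ck_ext _ _ _ _ _ (fun=> rsubmx 1%:M) _ (@cimg_open_set _ _ _ c)).
  by move=> x cx; rewrite loc_tangent_cst.
exact: Ck_cst.
Qed.

Lemma loc_metric_smooth : smooth_on (cimg c) gh.
Proof. by have [_ _ H] := g_metric; exact: H. Qed.

(** The rank of Gamma makes the rows of a spanning family of r vectors free. *)
Lemma loc_frames x : cimg c x ->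
  exists (W : set 'rV[R]_(N + M)) (E : 'rV[R]_(N + M) -> 'M[R]_(r, N + M)),
    [/\ open W, W x, W `<=` cimg c, smooth_on W E
      & forall y, W y -> row_free (E y) /\ (E y :=: Gh y)%MS].
Proof.
move=> cx; have [W [E [oW Wx Wc sE HE]]] := G_distr.2 c x ac cx.
exists W, E; split=> // y Wy; have e := HE y Wy; split=> //.
rewrite /row_free e mxrankMfree ?G_distr.1//.
rewrite row_free_unit unitmx_inv frame_unit//; exact/cinv_dom/Wc.
Qed.

Definition loc_h (x : 'rV[R]_(N + M)) : 'M[R]_(M, N + M) :=
  h_map (gh x) (Dh x) (Gh x).

Let pdg x : cimg c x -> posdef (gh x). Proof. exact: loc_posdef. Qed.

Lemma loc_h_smooth : smooth_on (cimg c) loc_h.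
Proof.
exact: (h_smooth loc_metric_smooth pdg loc_tangent_smooth
  loc_tangent_full loc_transversal loc_frames).
Qed.

Lemma loc_k_smooth : smooth_on (cimg c) (loc_k g pi G c d).
Proof.
exact: (k_smooth (@cimg_open_set _ _ _ c) loc_metric_smooth pdg loc_tangent_smooth
  loc_tangent_full loc_transversal loc_frames).
Qed.

Lemma loc_Pstar_I_smooth : smooth_on (cimg c) (loc_Pstar_I g pi G c d).
Proof.
exact: (Pstar_I_smooth (@cimg_open_set _ _ _ c) loc_metric_smooth pdg loc_tangent_smooth
  loc_tangent_full loc_transversal loc_frames).
Qed.

Lemma loc_ginv_smooth : smooth_on (cimg c) (fun y => invmx (gh y)).
Proof. exact: (ginv_smooth (@cimg_open_set _ _ _ c) loc_metric_smooth pdg). Qed.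

Lemma loc_momentum_split (I : set R) (x p : R -> 'rV[R]_(N + M)) (t : R) l :
  cimg c (x t) -> is_deriv_in I x t (p t *m invmx (gh (x t))) -> is_deriv_in I p t l ->
  is_deriv_in I (fun s => p s *m loc_Pstar_I g pi G c d (x s)) t
    (theta_I g pi G c d (x t) (p t) (p t) +
     (l + dH gh (x t) (p t)) *m loc_Pstar_I g pi G c d (x t)).
Proof.
exact: (momentum_split (@cimg_open_set _ _ _ c) loc_metric_smooth pdg loc_tangent_smooth
  loc_tangent_full loc_transversal loc_frames).
Qed.

Context (q : Q).
Hypothesis cq : cdom c q.
Local Notation A := (frame c q).
Local Notation B := (frame d (pi q)).

Let Au : A \in unitmx. Proof. exact: frame_unit. Qed.
Let Bu : B \in unitmx. Proof. by apply: frame_unit => //; exact: cdq. Qed.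

Lemma loc_hE : loc_h (cmap c q) = B *m h_map (g q) (tangent_map pi q) (G q) *m invmx A.
Proof.
rewrite /loc_h loc_metricE// loc_distributionE// loc_tangentE//; last exact: cdq.
by apply: h_change => //; [exact: metric_posdef|exact: pi_subm.2].
Qed.

Lemma loc_kE : loc_k g pi G c d (cmap c q) =
  B *m k_map (g q) (tangent_map pi q) (G q) *m A^T.
Proof.
rewrite /loc_k loc_metricE// loc_distributionE// loc_tangentE//; last exact: cdq.
by apply: k_change => //; [exact: metric_posdef|exact: pi_subm.2].
Qed.

Lemma loc_IIIE (v : 'rV[R]_(N + M)) :
  (v <= space_III (gh (cmap c q)) (Dh (cmap c q)) (Gh (cmap c q)))%MS =
  (v *m A <= space_III (g q) (tangent_map pi q) (G q))%MS.
Proof.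
rewrite loc_metricE// loc_distributionE// loc_tangentE//; last exact: cdq.
by apply: space_III_change.
Qed.

Lemma loc_GE (v : 'rV[R]_(N + M)) : (v <= Gh (cmap c q))%MS = (v *m A <= G q)%MS.
Proof. by rewrite loc_distributionE// sub_change. Qed.

End Adapted.
End LocalData.

(** * Images of flows in a manifold *)

Lemma ball_interval (R : realType) (e : R) : 0 < e ->
  time_interval [set t : R | `|t| < e].
Proof.
move=> e0; split.
  move=> a b /= ae be t; rewrite !ltr_norml in ae be *.
  move: ae be => /andP[a1 a2] /andP[b1 b2] /andP[t1 t2].
  by apply/andP; split; lra.
exists 0, (e / 2) => /=; rewrite normr0 ger0_norm ?divr_ge0 ?ltW//.
by split=> //; lra.
Qed.

Section Flows.
Context (R : realType) (k : nat) (Z : 'rV[R]_k -> 'rV[R]_k) (D : set 'rV[R]_k).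
Context (z : R -> 'rV[R]_k) (e : R).
Hypothesis e_gt0 : 0 < e.
Hypothesis sZ : smooth_on D Z.
Hypothesis zZ : forall t : R, `|t| < e -> D (z t) /\ is_derive t 1 z (Z (z t)).
Local Notation I := [set t : R | `|t| < e].

(** The Lie derivative along the field Z. *)
Definition lie (W : normedModType R) (Y : 'rV[R]_k -> W) (x : 'rV[R]_k) : W :=
  'D_(Z x) Y x.

Lemma lie_smooth (W : normedModType R) (D' : set 'rV[R]_k) (Y : 'rV[R]_k -> W) :
  open D' -> D' `<=` D -> smooth_on D' Y -> smooth_on D' (lie Y).
Proof.
move=> oD' DD' sY j.
apply: (@Ck_ext _ _ _ _ _ (fun x => \sum_i Z x 0 i *: 'D_(delta_mx 0 i) Y x) _ oD').
  by move=> x Dx; apply: esym; apply: derive_rV; exact: (sY 1%N).1.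
apply: (Ck_sum oD') => i; apply: (Ck_scale oD'); last exact: (sY j.+1).2.
by apply: (Ck_entry _ _ oD'); exact: Ck_sub (sZ j).
Qed.

Lemma flow_is t : I t -> is_deriv_in I z t (Z (z t)).
Proof. by move=> It; apply: is_derive_in; exact: (zZ It).2. Qed.

Lemma flow_deriv (W : normedModType R) (Y : 'rV[R]_k -> W) t : I t ->
  differentiable Y (z t) -> is_deriv_in I (Y \o z) t (lie Y (z t)).
Proof. by move=> It dY; exact: is_deriv_in_comp (flow_is It) dY. Qed.

Lemma flow_cont (T : topologicalType) (Y : 'rV[R]_k -> T) t : I t ->
  {for z t, continuous Y} -> cont_in I (Y \o z) t.
Proof.
move=> It cY; have cz := is_deriv_in_cont (flow_is It).
by apply: (@cvg_trans _ (Y @ nbhs (z t))); [exact: cvg_app cz|exact: cY].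
Qed.

Section IntoManifold.
Context (n : nat) (Q : manifold R n) (Phi : 'rV[R]_k -> Q).

Definition smooth_into := forall c, atlas c ->
  open (D `&` Phi @^-1` cdom c) /\
  smooth_on (D `&` Phi @^-1` cdom c) (cmap c \o Phi).

Hypothesis sPhi : smooth_into.

Lemma smooth_into_cont x : D x -> {for x, continuous Phi}.
Proof.
move=> Dx; set c := chart_at (Phi x).
have ac : atlas c := chart_at_atlas _.
have cx : cdom c (Phi x) := chart_at_dom _.
have [oc sc] := sPhi ac.
have cf : {for x, continuous (cinv c \o (cmap c \o Phi))}.
  apply: continuous_comp; first exact: (sc 0%N).
  by apply: cinv_cont; exists (Phi x).
have e1 : (cinv c \o (cmap c \o Phi)) x = Phi x by rewrite /= cmapK.
have nD : \forall y \near x, (D `&` Phi @^-1` cdom c) y by exact: open_nbhs_nbhs.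
have ne : \forall y \near x, (cinv c \o (cmap c \o Phi)) y = Phi y.
  by apply: filterS nD => y [_ cy]; rewrite /= cmapK.
change (Phi @ x --> Phi x).
by rewrite -[X in _ --> X]e1; exact: cvg_trans (near_eq_cvg ne) cf.
Qed.

Lemma flow_chart c t : atlas c -> I t -> cdom c (Phi (z t)) ->
  is_deriv_in I (cmap c \o (Phi \o z)) t (lie (cmap c \o Phi) (z t)).
Proof.
move=> ac It ct; have [oc sc] := sPhi ac.
apply: (@flow_deriv _ (cmap c \o Phi)) => //.
by apply: (sc 1%N).1; split=> //; exact: (zZ It).1.
Qed.

(** Along a flow, differentiation in time is the Lie derivative, which preserves
    smoothness. The first two derivatives of the coordinates of Phi o z are thus
    smooth functions of z. *)
Lemma flow_C2_curve : C2_curve I (Phi \o z).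
Proof.
have TI := ball_interval e_gt0.
have cq t : I t -> cont_in I (Phi \o z) t.
  by move=> It; apply: flow_cont => //; apply: smooth_into_cont; exact: (zZ It).1.
have near_dom c t : atlas c -> I t -> cdom c (Phi (z t)) ->
    \forall s \near t, I s -> cdom c (Phi (z s)).
  by move=> ac It ct; exact: (cq t It) _ (near_cdom ct).
pose Dc (c : chart R n Q) := D `&` Phi @^-1` cdom c.
have Dt c t : I t -> cdom c (Phi (z t)) -> Dc c (z t).
  by move=> It ct; split=> //; exact: (zZ It).1.
pose V (c : chart R n Q) := lie (cmap c \o Phi).
have sV c : atlas c -> smooth_on (Dc c) (V c).
  by move=> ac; have [oc sc] := sPhi ac; apply: lie_smooth => // y [].
have dV c t : atlas c -> I t -> cdom c (Phi (z t)) ->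
    deriv_in I (cmap c \o (Phi \o z)) t = V c (z t).
  by move=> ac It ct; apply: deriv_inE => //; exact: flow_chart.
have nV c t : atlas c -> I t -> cdom c (Phi (z t)) ->
    \forall s \near t, I s -> (V c \o z) s = deriv_in I (cmap c \o (Phi \o z)) s.
  move=> ac It ct; apply: filterS (near_dom c t ac It ct) => s H Is.
  by apply: esym; apply: dV => //; exact: H.
have hV c t : atlas c -> I t -> cdom c (Phi (z t)) ->
    is_deriv_in I (deriv_in I (cmap c \o (Phi \o z))) t (lie (V c) (z t)).
  move=> ac It ct; apply: (is_deriv_in_ext (nV c t ac It ct) It).
  by apply: flow_deriv => //; apply: (sV c ac 1%N).1; exact: Dt.
split; [split; [split|]|].
- exact: cq.
- by move=> c t ac It ct; apply: is_deriv_in_derivable; exact: flow_chart.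
- by move=> c t ac It ct; exact: is_deriv_in_cont (hV c t ac It ct).
- move=> c t ac It ct v; split; first by apply: is_deriv_in_derivable; exact: hV.
  rewrite /cont_in (deriv_inE TI It (hV c t ac It ct)).
  have cl : cont_in I (lie (V c) \o z) t.
    apply: flow_cont => //; have [oc sc] := sPhi ac.
    have sl : smooth_on (Dc c) (lie (V c)) by apply: (lie_smooth oc) => [y []//|]; exact: sV.
    by apply: (sl 0%N); exact: Dt.
  apply: cvg_trans cl; apply: near_eq_cvg; rewrite near_withinE.
  apply: filterS (near_dom c t ac It ct) => s H Is.
  by apply: esym; apply: deriv_inE => //; apply: hV => //; exact: H.
Qed.

End IntoManifold.
End Flows.

(** * Momentum of solutions and vanishing of Psi *)

Section MomentumOfSolutions.
Context (R : realType) (N M r : nat) (Q : manifold R (N + M)) (U : manifold R M).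
Context (g : Q -> 'M[R]_(N + M)) (pi : Q -> U) (G : Q -> 'M[R]_(N + M)).
Hypothesis g_metric : riemannian_metric g.
Hypothesis pi_subm : submersion pi.
Hypothesis G_distr : smooth_distribution r G.
Hypothesis transv : forall q, row_full (kermx (tangent_map pi q) + G q)%MS.

Section Adapted.
Context (c : chart R (N + M) Q) (d : chart R M U).
Hypothesis cd : adapted pi c d.
Let ac : atlas c. Proof. by case: cd. Qed.
Let ad : atlas d. Proof. by case: cd. Qed.
Local Notation gh := (loc_metric g c).
Local Notation Dh := (loc_tangent_map pi c d).
Local Notation Gh := (loc_distribution G c).
Local Notation Ph := (loc_Pstar_I g pi G c d).

Lemma grad_hamiltonian (x p : 'rV[R]_(N + M)) : cimg c x ->
  grad (fun y => hamiltonian g c y p) x = dH (loc_metric g c) x p.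
Proof.
move=> cx; apply/rowP => i; rewrite [LHS]mxE [RHS]mxE [X in _ = _ * X]mxE.
set e := delta_mx 0 i.
have [df _] := quad_derive p p e ((loc_ginv_smooth g_metric cd 1%N).1 x cx).
apply: etrans (deriveZ _ _) _ => //; exact: diff_derivable.
Qed.

(** If p stays in the kernel of P*_I, the left-hand side of the fundamental
    identity is the derivative of 0. *)
Lemma horizontal_momentum (I : set R) (x p : R -> 'rV[R]_(N + M)) (t : R) l :
  time_interval I -> I t -> cimg c (x t) ->
  is_deriv_in I x t (p t *m invmx (gh (x t))) -> is_deriv_in I p t l ->
  (\forall s \near t, I s -> p s *m Ph (x s) = 0) ->
  theta_I g pi G c d (x t) (p t) (p t) + (l + dH gh (x t) (p t)) *m Ph (x t) = 0.
Proof.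
move=> TI It cx Hx Hp H0.
have H1 := loc_momentum_split g_metric pi_subm G_distr transv cd cx Hx Hp.
have H2 := is_deriv_in_ext H0 It H1.
by rewrite -(deriv_inE TI It H2) (deriv_inE TI It (is_deriv_in_cst I _ t)).
Qed.

Lemma loc_ann x (s : 'rV[R]_(N + M)) : cimg c x ->
  (s <= kermx (Delta_loc pi c d x)^T + kermx (Gh x)^T)%MS <-> s *m Ph x = 0.
Proof.
move=> cx; apply: (@ann_Pstar_I _ _ _ (gh x) (Dh x) (Gh x)).
- exact: loc_posdef.
- exact: loc_tangent_full.
- exact: loc_transversal.
Qed.

Lemma cinv_into : smooth_into (cimg c) (cinv c).
Proof.
move=> c' ac'; have -> : cimg c `&` cinv c @^-1` cdom c' = cmap c @` (cdom c `&` cdom c').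
  by apply/seteqP; split=> y; [move=> [? ?]; apply/restrict_imgP|move=> /restrict_imgP[]].
by split; [exact/restrict_img_open/cdom_open|exact: atlas_compat].
Qed.

Lemma pi_cinv_into : smooth_into (cimg c) (pi \o cinv c).
Proof.
move=> d' ad'; have -> : cimg c `&` (pi \o cinv c) @^-1` cdom d' =
    cmap c @` (cdom c `&` pi @^-1` cdom d').
  by apply/seteqP; split=> y; [move=> [? ?]; apply/restrict_imgP|move=> /restrict_imgP[]].
split; first by apply/restrict_img_open/map_preim_open; exact: pi_subm.1.
exact: (pi_subm.1.2 c d' ac ad').
Qed.

Lemma cmap_u x : cimg c x -> cmap d (pi (cinv c x)) = rsubmx x.
Proof.
by move=> cx; have [_ _ H] := cd; have [_ ->] := H _ (cinv_dom cx); rewrite cinvK.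
Qed.

Lemma rsubmx_tangent x (v : 'rV[R]_(N + M)) : cimg c x -> v *m Dh x = rsubmx v.
Proof. by move=> cx; rewrite (loc_tangent_cst cd cx) mulmx_rsub mulmx1. Qed.

Lemma loc_h_tangent x : cimg c x -> loc_h g pi G c d x *m Dh x = 1%:M.
Proof.
move=> cx; apply: h_mulD; first exact: loc_posdef.
  exact: loc_tangent_full.
exact: loc_transversal.
Qed.

Lemma loc_k_Pstar_I x : cimg c x -> loc_k g pi G c d x *m Ph x = 0.
Proof. by move=> cx; apply: k_Pstar_I; exact: loc_posdef. Qed.

Lemma loc_k_ginv x : cimg c x ->
  loc_k g pi G c d x *m invmx (gh x) = loc_h g pi G c d x.
Proof.
by move=> cx; rewrite /loc_k /k_map mulmxK//; apply: posdef_unit; exact: loc_posdef.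
Qed.

(** For the field x' = h_x(w) with w constant in coordinates, the control is
    smooth and the momentum is differentiable, so the pointwise momentum equation
    is available at time 0, where x is arbitrary. *)
Lemma Psi_of_hamiltonian (x0 : 'rV[R]_(N + M)) (w : 'rV[R]_M) : cimg c x0 ->
  (forall (I : set R) (u : R -> U) (q : R -> Q),
     time_interval I -> C1_curve I u -> control_solution g pi G I u q ->
     let p t := velocity I u t
                *m k_map (g (q t)) (tangent_map pi (q t)) (G (q t)) in
     ham_solution g pi G (fun _ _ _ => 0) I u q p) ->
  Psi g pi G c d x0 w = 0.
Proof.
move=> cx0 ham.
(* The integral curve through x0 of the horizontal lift of w. *)
pose Z (x : 'rV[R]_(N + M)) := w *m loc_h g pi G c d x.
have oX := @cimg_open_set _ _ _ c.
have sZ : smooth_on (cimg c) Z.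
  move=> k; apply: (Ck_mulmx oX); first exact: Ck_cst.
  exact: (loc_h_smooth g_metric pi_subm G_distr transv cd).
have [e [e0 [z [z0 Hz]]]] := ode_exists oX (sZ 1%N) cx0.
pose I := [set t : R | `|t| < e].
have TI : time_interval I := ball_interval e0.
have I0 : I 0 by rewrite /I /= normr0.
pose q := cinv c \o z; pose u := pi \o q.
have Xz t : I t -> cimg c (z t) by move=> /Hz[].
have cqt t : I t -> cdom c (q t) by move=> /Xz/cinv_dom.
have qC2 : C2_curve I q by exact: (flow_C2_curve e0 sZ Hz cinv_into).
have uC2 : C2_curve I u by exact: (flow_C2_curve e0 sZ Hz pi_cinv_into).
have zI t : I t -> is_deriv_in I z t (Z (z t)) by move=> It; exact: (flow_is Hz It).
have cq t : I t -> cmap c (q t) = z t by move=> It; rewrite /q /= cinvK//; exact: Xz.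
have dqt t : I t -> is_deriv_in I (cmap c \o q) t (Z (z t)).
  move=> It; apply: (is_deriv_in_ext _ It (zI t It)).
  by apply: filterE => s Is; rewrite /= cq.
have dut t : I t -> is_deriv_in I (cmap d \o u) t w.
  move=> It; have : is_deriv_in I (fun s => rsubmx (z s)) t (rsubmx (Z (z t))).
    by apply: is_deriv_in_lin (zI t It); exact: linear_rV_continuous.
  rewrite -(rsubmx_tangent _ (Xz t It)) /Z -mulmxA (loc_h_tangent (Xz t It)) mulmx1.
  by apply: is_deriv_in_ext It; apply: filterE => s Is; rewrite /= cmap_u//; exact: Xz.
have vq t : I t -> velocity I q t = Z (z t) *m frame c (q t).
  by move=> It; apply: velocity_chart => //; [exact: qC2.1.1.1|exact: cqt|exact: dqt].
have vu t : I t -> velocity I u t = w *m frame d (u t).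
  move=> It; apply: velocity_chart => //; [exact: uC2.1.1.1| |exact: dut].
  by have [_ _ H] := cd; exact: (H _ (cqt t It)).1.
have csol : control_solution g pi G I u q.
  split; first exact: qC2.1.1.
  move=> t It; split=> //; rewrite vq// vu// /Z -(cq t It).
  rewrite (loc_hE g_metric pi_subm transv cd (cqt t It)) [w *m _]mulmxA.
  by rewrite mulmxKV ?frame_unit ?mulmxA//; exact: cqt.
have [_ /(_ c d cd)[H _]] := ham I u q TI uC2.1 csol.
pose ph s := w *m loc_k g pi G c d (z s).
set p := (fun t : R => _) in H.
have pE s : I s -> ph s = pc q p c s.
  move=> Is; rewrite /ph /pc /covec /p vu// -(cq s Is).
  by rewrite (loc_kE g_metric pi_subm transv cd (cqt s Is)) !mulmxA.
have dk := (loc_k_smooth g_metric pi_subm G_distr transv cd 1%N).1 _ (Xz 0 I0).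
have Hph := is_deriv_in_mulmx (is_deriv_in_cst I w 0) (is_deriv_in_comp (zI 0 I0) dk).
set l := (X in is_deriv_in _ _ _ X) in Hph.
have Hpc : is_deriv_in I (pc q p c) 0 l.
  by apply: (is_deriv_in_ext _ I0 Hph); apply: filterE => s Is; exact: pE.
have [_ _ _ _ Hm] := H 0 I0 (cqt 0 I0).
have [rr [rann]] := Hm (is_deriv_in_derivable Hpc).
rewrite (deriv_inE TI I0 Hpc) /drift cq// z0 -pE// /covec mul0mx addr0 => el.
have Hz0 : is_deriv_in I z 0 (ph 0 *m invmx (gh (z 0))).
  by rewrite /ph -mulmxA (loc_k_ginv (Xz 0 I0)); exact: zI.
have ph0 : \forall s \near (0 : R), I s -> ph s *m Ph (z s) = 0.
  by apply: filterE => s Is; rewrite /ph -mulmxA (loc_k_Pstar_I (Xz s Is)) mulmx0.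
have e1 : l + dH gh (z 0) (ph 0) = rr.
  by rewrite el z0 (grad_hamiltonian _ cx0) addrAC addNr add0r.
have := horizontal_momentum TI I0 (Xz 0 I0) Hz0 Hph ph0.
rewrite -/l e1 z0.
move: rann; rewrite cq// z0 => /(loc_ann _ cx0) ->.
by rewrite addr0 /ph z0.
Qed.

End Adapted.
End MomentumOfSolutions.

(** * Inertial motions and invariance of space_III *)

(** When f vanishes on (z, z), every remaining term of f (y + z, y + z) has a
    factor y. *)
Lemma bilinear_bound (R : realType) (V : normedModType R) (f : V -> V -> V) (C : R)
    (p y z : V) : (forall u v, `|f u v| <= C * `|u| * `|v|) ->
  f p p = f y y + f y z + f z y + f z z -> f z z = 0 ->
  `|f p p| <= C * `|y| * `|y| + C * `|y| * `|z| + C * `|z| * `|y|.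
Proof.
move=> fC -> ->; rewrite addr0; apply: le_trans (ler_normD _ _) _; apply: lerD => //.
by apply: le_trans (ler_normD _ _) _; apply: lerD.
Qed.

Section Kinetic.
Context (R : realType) (N M r : nat) (Q : manifold R (N + M)) (U : manifold R M).
Context (g : Q -> 'M[R]_(N + M)) (pi : Q -> U) (G : Q -> 'M[R]_(N + M)).
Hypothesis g_metric : riemannian_metric g.
Hypothesis pi_subm : submersion pi.
Hypothesis G_distr : smooth_distribution r G.
Hypothesis transv : forall q, row_full (kermx (tangent_map pi q) + G q)%MS.

Lemma grad_kinetic_v c (x v : 'rV[R]_(N + M)) :
  grad (kinetic g c x) v = v *m loc_metric g c x.
Proof. exact: (grad_quadratic v (loc_metric_sym g_metric c x)). Qed.

Lemma grad_kinetic_x c (x v : 'rV[R]_(N + M)) : atlas c -> cimg c x ->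
  grad (fun y => kinetic g c y v) x = - dH (loc_metric g c) x (v *m loc_metric g c x).
Proof.
move=> ac cx; have [_ _ sg] := g_metric; have sc := sg c ac.
have pdg y (cy : cimg c y) := loc_posdef g_metric ac cy.
apply: etrans _ (esym (congr1 -%R (grad_ginv (@cimg_open_set _ _ _ c) sc pdg v cx))).
rewrite opprK; apply/rowP => i; rewrite [LHS]mxE [RHS]mxE [X in _ = _ * X]mxE.
set e := delta_mx 0 i.
have [df _] := quad_derive v v e ((sc 1%N).1 x cx).
apply: etrans (deriveZ _ _) _ => //; exact: diff_derivable.
Qed.

End Kinetic.

Section MotionInChart.
Context (R : realType) (N M r : nat) (Q : manifold R (N + M)) (U : manifold R M).
Context (g : Q -> 'M[R]_(N + M)) (pi : Q -> U) (G : Q -> 'M[R]_(N + M)).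
Hypothesis g_metric : riemannian_metric g.
Hypothesis pi_subm : submersion pi.
Hypothesis G_distr : smooth_distribution r G.
Hypothesis transv : forall q, row_full (kermx (tangent_map pi q) + G q)%MS.
Context (c : chart R (N + M) Q) (d : chart R M U).
Hypothesis cd : adapted pi c d.
Let ac : atlas c. Proof. by case: cd. Qed.
Local Notation gh := (loc_metric g c).
Local Notation Dh := (loc_tangent_map pi c d).
Local Notation Gh := (loc_distribution G c).
Local Notation Ph := (loc_Pstar_I g pi G c d).

Lemma sub_III_Pstar x (v : 'rV[R]_(N + M)) : cimg c x -> (v <= Gh x)%MS ->
  (v <= space_III (gh x) (Dh x) (Gh x))%MS = (v *m gh x *m Ph x == 0).
Proof.
move=> cx vG; have pg := loc_posdef g_metric ac cx.
rewrite (space_III_P_I _ _ pg) vG /=.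
have -> : v *m gh x *m Ph x = v *m P_I (gh x) (Dh x) (Gh x) *m gh x.
  by rewrite /loc_Pstar_I Pstar_IE// -mulmxA -orth_proj_adj// mulmxA.
move: (v *m P_I _ _ _) => w.
by rewrite [in RHS]mulmx_free_eq0// row_free_unit posdef_unit.
Qed.

Lemma horizontal_part_III x (v : 'rV[R]_(N + M)) : cimg c x -> (v <= Gh x)%MS ->
  exists p, v *m gh x - v *m gh x *m Ph x = p *m loc_Pstar_III g pi G c d x.
Proof.
move=> cx vG; have pg := loc_posdef g_metric ac cx.
exists (v *m gh x - v *m gh x *m Ph x).
have -> : v *m gh x - v *m gh x *m Ph x =
    (v - v *m P_I (gh x) (Dh x) (Gh x)) *m gh x.
  by rewrite /loc_Pstar_I Pstar_IE// -mulmxA -orth_proj_adj// mulmxA mulmxBl.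
have := sub_P_I_III (Dh x) pg vG; move: (v - _) => w w3.
rewrite /loc_Pstar_III /Pstar_III /dual_proj [RHS]mulmxA [X in _ = X *m _]mulmxA.
by rewrite mulmxK ?posdef_unit// orth_proj_id.
Qed.

Context (I : set R) (q : R -> Q).
Hypothesis TI : time_interval I.
Hypothesis motion : inertial_motion g G I q.
Local Notation x := (cmap c \o q).
Local Notation v := (deriv_in I x).
Local Notation p := (fun t => v t *m gh (x t)).
Local Notation y := (fun t => p t *m Ph (x t)).

Lemma motion_velocity t : I t -> cdom c (q t) -> (v t <= Gh (x t))%MS.
Proof.
move=> It ct; have [[[dq _] _] vG _] := motion.
by rewrite (loc_GE G cd ct) -(velocity_deriv TI dq ac It ct); exact: vG.
Qed.

Lemma motion_III t : I t -> cdom c (q t) ->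
  (velocity I q t <= space_III (g (q t)) (tangent_map pi (q t)) (G (q t)))%MS =
  (y t == 0).
Proof.
move=> It ct; have [[[dq _] _] _ _] := motion.
rewrite (velocity_deriv TI dq ac It ct) -(loc_IIIE g G pi_subm cd ct).
by apply: sub_III_Pstar; [exact: cimg_map|exact: motion_velocity].
Qed.

(** The Euler-Lagrange covector p' - dT/dq equals p' + dH and annihilates Gamma, so
    its P*_I part vanishes. *)
Lemma motion_deriv t : I t -> cdom c (q t) ->
  is_deriv_in I y t (theta_I g pi G c d (x t) (p t) (p t)).
Proof.
move=> It ct; have [[[dq _] dv] _ el] := motion.
have cx : cimg c (x t) by exact: cimg_map.
have Hx : is_deriv_in I x t (v t) by exact: diff_curve_is.
have gu : gh (x t) \in unitmx by exact/posdef_unit/loc_posdef.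
have Hv := derivable_in_is (dv c t ac It ct).1.
have dg := (loc_metric_smooth g_metric cd 1%N).1 _ cx.
have Hp := is_deriv_in_mulmx Hv (is_deriv_in_comp Hx dg).
set l := (X in is_deriv_in _ _ _ X) in Hp.
have Hx' : is_deriv_in I x t (p t *m invmx (gh (x t))) by rewrite mulmxK.
have := loc_momentum_split g_metric pi_subm G_distr transv cd cx Hx' Hp.
suff -> : (l + dH gh (x t) (p t)) *m Ph (x t) = 0 by rewrite addr0.
apply/(loc_ann g_metric pi_subm transv cd _ cx).
apply: submx_trans (addsmxSr _ _); have := el c t ac It ct; cbv zeta.
rewrite (grad_kinetic_x g_metric _ ac cx) opprK.
have -> : (fun s => grad (kinetic g c (x s)) (v s)) = p.
  by apply/funext => s; exact: grad_kinetic_v.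
by rewrite (deriv_inE TI It Hp).
Qed.

Hypothesis theta0 : forall x0, cimg c x0 -> forall p0 : 'rV[R]_(N + M),
  let w := p0 *m loc_Pstar_III g pi G c d x0 in theta_I g pi G c d x0 w w = 0.

(** If y = p P*_I is nonzero at t0 it is nonzero nearby. If it is zero,
    theta[p, p] is bounded by a multiple of |y| and Gronwall applies. *)
Lemma motion_locally_III t0 : I t0 -> cdom c (q t0) ->
  let S t := (velocity I q t <= space_III (g (q t)) (tangent_map pi (q t)) (G (q t)))%MS in
  (\forall t \near t0, I t -> S t) \/ (\forall t \near t0, I t -> ~ S t).
Proof.
move=> It0 ct0 S; have [[[dq _] dv] _ _] := motion.
have ndom := cont_near (dq.1 t0 It0) ct0.
have dy := motion_deriv It0 ct0; have cy := is_deriv_in_cont dy.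
have cx0 : cimg c (x t0) by exact: cimg_map.
have [y0|y0] := eqVneq (y t0) 0; last first.
  right.
  have ny : \forall t \near t0, I t -> y t != 0.
    by have := cvgr_neq0 _ cy y0; rewrite near_withinE; apply.
  apply: filterS2 ndom ny => t ct yt It; rewrite /S motion_III//; last exact: ct.
  by apply/negP/yt.
left.
have cp : cont_in I p t0.
  have Hx := diff_curve_is dq ac It0 ct0.
  have Hv := derivable_in_is (dv c t0 ac It0 ct0).1.
  have dg := (loc_metric_smooth g_metric cd 1%N).1 _ cx0.
  exact: is_deriv_in_cont (is_deriv_in_mulmx Hv (is_deriv_in_comp Hx dg)).
have by_ := cont_in_bounded cy; have bp := cont_in_bounded cp.
have sP := loc_Pstar_I_smooth g_metric pi_subm G_distr transv cd.
have sg := loc_ginv_smooth g_metric cd.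
have [C C0 Cth] := theta_bound (@cimg_open_set _ _ _ c) sP sg cx0.
have nth : \forall t \near t0, I t -> forall p1 p2,
    `|theta_I g pi G c d (x t) p1 p2| <= C * `|p1| * `|p2|.
  have cx : cont_in I x t0 := is_deriv_in_cont (diff_curve_is dq ac It0 ct0).
  exact: (cx _ Cth).
(* y and z are bounded near t0, which makes the bilinear bound linear in y. *)
pose B := `|p t0| + 1; pose B' := `|y t0| + 1.
pose K := C * (B' + 2 * (B + B')).
have K0 : 0 <= K by rewrite /K /B /B' !(mulr_ge0, addr_ge0).
have Hall : \forall t \near t0, I t ->
    is_deriv_in I y t (theta_I g pi G c d (x t) (p t) (p t)) /\
    `|theta_I g pi G c d (x t) (p t) (p t)| <= K * `|y t|.
  have n1 : \forall t \near t0, (I t -> cdom c (q t)) /\ (I t -> forall p1 p2,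
    `|theta_I g pi G c d (x t) p1 p2| <= C * `|p1| * `|p2|) by exact: filterI.
  apply: filterS3 n1 by_ bp => t [ct th] yB pB It.
  split; first by apply: motion_deriv => //; exact: ct.
  have cx : cimg c (x t) by apply: cimg_map; exact: ct.
  have vG := motion_velocity It (ct It).
  have [p1 ep] := horizontal_part_III cx vG.
  set z := (X in X = _) in ep.
  have ez : p t = y t + z by rewrite /z addrC subrK.
  have tz : theta_I g pi G c d (x t) z z = 0 by rewrite ep; exact: theta0.
  have := theta_expand sP sg (y t) z cx.
  rewrite -ez => et; apply: le_trans (bilinear_bound (th It) et tz) _.
  have yB' : `|y t| <= B' := yB It.
  have zB : `|z| <= B + B'.
    by apply: le_trans (ler_normB _ _) _; apply: lerD => //; exact: pB.
  move: yB' zB; rewrite /K; move: (normr_ge0 (y t)) (normr_ge0 z).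
  move: `|y t| `|z| (B) (B') => a b B1 B2 a0 b0 h1 h2.
  have -> : C * a * a + C * a * b + C * b * a = C * a * (a + 2 * b) by ring.
  have -> : C * (B2 + 2 * (B1 + B2)) * a = C * a * (B2 + 2 * (B1 + B2)) by ring.
  apply: ler_wpM2l; first by rewrite mulr_ge0.
  by apply: lerD => //; rewrite ler_pM2l.
have near_y0 := gronwall_near TI.1 It0 K0 y0 Hall.
apply: filterS2 ndom near_y0 => t ct yt It; rewrite /S (motion_III It (ct It)).
by apply/eqP; exact: yt.
Qed.

End MotionInChart.

Section Invariance.
Context (R : realType) (N M r : nat) (Q : manifold R (N + M)) (U : manifold R M).
Context (g : Q -> 'M[R]_(N + M)) (pi : Q -> U) (G : Q -> 'M[R]_(N + M)).
Hypothesis g_metric : riemannian_metric g.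
Hypothesis pi_subm : submersion pi.
Hypothesis G_distr : smooth_distribution r G.
Hypothesis transv : forall q, row_full (kermx (tangent_map pi q) + G q)%MS.

Lemma III_invariant :
  (forall c d, adapted pi c d ->
     forall x, cimg c x -> forall p : 'rV[R]_(N + M),
       let v := p *m loc_Pstar_III g pi G c d x in
       theta_I g pi G c d x v v = 0) ->
  inertially_invariant g G
    [set qv | (qv.2 <= space_III (g qv.1) (tangent_map pi qv.1) (G qv.1))%MS].
Proof.
move=> H I q TI motion [t0 [It0 S0]] t It.
pose S t := is_true (velocity I q t <= space_III (g (q t)) (tangent_map pi (q t)) (G (q t)))%MS.
apply: (@interval_clopen _ I S TI.1 _ t0 t It0 S0 It) => s Is.
have [c [d [cd cs]]] := adapted_chart_exists pi_subm (q s).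
exact: (motion_locally_III g_metric pi_subm G_distr transv cd TI motion (H c d cd) Is cs).
Qed.

End Invariance.

(** * Covariance of the Euler-Lagrange covector *)

Section MovingQuadratic.
Context (R : realType) (n : nat).

Lemma grad_mul (f : 'rV[R]_n -> R) (x w : 'rV[R]_n) : differentiable f x ->
  (grad f x *m w^T) 0 0 = 'D_w f x :> R.
Proof.
move=> df; apply: etrans _ (esym (derive_rV w df)).
by rewrite mxE; apply: eq_bigr => i _; rewrite !mxE mulrC.
Qed.

(** Symmetry of f merges the two terms in which a is differentiated. *)
Lemma quad_moving (V : normedModType R) (a : V -> 'rV[R]_n) (f : V -> 'M[R]_n) (x e : V) :
  differentiable a x -> differentiable f x -> (f x)^T = f x ->
  differentiable (fun y => 2^-1 * (a y *m f y *m (a y)^T) 0 0) x /\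
  'D_e (fun y => 2^-1 * (a y *m f y *m (a y)^T) 0 0) x =
    (a x *m f x *m ('D_e a x)^T) 0 0 + 2^-1 * (a x *m 'D_e f x *m (a x)^T) 0 0.
Proof.
move=> da df fs.
have [d1 e1] := derive_bilin (@mulmx_continuous R 1 n n) da df.
have d2 := @derive_linE R _ _ _ (@trmx R 1 n) a x e
  (@linear_rV_continuous R n _ (@trmx R 1 n)) da.
have [d3 e3] := derive_bilin (@mulmx_continuous R 1 n 1) d1 d2.1.
have lE : linear (fun M : 'M[R]_1 => 2^-1 * M 0 0 : R).
  by move=> b M1 M2; rewrite !mxE mulrDr mulrCA.
pose L := HB.pack_for {linear 'M[R]_1 -> R} (fun M : 'M[R]_1 => 2^-1 * M 0 0 : R)
  (GRing.isLinear.Build _ _ _ _ _ lE).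
have cL : continuous L.
  move=> M; apply: (@cvgM _ _ (nbhs M)); first exact: cvg_cst.
  exact: coord_continuous.
have [d4 e4] := derive_linE e cL d3; split; first exact: d4.
apply: etrans e4 _; rewrite e3 e1 d2.2 /L /=.
move: ('D_e a x) ('D_e f x) (a x) (f x) fs => A F b S fs.
rewrite mulmxDl.
have -> : A *m S *m b^T = (b *m S *m A^T)^T by rewrite !trmx_mul !trmxK fs mulmxA.
move: (b *m S *m A^T) (b *m F *m b^T) => B C.
have -> : (B^T + C + B) 0 0 = B 0 0 + C 0 0 + B 0 0 by rewrite !mxE.
by field.
Qed.

End MovingQuadratic.

Lemma ann_change (R : realType) n (e e' : 'rV[R]_n) (W W' J : 'M[R]_n) :
  (forall w : 'rV[R]_n, (e *m w^T) 0 0 = (e' *m (w *m J)^T) 0 0) -> W' = W *m J ->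
  (e <= kermx W^T)%MS -> (e' <= kermx W'^T)%MS.
Proof.
move=> H ->; rewrite !sub_kermx => /eqP e0; apply/eqP/matrixP => k i; rewrite ord1 [RHS]mxE.
have := H (row i W); rewrite -row_mul !tr_row.
have ec (z : 'rV[R]_n) (X : 'M[R]_n) : (z *m col i X) 0 0 = (z *m X) 0 i.
  by rewrite !mxE; apply: eq_bigr => j _; rewrite mxE.
by rewrite !ec e0 => <-; rewrite mxE.
Qed.

(** The second-derivative terms of the time derivative and of the position
    gradient cancel. *)
Lemma momentum_balance (R : realType) n (l l' g1 g2 w b p a : 'rV[R]_n) :
  l *m w^T = l' *m b^T + p *m a^T ->
  (g1 *m w^T) 0 0 = (p *m a^T) 0 0 + (g2 *m b^T) 0 0 ->
  ((l - g1) *m w^T) 0 0 = ((l' - g2) *m b^T) 0 0.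
Proof.
move=> el eg; rewrite !mulmxBl el.
have -> : (l' *m b^T + p *m a^T - g1 *m w^T) 0 0 =
    (l' *m b^T) 0 0 + (p *m a^T) 0 0 - (g1 *m w^T) 0 0.
  by move: (l' *m _) (p *m _) (g1 *m _) => A B C; rewrite !mxE.
have -> : (l' *m b^T - g2 *m b^T) 0 0 = (l' *m b^T) 0 0 - (g2 *m b^T) 0 0.
  by move: (l' *m _) (g2 *m _) => A B; rewrite !mxE.
by rewrite eg addrKA.
Qed.

Section EulerLagrange.
Context (R : realType) (n : nat) (Q : manifold R n) (g : Q -> 'M[R]_n).
Hypothesis gs : forall q, (g q)^T = g q.
Hypothesis sg : forall c, atlas c -> smooth_on (cimg c) (loc_metric g c).
Implicit Types c : chart R n Q.

Lemma loc_metric_tr c x : (loc_metric g c x)^T = loc_metric g c x.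
Proof. by rewrite /loc_metric !trmx_mul trmxK gs mulmxA. Qed.

Lemma loc_metric_change c c' x : atlas c -> atlas c' -> cimg c x ->
  cdom c' (cinv c x) ->
  let J := 'J (trans c c') x in
  loc_metric g c x = J *m loc_metric g c' (trans c c' x) *m J^T.
Proof.
move=> ac ac' cx c'x J; have cq := cinv_dom cx.
have eA : frame c (cinv c x) = J *m frame c' (cinv c x).
  by rewrite (frame_change ac ac' cq c'x) cinvK.
rewrite /loc_metric eA; have -> : cinv c' (trans c c' x) = cinv c x by exact: cmapK.
by move: (frame c' _) (J) (g _) => A B S; rewrite trmx_mul !mulmxA.
Qed.

(** In the coordinates of c the kinetic energy at fixed v is that of c' at the
    moving velocity D_v T, with T the change of coordinates; hence the
    second-derivative term. *)
Lemma grad_kinetic_change c c' x (v w : 'rV[R]_n) : atlas c -> atlas c' -> cimg c x ->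
  cdom c' (cinv c x) ->
  let T := trans c c' in let a := 'D_v T x in
  (grad (fun z => kinetic g c z v) x *m w^T) 0 0 =
  (a *m loc_metric g c' (T x) *m ('D_w ('D_v T) x)^T) 0 0
  + (grad (fun z => kinetic g c' z a) (T x) *m ('D_w T x)^T) 0 0 :> R.
Proof.
move=> ac ac' cx c'x T a; pose X := cmap c @` (cdom c `&` cdom c').
have oX : open X by exact/restrict_img_open/cdom_open.
have sT k : Ck k X T by exact: trans_Ck.
have Xx : X x by apply/restrict_imgP.
have cT : cimg c' (T x) by exact: cimg_map.
have dT := (sT 1%N).1 x Xx.
have dDv : differentiable ('D_v T) x by have [_ H] := sT 2%N; exact: (H v).1.
have dg' : differentiable (loc_metric g c') (T x) by exact: (sg ac' 1%N).1.
have dgT : differentiable (loc_metric g c' \o T) x by exact: differentiable_comp.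
have dk : differentiable (fun z => kinetic g c z v) x.
  have d := (quad_derive v v w ((sg ac 1%N).1 _ cx)).1.
  by apply: differentiableM => //; exact: differentiable_cst.
have d' := quad_derive a a ('D_w T x) dg'.
have dk' : differentiable (fun z => kinetic g c' z a) (T x).
  by apply: differentiableM d'.1; exact: differentiable_cst.
have [_ Hq] := quad_moving w dDv dgT (loc_metric_tr c' (T x)).
have e1 : 'D_w (fun z => kinetic g c z v) x =
   'D_w (fun y => 2^-1 * ('D_v T y *m (loc_metric g c' \o T) y *m ('D_v T y)^T) 0 0) x :> R.
  apply: near_eq_derive.
  have nX : \forall y \near x, X y by exact: open_nbhs_nbhs.
  apply: filterS nX => y Xy; have /restrict_imgP[cy c'y] := Xy.
  rewrite /kinetic (loc_metric_change ac ac' cy c'y) -/T.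
  rewrite (deriveEjacobian v ((sT 1%N).1 y Xy)) /=.
  by move: ('J T y) (loc_metric _ _ _) => J S; rewrite trmx_mul !mulmxA.
have e2 : 'D_('D_w T x) (fun z => kinetic g c' z a) (T x) =
    2^-1 * (a *m 'D_('D_w T x) (loc_metric g c') (T x) *m a^T) 0 0 :> R.
  rewrite -d'.2; apply: etrans (deriveZ _ _) _ => //; exact: diff_derivable d'.1.
apply: etrans (grad_mul w dk) _; apply: etrans e1 _; apply: etrans Hq _.
congr (_ + _); apply: esym; apply: etrans (grad_mul _ dk') _; apply: etrans e2 _.
have ec := derive_compE w dT dg'.
exact: (congr1 (fun F : 'M[R]_n => 2^-1 * (a *m F *m a^T) 0 0) (esym ec)).
Qed.

Context (I : set R) (q : R -> Q).
Hypothesis TI : time_interval I.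
Hypothesis qC2 : C2_curve I q.

Definition euler_lagrange c t : 'rV[R]_n :=
  let x := cmap c \o q in let v := deriv_in I x in
  deriv_in I (fun s => grad (kinetic g c (x s)) (v s)) t
  - grad (fun y => kinetic g c y (v t)) (x t).

Lemma momentum_is c t : atlas c -> I t -> cdom c (q t) ->
  let x := cmap c \o q in let v := deriv_in I x in
  is_deriv_in I (fun s => v s *m loc_metric g c (x s)) t
    (deriv_in I (fun s => grad (kinetic g c (x s)) (v s)) t).
Proof.
move=> ac It ct x v; have [[dq _] dv] := qC2.
have Hx : is_deriv_in I x t (v t) by exact: diff_curve_is.
have Hv := derivable_in_is (dv c t ac It ct).1.
have dg := (sg ac 1%N).1 _ (cimg_map ct).
have Hp := is_deriv_in_mulmx Hv (is_deriv_in_comp Hx dg).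
have -> : (fun s => grad (kinetic g c (x s)) (v s)) = fun s => v s *m loc_metric g c (x s).
  by apply/funext => s; exact: (grad_quadratic (v s) (loc_metric_tr c (x s))).
by rewrite (deriv_inE TI It Hp).
Qed.

(** Both the derivative of the momentum and the gradient of the kinetic energy
    pick up a second derivative of the change of coordinates, namely D_v D_w T and
    D_w D_v T; they cancel by symmetry. Pairing with w avoids differentiating the
    matrix of the change of coordinates. *)
Lemma euler_lagrange_pair c c' t (w l l' : 'rV[R]_n) : atlas c -> atlas c' -> I t ->
  cdom c (q t) -> cdom c' (q t) ->
  let x := cmap c \o q in let v := deriv_in I x in
  let y := cmap c' \o q in let a := deriv_in I y in
  is_deriv_in I (fun s => v s *m loc_metric g c (x s)) t l ->
  is_deriv_in I (fun s => a s *m loc_metric g c' (y s)) t l' ->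
  ((l - grad (fun z => kinetic g c z (v t)) (x t)) *m w^T) 0 0 =
  ((l' - grad (fun z => kinetic g c' z (a t)) (y t)) *m
     (w *m 'J (trans c c') (cmap c (q t)))^T) 0 0 :> R.
Proof.
move=> ac ac' It ct c't x v y a Hp Hp'; have [[dq _] _] := qC2.
pose T := trans c c'; pose X := cmap c @` (cdom c `&` cdom c').
have oX : open X by exact/restrict_img_open/cdom_open.
have sT k : Ck k X T by exact: trans_Ck.
have Xx : X (x t) by exists (q t).
have Ty s : cdom c (q s) -> T (x s) = y s by move=> cs; rewrite /T /trans /x /y /= cmapK.
have nIdom : \forall s \near t, I s -> cdom c (q s) /\ cdom c' (q s).
  have n1 := cont_near (dq.1 t It) ct; have n2 := cont_near (dq.1 t It) c't.
  by apply: filterS2 n1 n2 => s H1 H2 Is; split; [exact: H1|exact: H2].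
have dT z (Xz : X z) : differentiable T z by exact: (sT 1%N).1.
have aE s : I s -> cdom c (q s) -> cdom c' (q s) -> a s = v s *m 'J T (x s).
  move=> Is cs c's; apply: deriv_inE => //; apply: is_deriv_trans => //.
    exact: dq.1.
  exact: diff_curve_is.
have Hx : is_deriv_in I x t (v t) by exact: diff_curve_is.
have pw : \forall s \near t, I s ->
    (a s *m loc_metric g c' (y s)) *m ('D_w T (x s))^T = (v s *m loc_metric g c (x s)) *m w^T.
  apply: filterS nIdom => s H Is; have [cs c's] := H Is.
  have Xs : X (x s) by exists (q s).
  rewrite (deriveEjacobian w (dT _ Xs)) (aE s Is cs c's).
  have c'x : cdom c' (cinv c (x s)) by rewrite /x /= cmapK.
  rewrite (loc_metric_change ac ac' (cimg_map cs) c'x) -/T (Ty s cs).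
  by move: ('J T _) (loc_metric _ _ _) (v s) => J S b; rewrite trmx_mul !mulmxA.
have dDw : differentiable ('D_w T) (x t) by have [_ H] := sT 2%N; exact: (H w).1.
have HD := is_deriv_in_lin (@linear_rV_continuous R n _ (@trmx R 1 n)) (is_deriv_in_comp Hx dDw).
have H1 := is_deriv_in_ext pw It (is_deriv_in_mulmx Hp' HD).
have H2 : is_deriv_in I (fun s => (v s *m loc_metric g c (x s)) *m w^T) t (l *m w^T).
  exact: (is_deriv_in_lin (@linear_rV_continuous R n _ (mulmxr w^T)) Hp).
have el := etrans (esym (deriv_inE TI It H2)) (deriv_inE TI It H1).
have cx : cimg c (x t) by exact: cimg_map.
have c'x : cdom c' (cinv c (x t)) by rewrite /x /= cmapK.
have := grad_kinetic_change (v t) w ac ac' cx c'x; cbv zeta; rewrite -/T.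
have -> : 'D_(v t) T (x t) = a t.
  by rewrite (deriveEjacobian (v t) (dT _ Xx)) -(aE t It ct c't).
rewrite (schwarz (v t) w oX (sT 2%N) Xx) (Ty t ct) => eg.
have eJ : w *m 'J T (x t) = 'D_w T (x t) by rewrite (deriveEjacobian w (dT _ Xx)).
rewrite -[cmap c (q t)]/(x t) -/T eJ.
exact: momentum_balance el eg.
Qed.

Lemma euler_lagrange_change c c' t (w : 'rV[R]_n) : atlas c -> atlas c' -> I t ->
  cdom c (q t) -> cdom c' (q t) ->
  (euler_lagrange c t *m w^T) 0 0 =
  (euler_lagrange c' t *m (w *m 'J (trans c c') (cmap c (q t)))^T) 0 0 :> R.
Proof.
move=> ac ac' It ct c't.
exact: (euler_lagrange_pair w ac ac' It ct c't (momentum_is ac It ct) (momentum_is ac' It c't)).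
Qed.

Lemma euler_lagrange_ann (G : Q -> 'M[R]_n) c c' t : atlas c -> atlas c' -> I t ->
  cdom c (q t) -> cdom c' (q t) ->
  (euler_lagrange c t <= kermx (loc_distribution G c (cmap c (q t)))^T)%MS ->
  (euler_lagrange c' t <= kermx (loc_distribution G c' (cmap c' (q t)))^T)%MS.
Proof.
move=> ac ac' It ct c't.
apply: (ann_change (J := 'J (trans c c') (cmap c (q t)))).
- by move=> w; exact: euler_lagrange_change.
- rewrite /loc_distribution !cmapK//.
  have -> : 'J (trans c c') (cmap c (q t)) = frame c (q t) *m invmx (frame c' (q t)).
    by rewrite (frame_change ac ac' ct c't) mulmxK// frame_unit.
  by rewrite mulmxA mulmxKV// frame_unit.
Qed.

End EulerLagrange.

(** * Constrained inertial motions with given initial velocity *)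

Section ConstrainedFlow.
Context (R : realType) (N M r : nat) (Q : manifold R (N + M)) (U : manifold R M).
Context (g : Q -> 'M[R]_(N + M)) (pi : Q -> U) (G : Q -> 'M[R]_(N + M)).
Hypothesis g_metric : riemannian_metric g.
Hypothesis pi_subm : submersion pi.
Hypothesis G_distr : smooth_distribution r G.
Hypothesis transv : forall q, row_full (kermx (tangent_map pi q) + G q)%MS.
Context (c : chart R (N + M) Q) (d : chart R M U).
Hypothesis cd : adapted pi c d.
Let ac : atlas c. Proof. by case: cd. Qed.
Local Notation n := (N + M)%N.
Local Notation gh := (loc_metric g c).
Local Notation Gh := (loc_distribution G c).
Local Notation zt := 'rV[R]_(n + r).

Section Field.
Context (W : set 'rV[R]_n) (E : 'rV[R]_n -> 'M[R]_(r, n)).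
Hypothesis oW : open W.
Hypothesis Wc : W `<=` cimg c.
Hypothesis sE : smooth_on W E.
Hypothesis HE : forall y, W y -> row_free (E y) /\ (E y :=: Gh y)%MS.

Definition pos (z : zt) : 'rV[R]_n := lsubmx z.
Definition vel (z : zt) : 'rV[R]_n := rsubmx z *m E (pos z).
Definition dom : set zt := pos @^-1` W.

Definition frame_momentum (x : 'rV[R]_n) : 'M[R]_(r, n) := E x *m gh x.

Definition frame_momentum_dot (z : zt) : 'M[R]_(r, n) :=
  \sum_i vel z 0 i *: 'D_(delta_mx 0 i) frame_momentum (pos z).

Definition kinetic_force (z : zt) : 'rV[R]_n :=
  2^-1 *: \row_i (vel z *m 'D_(delta_mx 0 i) gh (pos z) *m (vel z)^T) 0 0.

(** Solves (p' - dT/dq) E^T = 0 for the time derivative of the coefficients, where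
    p = a E g for the velocity a E; the Gram matrix of E is invertible. *)
Definition acc (z : zt) : 'rV[R]_r :=
  (kinetic_force z - rsubmx z *m frame_momentum_dot z) *m (E (pos z))^T
  *m invmx (frame_gram (gh (pos z)) (E (pos z))).

Definition field (z : zt) : zt := row_mx (vel z) (acc z).

Lemma dom_open : open dom.
Proof.
rewrite openE => z Wz; apply: (@linear_rV_continuous R _ _ (@lsubmx R 1 n r) z).
by apply: open_nbhs_nbhs.
Qed.

Lemma Ck_pos k (V : normedModType R) (f : 'rV[R]_n -> V) :
  Ck k W f -> Ck k dom (fun z => f (pos z)).
Proof.
apply: (Ck_comp dom_open) => //.
apply: (@Ck_lin _ _ _ _ _ _ (@lsubmx R 1 n r) (fun z => z) dom_open); last exact: Ck_id.
exact: linear_rV_continuous.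
Qed.

Lemma Ck_coef k : Ck k dom (fun z : zt => rsubmx z).
Proof.
apply: (@Ck_lin _ _ _ _ _ _ (@rsubmx R 1 n r) (fun z => z) dom_open); last exact: Ck_id.
exact: linear_rV_continuous.
Qed.

Lemma vel_smooth : smooth_on dom vel.
Proof. by move=> k; apply: (Ck_mulmx dom_open); [exact: Ck_coef|exact: Ck_pos]. Qed.

Lemma gh_smooth : smooth_on W gh.
Proof. by move=> k; apply: Ck_sub Wc _; exact: (loc_metric_smooth g_metric cd). Qed.

Lemma frame_momentum_smooth : smooth_on W frame_momentum.
Proof. by move=> k; apply: (Ck_mulmx oW); [exact: sE|exact: gh_smooth]. Qed.

Lemma acc_smooth : smooth_on dom acc.
Proof.
move=> k; have oD := dom_open.
have sgram : Ck k dom (fun z => frame_gram (gh (pos z)) (E (pos z))).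
  apply: (Ck_mulmx oD); last by apply: (Ck_tr oD); exact: Ck_pos.
  apply: (Ck_mulmx oD); first exact: Ck_pos.
  by apply: Ck_pos; exact: gh_smooth.
apply: (Ck_mulmx oD); last first.
  apply: (Ck_invmx oD _ sgram) => z Wz; apply: posdef_unit.
  apply: frame_gram_pd (HE Wz).1; apply: loc_posdef => //; exact: Wc.
apply: (Ck_mulmx oD); last by apply: (Ck_tr oD); exact: Ck_pos.
apply: (Ck_add oD).
  apply: (Ck_scale oD); first exact: Ck_cst.
  apply: (Ck_mx oD) => i j; under eq_fun do rewrite mxE.
  apply: (Ck_entry _ _ oD); apply: (Ck_mulmx oD); last by apply: (Ck_tr oD); exact: vel_smooth.
  apply: (Ck_mulmx oD); first exact: vel_smooth.
  by apply: (Ck_pos (f := 'D_(delta_mx 0 j) gh)); exact: (gh_smooth k.+1).2.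
apply: (Ck_opp oD); apply: (Ck_mulmx oD); first exact: Ck_coef.
apply: (Ck_sum oD) => i; apply: (Ck_scale oD).
  by apply: (Ck_entry _ _ oD); exact: vel_smooth.
apply: (Ck_pos (f := 'D_(delta_mx 0 i) frame_momentum)).
exact: (frame_momentum_smooth k.+1).2.
Qed.

Lemma field_smooth : smooth_on dom field.
Proof.
move=> k; have oD := dom_open.
pose PL : 'M[R]_(n, n + r) := row_mx 1%:M 0.
pose PR : 'M[R]_(r, n + r) := row_mx 0 1%:M.
apply: (@Ck_ext _ _ _ _ _ (fun z => vel z *m PL + acc z *m PR) _ oD).
  by move=> z _; rewrite /PL /PR !mul_mx_row !mulmx0 !mulmx1 add_row_mx addr0 add0r.
apply: (Ck_add oD); apply: (Ck_mulmx oD).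
- exact: vel_smooth.
- exact: Ck_cst.
- exact: acc_smooth.
- exact: Ck_cst.
Qed.

Lemma cinv_pos_into : smooth_into dom (cinv c \o pos).
Proof.
move=> c' ac'; have [oX sX] := @cinv_into R N M Q U pi c d cd c' ac'.
pose X := cimg c `&` cinv c @^-1` cdom c'.
have -> : dom `&` (cinv c \o pos) @^-1` cdom c' = dom `&` pos @^-1` X.
  apply/seteqP; split=> z [Wz Hz]; split=> //; first by split=> //; exact: Wc.
  by case: Hz.
have oD : open (dom `&` pos @^-1` X).
  apply: openI; first exact: dom_open.
  rewrite openE => z Xz; apply: (@linear_rV_continuous R _ _ (@lsubmx R 1 n r) z).
  by apply: open_nbhs_nbhs.
split=> // k; apply: (@Ck_comp _ _ _ _ _ _ X pos (cmap c' \o cinv c) oD).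
- by move=> z [].
- apply: (@Ck_lin _ _ _ _ _ _ (@lsubmx R 1 n r) (fun z => z) oD); last exact: Ck_id.
  exact: linear_rV_continuous.
- exact: sX.
Qed.

Section Solution.
Context (e : R) (z : R -> zt).
Hypothesis e_gt0 : 0 < e.
Hypothesis Hz : forall t : R, `|t| < e -> dom (z t) /\ is_derive t 1 z (field (z t)).
Local Notation I := [set t : R | `|t| < e].
Local Notation q := (cinv c \o (pos \o z)).

Let TI : time_interval I. Proof. exact: ball_interval. Qed.
Let zI t : I t -> is_deriv_in I z t (field (z t)).
Proof. by move=> It; exact: (flow_is Hz It). Qed.
Let Wz t : I t -> W (pos (z t)). Proof. by case/Hz. Qed.
Let cqt t : I t -> cdom c (q t).
Proof. by move=> It; apply: cinv_dom; exact/Wc/Wz. Qed.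
Let cq t : I t -> cmap c (q t) = pos (z t).
Proof. by move=> It; rewrite /= cinvK//; exact/Wc/Wz. Qed.

Lemma solution_C2 : C2_curve I q.
Proof. exact: (flow_C2_curve e_gt0 field_smooth Hz cinv_pos_into). Qed.

Lemma solution_pos t : I t -> is_deriv_in I (pos \o z) t (vel (z t)).
Proof.
move=> It; rewrite -[vel _](row_mxKl _ (acc (z t))).
exact: (is_deriv_in_lin (@linear_rV_continuous R _ _ (@lsubmx R 1 n r)) (zI It)).
Qed.

Lemma solution_coef t : I t -> is_deriv_in I (fun s => rsubmx (z s)) t (acc (z t)).
Proof.
move=> It; rewrite -[acc _](row_mxKr (vel (z t))).
exact: (is_deriv_in_lin (@linear_rV_continuous R _ _ (@rsubmx R 1 n r)) (zI It)).
Qed.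

Lemma solution_chart t : I t -> is_deriv_in I (cmap c \o q) t (vel (z t)).
Proof.
move=> It; apply: (is_deriv_in_ext _ It (solution_pos It)).
by apply: filterE => s Is; exact: esym (cq Is).
Qed.

Lemma solution_vel t : I t -> deriv_in I (cmap c \o q) t = vel (z t).
Proof. by move=> It; exact: deriv_inE TI It (solution_chart It). Qed.

Lemma solution_velocity t : I t -> velocity I q t = vel (z t) *m frame c (q t).
Proof.
move=> It; apply: velocity_chart => //; first exact: solution_C2.1.1.1.
  exact: cqt.
exact: solution_chart.
Qed.

Lemma solution_momentum t : I t ->
  is_deriv_in I (fun s => vel (z s) *m gh (pos (z s))) t
    (acc (z t) *m frame_momentum (pos (z t)) + rsubmx (z t) *m frame_momentum_dot (z t)).
Proof.
move=> It; have dE := (frame_momentum_smooth 1%N).1 _ (Wz It).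
have -> : frame_momentum_dot (z t) = 'D_(vel (z t)) frame_momentum (pos (z t)).
  exact: esym (derive_rV _ dE).
have H := is_deriv_in_mulmx (solution_coef It) (is_deriv_in_comp (solution_pos It) dE).
apply: is_deriv_in_ext It H; apply: filterE => s Is.
by rewrite /vel /frame_momentum /= mulmxA.
Qed.

Lemma solution_kinetic t : I t ->
  grad (fun y => kinetic g c y (vel (z t))) (pos (z t)) = kinetic_force (z t).
Proof.
move=> It; have dg := (gh_smooth 1%N).1 _ (Wz It); apply/rowP => i.
rewrite [LHS]mxE [RHS]mxE [X in _ = _ * X]mxE; set h := delta_mx 0 i.
have [df ef] := quad_derive (vel (z t)) (vel (z t)) h dg.
rewrite -ef; apply: etrans (deriveZ _ _) _ => //; exact: diff_derivable.
Qed.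

Lemma solution_euler_lagrange t : I t ->
  (euler_lagrange g I q c t <= kermx (Gh (cmap c (q t)))^T)%MS.
Proof.
move=> It; have Hp : is_deriv_in I
    (fun s => grad (kinetic g c ((cmap c \o q) s)) (deriv_in I (cmap c \o q) s)) t
    (acc (z t) *m frame_momentum (pos (z t)) + rsubmx (z t) *m frame_momentum_dot (z t)).
  apply: (is_deriv_in_ext _ It (solution_momentum It)); apply: filterE => s Is.
  rewrite (solution_vel Is); have -> : (cmap c \o q) s = pos (z s) by exact: cq.
  exact: esym (grad_kinetic_v g_metric _ _ _).
rewrite /euler_lagrange (deriv_inE TI It Hp) (solution_vel It).
have -> : (cmap c \o q) t = pos (z t) by exact: cq.
rewrite (solution_kinetic It) (cq It).
have [Ef EG] := HE (Wz It); have pg := loc_posdef g_metric ac (Wc (Wz It)).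
have gu := posdef_unit (frame_gram_pd pg Ef).
(* Annihilating the frame E is annihilating Gamma. *)
suff H : (acc (z t) *m frame_momentum (pos (z t)) +
    rsubmx (z t) *m frame_momentum_dot (z t) - kinetic_force (z t)) *m (E (pos (z t)))^T = 0.
  rewrite sub_kermx; have /submxP[Y ->] : (Gh (pos (z t)) <= E (pos (z t)))%MS by rewrite EG.
  by rewrite trmx_mul mulmxA H mul0mx.
rewrite -addrA mulmxDl.
have -> : acc (z t) *m frame_momentum (pos (z t)) *m (E (pos (z t)))^T =
    acc (z t) *m frame_gram (gh (pos (z t))) (E (pos (z t))).
  by rewrite /frame_gram /frame_momentum !mulmxA.
rewrite /acc mulmxKV// -mulmxDl.
by rewrite subrKA subrr mul0mx.
Qed.

Lemma solution_inertial : inertial_motion g G I q.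
Proof.
have [gs _ sg] := g_metric.
split; first exact: solution_C2.
  move=> t It; rewrite solution_velocity// -(loc_GE G cd (cqt It)) cq//.
  by have [_ <-] := HE (Wz It); exact: submxMl.
move=> c' t ac' It c't.
exact: (euler_lagrange_ann gs sg TI solution_C2 ac ac' It (cqt It) c't
  (solution_euler_lagrange It)).
Qed.

End Solution.
End Field.

(** Start a constrained motion at x0 with velocity h(b), whose momentum is the
    given horizontal covector. Invariance keeps y = p P*_I equal to 0, and the
    derivative of y at time 0 is theta[w, w]. *)
Lemma theta_of_invariance (x0 p0 : 'rV[R]_n) : cimg c x0 ->
  inertially_invariant g G
    [set qv | (qv.2 <= space_III (g qv.1) (tangent_map pi qv.1) (G qv.1))%MS] ->
  let w := p0 *m loc_Pstar_III g pi G c d x0 in theta_I g pi G c d x0 w w = 0.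
Proof.
move=> cx0 inv w.
have pg := loc_posdef g_metric ac cx0.
have fD := loc_tangent_full pi_subm cd cx0.
have tD := loc_transversal pi_subm transv cd cx0.
have [b eb] := Pstar_III_k pg fD tD p0.
have ew : w = b *m loc_h g pi G c d x0 *m gh x0 by rewrite /w -mulmxA; exact: eb.
have v3 : (b *m loc_h g pi G c d x0 <=
    space_III (gh x0) (loc_tangent_map pi c d x0) (Gh x0))%MS.
  exact: submx_trans (submxMl _ _) (h_sub _ _ _).
have [W [E [oW Wx Wc sE HE]]] := loc_frames G_distr cd cx0.
have : (b *m loc_h g pi G c d x0 <= E x0)%MS.
  by rewrite (HE x0 Wx).2; exact: space_III_sub v3.
case/submxP => a0 ea.
pose z0 : zt := row_mx x0 a0.
have oD := dom_open oW; have sF := field_smooth oW Wc sE HE.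
have Dz0 : dom W z0 by rewrite /dom /= /pos row_mxKl.
have [e [e0 [z [ez Hz]]]] := ode_exists oD (sF 1%N) Dz0.
have motion := solution_inertial oW Wc sE HE e0 Hz.
have TI := ball_interval e0.
set I := [set t : R | `|t| < e] in motion TI.
set q := (cinv c \o (@pos \o z)) in motion.
have I0 : I 0 by rewrite /I /= normr0.
have cqt t : I t -> cdom c (q t).
  by move=> /Hz[Wz _]; apply: cinv_dom; exact: Wc.
have v0 : vel E (z 0) = b *m loc_h g pi G c d x0.
  by rewrite ez /vel /pos /z0 row_mxKl row_mxKr.
have x0E : cmap c (q 0) = x0.
  by rewrite /q /= ez /pos row_mxKl cinvK.
have S0 : (velocity I q 0 <= space_III (g (q 0)) (tangent_map pi (q 0)) (G (q 0)))%MS.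
  rewrite (solution_velocity oW Wc sE HE e0 Hz I0) v0.
  by rewrite -(loc_IIIE g G pi_subm cd (cqt 0 I0)) x0E.
have HI t : I t -> (velocity I q t <= space_III (g (q t)) (tangent_map pi (q t)) (G (q t)))%MS.
  by move=> It; apply: (inv I q TI motion _ t It); exists 0.
have H1 := motion_deriv g_metric pi_subm G_distr transv cd TI motion I0 (cqt 0 I0).
have H2 : is_deriv_in I (fun=> 0 : 'rV[R]_n) 0
    (theta_I g pi G c d (cmap c (q 0)) (deriv_in I (cmap c \o q) 0 *m gh (cmap c (q 0)))
       (deriv_in I (cmap c \o q) 0 *m gh (cmap c (q 0)))).
  apply: (is_deriv_in_ext _ I0 H1); apply: filterE => s Is.
  apply/eqP; rewrite -(motion_III g_metric pi_subm cd TI motion Is (cqt s Is)).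
  exact: HI.
have := etrans (esym (deriv_inE TI I0 H2)) (deriv_inE TI I0 (is_deriv_in_cst I 0 0)).
by rewrite (solution_vel Wc e0 Hz I0) v0 x0E -ew.
Qed.

End ConstrainedFlow.

(** * Defect of a covector field in the sense of distributions *)

Section CompactSupport.
Context (R : realType).
Local Notation mu := (@lebesgue_measure R).
Implicit Types (I K : set R) (f : R -> R).

Lemma support_integral I K f : K `<=` I -> (forall t, ~ K t -> f t = 0) ->
  \int[mu]_(t in I) f t = \int[mu]_(t in K) f t.
Proof.
move=> KI f0; rewrite Rintegral_mkcond [RHS]Rintegral_mkcond.
congr (Rintegral _ _ _); apply/funext => t; rewrite /patch.
case: ifPn => It; case: ifPn => Kt //.
  by apply: f0 => Kt'; move/negP: Kt; apply; exact: mem_set.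
by exfalso; move/negP: It; apply; apply/mem_set/KI/set_mem.
Qed.

(** The integrals over I are integrals over the compact set K, on which continuous
    functions are integrable. *)
Lemma integral_linear I K (a : R) (f1 f2 : R -> R) : compact K -> K `<=` I ->
  (forall t, K t -> {for t, continuous f1}) -> (forall t, K t -> {for t, continuous f2}) ->
  (forall t, ~ K t -> f1 t = 0) -> (forall t, ~ K t -> f2 t = 0) ->
  \int[mu]_(t in I) (a * f1 t + f2 t) =
  a * (\int[mu]_(t in I) f1 t) + \int[mu]_(t in I) f2 t.
Proof.
move=> cK KI c1 c2 z1 z2.
have int (f : R -> R) : (forall t, K t -> {for t, continuous f}) ->
    mu.-integrable K (EFin \o f).
  move=> cf; apply: continuous_compact_integrable => //.
  by apply: continuous_in_subspaceT => t /set_mem; exact: cf.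
have mK : measurable K by exact: measurable_realfun.compact_measurable.
have z12 t : ~ K t -> a * f1 t + f2 t = 0 by move=> nK; rewrite z1// z2// mulr0 addr0.
rewrite (support_integral KI z12) (support_integral KI z1) (support_integral KI z2).
have ca t : K t -> {for t, continuous (fun s => a * f1 s)}.
  by move=> Kt; apply: (@cvgM _ _ (nbhs t)); [exact: cvg_cst|exact: c1].
rewrite RintegralD//; [|exact: int|exact: int].
by rewrite RintegralZl//; exact: int.
Qed.

Lemma cont_in_interior (T : topologicalType) I (f : R -> T) t : nbhs t I ->
  cont_in I f t -> {for t, continuous f}.
Proof. by move=> nI cf B /cf nB; apply: filterS2 nI nB => s Is; exact. Qed.

End CompactSupport.

Section WeakEquation.
Context (R : realType) (n : nat) (Q : manifold R n) (I : set R) (q : R -> Q)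
  (c : chart R n Q).
Local Notation mu := (@lebesgue_measure R).
Local Notation A := (I° `&` q @^-1` cdom c).
Context (p f : R -> 'rV[R]_n).
Hypothesis A_open : open A.
Hypothesis cp : forall t, A t -> {for t, continuous p}.
Hypothesis cf : forall t, A t -> {for t, continuous f}.

(** The distribution p' - f, on test fields. *)
Definition defect (phi : R -> 'rV[R]_n) : R :=
  - (\int[mu]_(t in I) (p t *m (derive1 phi t)^T) 0 0)
  - \int[mu]_(t in I) (f t *m (phi t)^T) 0 0.

Lemma test_field_is phi (t : R) : test_field I q c phi -> is_derive t 1 phi (derive1 phi t).
Proof. by case=> d _ _; rewrite derive1E; apply: derivableP; exact: d. Qed.

Lemma derive1_off (K : set R) (phi : R -> 'rV[R]_n) t : compact K ->
  (forall t, ~ K t -> phi t = 0) -> ~ K t -> is_derive t 1 phi 0.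
Proof.
move=> cK z nK; have oK : open (~` K).
  by apply: closed_openC; exact: compact_closed.
have H : \forall s \near t, phi s = 0.
  have : \forall s \near t, (~` K) s by exact: open_nbhs_nbhs.
  by apply: filterS => s; exact: z.
apply: (@is_deriv_in_derive _ _ setT); first exact: filterT.
apply: (is_deriv_in_ext _ _ (is_deriv_in_cst setT 0 t)) => //.
by apply: filterS H => s -> _.
Qed.

Lemma derive1_off0 (K : set R) (phi : R -> 'rV[R]_n) t : compact K ->
  (forall t, ~ K t -> phi t = 0) -> ~ K t -> derive1 phi t = 0.
Proof.
by move=> cK z nK; rewrite derive1E; have [_ ->] := derive1_off cK z nK.
Qed.

Lemma pairing_continuous (u v : R -> 'rV[R]_n) t : {for t, continuous u} ->
  {for t, continuous v} -> {for t, continuous (fun s => (u s *m (v s)^T) 0 0)}.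
Proof.
move=> cu cv; apply: (@cvg_coord _ _ (nbhs t)); apply: (@cvg_mulmx _ _ (nbhs t)) => //.
have cT : {for v t, continuous (@trmx R 1 n)} by exact: (@linear_rV_continuous R n _ (@trmx R 1 n)).
exact: continuous_comp cv cT.
Qed.

Lemma test_continuous phi : test_field I q c phi -> continuous phi.
Proof.
by move=> [d _ _] t; apply: differentiable_continuous; apply/derivable1_diffP; exact: d.
Qed.

Lemma derive1_lin (a : R) phi psi t : test_field I q c phi -> test_field I q c psi ->
  derive1 (fun s => a *: phi s + psi s) t = a *: derive1 phi t + derive1 psi t.
Proof.
move=> [d1 _ _] [d2 _ _]; rewrite !derive1E.
have dZ : derivable (fun s => a *: phi s) t 1 by exact: derivableZ.
apply: etrans (deriveD dZ (d2 t)) _.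
by congr (_ + _); exact: (deriveZ _ (d1 t)).
Qed.

Lemma compact_supportU phi psi : test_field I q c phi -> test_field I q c psi ->
  exists K : set R, [/\ compact K, K `<=` A, forall t, ~ K t -> phi t = 0
    & forall t, ~ K t -> psi t = 0].
Proof.
move=> [_ _ [K1 [cK1 KA1 z1]]] [_ _ [K2 [cK2 KA2 z2]]]; exists (K1 `|` K2); split.
- exact: compactU.
- by move=> t [/KA1|/KA2].
- by move=> t nK; apply: z1 => K1t; apply: nK; left.
- by move=> t nK; apply: z2 => K1t; apply: nK; right.
Qed.

Lemma test_field_lin (a : R) phi psi : test_field I q c phi -> test_field I q c psi ->
  test_field I q c (fun t => a *: phi t + psi t).
Proof.
move=> H1 H2; have [K [cK KA z1 z2]] := compact_supportU H1 H2; split.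
- by move=> t; have [d1 _ _] := H1; have [d2 _ _] := H2;
    apply: derivableD => //; exact: derivableZ.
- have -> : derive1 (fun t => a *: phi t + psi t) = fun t => a *: derive1 phi t + derive1 psi t.
    by apply/funext => t; exact: derive1_lin.
  have [_ c1 _] := H1; have [_ c2 _] := H2.
  move=> t; apply: (@cvgD _ _ _ (nbhs t)); last exact: c2.
  by apply: (@cvgZ _ _ _ (nbhs t)); [exact: cvg_cst|exact: c1].
- by exists K; split=> // t nK; rewrite z1// z2// scaler0 addr0.
Qed.

Lemma defect_linear : linear_on_tests I q c defect.
Proof.
move=> a phi psi H1 H2; have [K [cK KA z1 z2]] := compact_supportU H1 H2.
have KI : K `<=` I by move=> t /KA[/interior_subset].
have [_ c1 _] := H1; have [_ c2 _] := H2.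
have lin (u : R -> 'rV[R]_n) (v1 v2 : R -> 'rV[R]_n) :
    (forall t, A t -> {for t, continuous u}) -> continuous v1 -> continuous v2 ->
    (forall t, ~ K t -> v1 t = 0) -> (forall t, ~ K t -> v2 t = 0) ->
    \int[mu]_(t in I) (u t *m (a *: v1 t + v2 t)^T) 0 0 =
    a * (\int[mu]_(t in I) (u t *m (v1 t)^T) 0 0) + \int[mu]_(t in I) (u t *m (v2 t)^T) 0 0.
  move=> cu cv1 cv2 zv1 zv2.
  rewrite -(integral_linear a cK KI).
  - apply: eq_Rintegral => t _; rewrite linearD linearZ /= mulmxDr -scalemxAr.
    by move: (u t *m _) (u t *m _) => B C; rewrite !mxE.
  - by move=> t /KA At; apply: pairing_continuous; [exact: cu|exact: cv1].
  - by move=> t /KA At; apply: pairing_continuous; [exact: cu|exact: cv2].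
  - by move=> t nK; rewrite zv1// trmx0 mulmx0 mxE.
  - by move=> t nK; rewrite zv2// trmx0 mulmx0 mxE.
rewrite /defect.
have -> : derive1 (fun s => a *: phi s + psi s) = fun t => a *: derive1 phi t + derive1 psi t.
  by apply/funext => t; exact: derive1_lin.
have e1 := lin p (derive1 phi) (derive1 psi) cp c1 c2
  (fun t => derive1_off0 cK z1) (fun t => derive1_off0 cK z2).
have e2 := lin f phi psi cf (test_continuous H1) (test_continuous H2) z1 z2.
rewrite e1 e2.
have alg (x y u v : R) : - (a * x + y) - (a * u + v) = a * (- x - u) + (- y - v) by ring.
exact: alg.
Qed.

Lemma defect0 phi : test_field I q c phi ->
  (forall t, A t -> (p t *m (derive1 phi t)^T) 0 0 = - (f t *m (phi t)^T) 0 0) ->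
  defect phi = 0.
Proof.
move=> H E; have [_ c1 [K [cK KA z]]] := H.
have KI : K `<=` I by move=> t /KA[/interior_subset].
have zf t : ~ K t -> (f t *m (phi t)^T) 0 0 = 0.
  by move=> nK; rewrite z// trmx0 mulmx0 mxE.
have z0 (t : R) : ~ K t -> (0 : R) = 0 by [].
have cc t : K t -> {for t, continuous (fun s => (f s *m (phi s)^T) 0 0)}.
  by move=> /KA At; apply: pairing_continuous; [exact: cf|exact: test_continuous].
have c0 t : K t -> {for t, continuous (fun _ : R => 0 : R)} by move=> _; exact: cvg_cst.
have := integral_linear (-1) cK KI cc c0 zf z0.
have -> : \int[mu]_(t in I) (0 : R) = 0.
  by rewrite (support_integral KI z0) /Rintegral integral0.
rewrite addr0 /defect => e.
suff -> : \int[mu]_(t in I) (p t *m (derive1 phi t)^T) 0 0 =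
    \int[mu]_(t in I) (-1 * (f t *m (phi t)^T) 0 0 + 0).
  by rewrite e mulN1r opprK subrr.
apply: eq_Rintegral => t _; rewrite addr0 mulN1r.
have [Kt|nK] := pselect (K t); first by apply: E; exact: KA.
by rewrite (derive1_off0 cK z nK) zf// trmx0 mulmx0 mxE oppr0.
Qed.

Lemma defect_cst0 phi : test_field I q c phi -> defect (fun=> 0) = 0.
Proof.
move=> H; have := defect_linear (-1) H H.
have -> : (fun t => -1 *: phi t + phi t) = fun=> 0.
  by apply/funext => t; rewrite scaleN1r addNr.
by move=> ->; rewrite mulN1r addNr.
Qed.

Section Multiplier.
Context (S dS : R -> 'M[R]_n).
Hypothesis HS : forall t, A t -> is_derive t 1 S (dS t).
Hypothesis cS : forall t, A t -> {for t, continuous dS}.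

Lemma multiplier_is phi t : test_field I q c phi -> A t ->
  is_derive t 1 (fun s => phi s *m S s) (derive1 phi t *m S t + phi t *m dS t).
Proof.
move=> H At; apply: (@is_deriv_in_derive _ _ setT); first exact: filterT.
by apply: is_deriv_in_mulmx; apply: is_derive_in; [exact: test_field_is|exact: HS].
Qed.

(** Outside the support everything vanishes on an open set; on the open set A the
    product rule applies. *)
Lemma test_field_mul phi : test_field I q c phi ->
  test_field I q c (fun t => phi t *m S t).
Proof.
move=> H; have [_ c1 [K [cK KA z]]] := H.
have zS t : ~ K t -> phi t *m S t = 0 by move=> nK; rewrite z// mul0mx.
have KC t : A t \/ ~ K t.
  by have [/KA|] := pselect (K t); [left|right].
split; last by exists K.
- move=> t; have [At|nK] := KC t; first by have [] := multiplier_is H At.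
  by have [] := derive1_off cK zS nK.
- move=> t; have [At|nK] := KC t; last first.
    have oK : open (~` K) by apply: closed_openC; exact: compact_closed.
    have ne : \forall s \near t, 0 = derive1 (fun t => phi t *m S t) s.
      have : \forall s \near t, (~` K) s by exact: open_nbhs_nbhs.
      by apply: filterS => s nKs; rewrite (derive1_off0 cK zS nKs).
    rewrite /continuous_at (derive1_off0 cK zS nK).
    by apply: cvg_trans (near_eq_cvg ne) _; exact: cvg_cst.
  have ne : \forall s \near t,
      derive1 phi s *m S s + phi s *m dS s = derive1 (fun t => phi t *m S t) s.
    have : \forall s \near t, A s by exact: open_nbhs_nbhs.
    apply: filterS => s As; rewrite [RHS]derive1E.
    by have [_ ->] := multiplier_is H As.
  rewrite /continuous_at -(nbhs_singleton ne).
  apply: cvg_trans (near_eq_cvg ne) _.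
  have cSt : S s @[s --> t] --> S t.
    apply: differentiable_continuous; apply/derivable1_diffP.
    by have [] := HS At.
  apply: (@cvgD _ _ _ (nbhs t)); apply: (@cvg_mulmx _ _ (nbhs t)).
  - exact: c1.
  - exact: cSt.
  - exact: test_continuous.
  - exact: cS.
Qed.

End Multiplier.
End WeakEquation.

(** * Solutions of the control equation and the Hamiltonian system *)

Lemma near_continuous_at (R : realType) (W : topologicalType) (f g : R -> W) (t : R) :
  (\forall s \near t, f s = g s) -> {for t, continuous f} -> {for t, continuous g}.
Proof.
move=> ne cf; have e : g t = f t := esym (nbhs_singleton ne).
change (g @ t --> g t); rewrite e.
exact: cvg_trans (near_eq_cvg ne) cf.
Qed.

(** Differentiating P psi^T = psi^T gives (D_v P) psi^T + P dpsi^T = dpsi^T. Paired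
    with p, which P kills, the term in dpsi drops out and theta = 0 identifies
    the rest. *)
Lemma reaction_work (R : realType) (n : nat) (P gh : 'rV[R]_n -> 'M[R]_n)
    (x p v psi dpsi : 'rV[R]_n) :
  theta P (fun y => invmx (gh y)) x p p = 0 ->
  'D_v P x *m psi^T + P x *m dpsi^T = dpsi^T ->
  P x *m psi^T = psi^T -> p *m P x = 0 -> p *m invmx (gh x) = v ->
  (p *m dpsi^T) 0 0 = (dH gh x p *m psi^T) 0 0.
Proof.
move=> th e eP pP ev.
move: th e; rewrite /theta /dH; cbv beta; rewrite ev.
move: ('D_v P x) (grad _ _) => A b th e.
have {}th : p *m A = 2^-1 *: b *m P x by apply/eqP; rewrite -subr_eq0 -scalemxAl th.
by rewrite -e mulmxDr !mulmxA th pP mul0mx addr0 -mulmxA eP.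
Qed.

Section ControlSolution.
Context (R : realType) (N M r : nat) (Q : manifold R (N + M)) (U : manifold R M).
Context (g : Q -> 'M[R]_(N + M)) (pi : Q -> U) (G : Q -> 'M[R]_(N + M)).
Hypothesis g_metric : riemannian_metric g.
Hypothesis pi_subm : submersion pi.
Hypothesis G_distr : smooth_distribution r G.
Hypothesis transv : forall q, row_full (kermx (tangent_map pi q) + G q)%MS.
Context (I : set R) (u : R -> U) (q : R -> Q).
Hypothesis TI : time_interval I.
Hypothesis uC1 : C1_curve I u.
Hypothesis sol : control_solution g pi G I u q.
Local Notation p := (fun t => velocity I u t
  *m k_map (g (q t)) (tangent_map pi (q t)) (G (q t))).
Local Notation F0 := (fun (_ : R) (q : Q) (_ : 'rV[R]_(N + M)) => 0 : 'rV[R]_(N + M)).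

Section Adapted.
Context (c : chart R (N + M) Q) (d : chart R M U).
Hypothesis cd : adapted pi c d.
Let ac : atlas c. Proof. by case: cd. Qed.
Let ad : atlas d. Proof. by case: cd. Qed.
Local Notation gh := (loc_metric g c).
Local Notation Dh := (loc_tangent_map pi c d).
Local Notation Gh := (loc_distribution G c).
Local Notation Ph := (loc_Pstar_I g pi G c d).
Local Notation hh := (loc_h g pi G c d).
Local Notation kh := (loc_k g pi G c d).
Local Notation x := (cmap c \o q).
Local Notation w := (deriv_in I (cmap d \o u)).
Hypothesis theta0 : forall x0, cimg c x0 -> forall p0 : 'rV[R]_(N + M),
  let v := p0 *m loc_Pstar_III g pi G c d x0 in theta_I g pi G c d x0 v v = 0.

Lemma control_dom t : I t -> cdom c (q t) -> cdom d (u t).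
Proof.
move=> It ct; have [_ _ H] := cd; have [_ H2] := sol.
by rewrite -(H2 t It).1; exact: (H _ ct).1.
Qed.

Lemma control_velocity t : I t -> cdom c (q t) ->
  velocity I u t = w t *m frame d (u t).
Proof.
by move=> It ct; apply: velocity_deriv => //; [exact: uC1.1|exact: control_dom].
Qed.

Lemma solution_pc t : I t -> cdom c (q t) -> pc q p c t = w t *m kh (x t).
Proof.
move=> It ct; rewrite /pc /covec control_velocity// [x t]/=.
rewrite (loc_kE g_metric pi_subm transv cd ct) -(sol.2 t It).1.
by rewrite !mulmxA.
Qed.

Lemma solution_dx t : I t -> cdom c (q t) -> deriv_in I x t = w t *m hh (x t).
Proof.
move=> It ct; have [dq H] := sol; have [eu ev] := H t It.
rewrite [x t]/= (loc_hE g_metric pi_subm transv cd ct) [RHS]mulmxA [w t *m _]mulmxA eu.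
rewrite -(control_velocity It ct) -ev (velocity_deriv TI dq ac It ct).
by rewrite mulmxK// frame_unit.
Qed.

Lemma solution_x t : I t -> cdom c (q t) -> is_deriv_in I x t (w t *m hh (x t)).
Proof.
by move=> It ct; rewrite -solution_dx//; apply: diff_curve_is => //; exact: sol.1.
Qed.

Lemma solution_w_cont t : I t -> cdom c (q t) -> cont_in I w t.
Proof. by move=> It ct; apply: uC1.2 => //; exact: control_dom. Qed.

Lemma solution_x_comp_cont (W : normedModType R) k (Y : 'rV[R]_(N + M) -> W) t :
  I t -> cdom c (q t) -> Ck k (cimg c) Y -> cont_in I (fun s => Y (x s)) t.
Proof.
move=> It ct cY; have cx := is_deriv_in_cont (solution_x It ct).
have cYt : {for x t, continuous Y} by apply: (Ck_le (leq0n k) cY); exact: cimg_map.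
by apply: (@cvg_trans _ (Y @ nbhs (x t))); [exact: cvg_app cx|exact: cYt].
Qed.

Lemma solution_pc_cont t : I t -> cdom c (q t) -> cont_in I (pc q p c) t.
Proof.
move=> It ct; have ndom := cont_near (sol.1.1 t It) ct.
have ck := solution_x_comp_cont It ct
  (loc_k_smooth g_metric pi_subm G_distr transv cd 0%N).
have cw := solution_w_cont It ct.
have H : cont_in I (fun s => w s *m kh (x s)) t by exact: cvg_mulmx.
rewrite /cont_in solution_pc//; apply: cvg_trans H; apply: near_eq_cvg.
rewrite near_withinE; apply: filterS ndom => s cs Is.
by rewrite solution_pc//; exact: cs.
Qed.

Lemma solution_pc_Pstar t : I t -> cdom c (q t) -> pc q p c t *m Ph (x t) = 0.
Proof.
move=> It ct; rewrite solution_pc// -mulmxA.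
by rewrite (loc_k_Pstar_I G g_metric cd (cimg_map ct)) mulmx0.
Qed.

Lemma solution_pc_ginv t : I t -> cdom c (q t) ->
  pc q p c t *m invmx (gh (x t)) = w t *m hh (x t).
Proof.
move=> It ct; rewrite solution_pc// -mulmxA.
by rewrite (loc_k_ginv G g_metric cd (cimg_map ct)).
Qed.

(** The momentum k(w) is fixed by P*_III. *)
Lemma solution_theta t : I t -> cdom c (q t) ->
  theta_I g pi G c d (x t) (pc q p c t) (pc q p c t) = 0.
Proof.
move=> It ct; have := theta0 (cimg_map ct) (pc q p c t); cbv zeta.
suff -> : pc q p c t *m loc_Pstar_III g pi G c d (cmap c (q t)) = pc q p c t by [].
rewrite solution_pc// -mulmxA; congr (_ *m _); apply: k_Pstar_III.
exact/loc_posdef/cimg_map.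
Qed.

Lemma solution_drift t : cdom c (q t) ->
  drift g F0 q p c t = - dH gh (x t) (pc q p c t).
Proof.
move=> ct; rewrite /drift /covec mul0mx addr0; congr (- _).
exact: (grad_hamiltonian g_metric cd _ (cimg_map ct)).
Qed.

Lemma solution_pointwise t : I t -> cdom c (q t) -> derivable_in I (pc q p c) t ->
  momentum_equation g pi G F0 I q p c d t.
Proof.
move=> It ct /derivable_in_is Hp; have cx := cimg_map ct.
set l := deriv_in I (pc q p c) t in Hp *.
have Hx : is_deriv_in I x t (pc q p c t *m invmx (gh (x t))).
  by rewrite solution_pc_ginv//; exact: solution_x.
have ndom := cont_near (sol.1.1 t It) ct.
have n0 : \forall s \near t, I s -> pc q p c s *m Ph (x s) = 0.
  by apply: filterS ndom => s cs Is; apply: solution_pc_Pstar => //; exact: cs.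
have := horizontal_momentum g_metric pi_subm G_distr transv cd TI It cx Hx Hp n0.
rewrite solution_theta// add0r => e.
exists (l - drift g F0 q p c t); split; last by rewrite addrC subrK.
apply/(loc_ann g_metric pi_subm transv cd _ cx).
by rewrite solution_drift// opprK.
Qed.

Local Notation S := (fun t => Dh (x t) *m hh (x t)).
Local Notation A := (I° `&` q @^-1` cdom c).

Lemma interior_dom_open : open A.
Proof.
rewrite openE => t [It ct]; rewrite /interior.
have It' := interior_subset It.
have nq := cont_in_interior It (sol.1.1 t It') (near_cdom ct).
have nI : \forall s \near t, (I°) s by apply: open_nbhs_nbhs; split=> //; exact: open_interior.
by apply: filterS2 nI nq => s.
Qed.

Lemma interior_comp (W : normedModType R) (Y : 'rV[R]_(N + M) -> W) t : A t ->
  smooth_on (cimg c) Y ->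
  is_derive t 1 (fun s => Y (x s)) ('D_(w t *m hh (x t)) Y (x t)).
Proof.
move=> [It ct] sY; have It' := interior_subset It; apply: is_deriv_in_derive It _.
apply: is_deriv_in_comp; first exact: solution_x.
by apply: (sY 1%N).1; exact: cimg_map.
Qed.

Lemma interior_v_cont t : A t -> {for t, continuous (fun s => w s *m hh (x s))}.
Proof.
move=> [It ct]; have It' := interior_subset It.
apply: (cont_in_interior It); apply: cvg_mulmx; first exact: solution_w_cont.
exact: (solution_x_comp_cont It' ct (loc_h_smooth g_metric pi_subm G_distr transv cd 0%N)).
Qed.

Lemma interior_comp_cont k (W : normedModType R) (Y : 'rV[R]_(N + M) -> W) t : A t ->
  Ck k (cimg c) Y -> {for t, continuous (fun s => Y (x s))}.
Proof.
move=> [It ct] cY; apply: (cont_in_interior It).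
by apply: solution_x_comp_cont cY => //; exact: interior_subset.
Qed.

Lemma interior_pc_cont t : A t -> {for t, continuous (pc q p c)}.
Proof.
move=> [It ct]; apply: (cont_in_interior It).
by apply: solution_pc_cont => //; exact: interior_subset.
Qed.

Lemma interior_drift_cont t : A t -> {for t, continuous (drift g F0 q p c)}.
Proof.
move=> At; have sg := loc_ginv_smooth g_metric cd.
pose f s := - (2^-1 *: \row_i (pc q p c s *m 'D_(delta_mx 0 i) (fun y => invmx (gh y)) (x s)
   *m (pc q p c s)^T) 0 0).
have ne : \forall s \near t, f s = drift g F0 q p c s.
  have nA : \forall s \near t, A s by apply: open_nbhs_nbhs; split=> //; exact: interior_dom_open.
  apply: filterS nA => s [Is cs]; rewrite solution_drift// /dH.
  by rewrite (theta_gradE sg _ _ (cimg_map cs)).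
apply: (near_continuous_at ne); rewrite /f.
have cp := interior_pc_cont At.
apply: (@cvgN _ _ _ (nbhs t)); apply: (@cvgZ _ _ _ (nbhs t)); first exact: cvg_cst.
apply: (@cvg_mxP _ _ (nbhs t)) => i j.
have -> : (fun s => (\row_i (pc q p c s *m 'D_(delta_mx 0 i) (fun y => invmx (gh y)) (x s)
   *m (pc q p c s)^T) 0 0) i j) = fun s => (pc q p c s *m
   'D_(delta_mx 0 j) (fun y => invmx (gh y)) (x s) *m (pc q p c s)^T) 0 0.
  by apply/funext => s; rewrite mxE.
rewrite [X in _ --> X]mxE.
have cT : {for pc q p c t, continuous (@trmx R 1 (N + M))}.
  exact: (@linear_rV_continuous R _ _ (@trmx R 1 (N + M))).
have cpT := continuous_comp cp cT.
have cD := @interior_comp_cont 0 _ ('D_(delta_mx 0 j) (fun y => invmx (gh y))) t At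
  ((sg 1%N).2 (delta_mx 0 j)).
apply: (@cvg_coord _ _ (nbhs t)); apply: (@cvg_mulmx _ _ (nbhs t)); last exact: cpT.
by apply: (@cvg_mulmx _ _ (nbhs t)); [exact: cp|exact: cD].
Qed.

Lemma projector_smooth : smooth_on (cimg c) (fun y => Dh y *m hh y).
Proof.
move=> k; apply: (Ck_mulmx (@cimg_open_set _ _ _ c)).
  exact: (loc_tangent_smooth cd).
exact: (loc_h_smooth g_metric pi_subm G_distr transv cd).
Qed.

Local Notation dS := (fun t => 'D_(w t *m hh (x t)) (fun y => Dh y *m hh y) (x t)).

Lemma interior_dS_cont t : A t -> {for t, continuous dS}.
Proof.
move=> At; have sP := projector_smooth.
pose f s := \sum_i (w s *m hh (x s)) 0 i *: 'D_(delta_mx 0 i) (fun y => Dh y *m hh y) (x s).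
have ne : \forall s \near t, f s = dS s.
  have nA : \forall s \near t, A s by apply: open_nbhs_nbhs; split=> //; exact: interior_dom_open.
  apply: filterS nA => s [Is cs]; apply: esym; apply: derive_rV.
  by apply: (sP 1%N).1; exact: cimg_map.
apply: (near_continuous_at ne); rewrite /f.
apply: (@cvg_sum_fun _ _ (nbhs t)) => i; apply: (@cvgZ _ _ _ (nbhs t)).
  by apply: (@cvg_coord _ _ (nbhs t)); exact: interior_v_cont.
have cD := @interior_comp_cont 0 _ ('D_(delta_mx 0 i) (fun y => Dh y *m hh y)) t At
  ((sP 1%N).2 (delta_mx 0 i)).
exact: cD.
Qed.

Local Notation L := (defect I (pc q p c) (drift g F0 q p c)).

(** The weak form of the statement that the reaction annihilates
    Delta :&: Gamma. The derivative falls on psi, so continuity of p suffices. *)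
Lemma defect_I_zero psi : test_field I q c psi ->
  (forall t, I t -> cdom c (q t) -> (psi t <= space_I (Dh (x t)) (Gh (x t)))%MS) ->
  L psi = 0.
Proof.
move=> Hpsi HI; apply: (defect0 interior_drift_cont Hpsi) => t At.
have [It ct] := At; have It' := interior_subset It; have cx := cimg_map ct.
rewrite solution_drift// mulNmx [X in _ = - X]mxE opprK.
have sP := loc_Pstar_I_smooth g_metric pi_subm G_distr transv cd.
have psiP s : I s -> cdom c (q s) -> Ph (x s) *m (psi s)^T = (psi s)^T.
  move=> Is cs; have pgs := loc_posdef g_metric ac (cimg_map cs).
  rewrite /loc_Pstar_I Pstar_IE// -trmx_mul; congr trmx.
  by apply: orth_proj_id => //; exact: HI.
have HT := is_deriv_in_lin (@linear_rV_continuous R _ _ (@trmx R 1 (N + M)))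
  (is_derive_in I (test_field_is t Hpsi)).
have H2 := is_deriv_in_mulmx (is_derive_in I (interior_comp At sP)) HT.
have ndom := cont_near (sol.1.1 t It') ct.
have nP : \forall s \near t, I s -> Ph (x s) *m (psi s)^T = (psi s)^T.
  by apply: filterS ndom => s cs Is; apply: psiP => //; exact: cs.
have H3 := is_deriv_in_ext nP It' H2.
have e := etrans (esym (deriv_inE TI It' H3)) (deriv_inE TI It' HT).
have th := solution_theta It' ct.
exact: (reaction_work th e (psiP t It' ct) (solution_pc_Pstar It' ct)
  (solution_pc_ginv It' ct)).
Qed.

(** The reaction is split by the projection S along Delta: rD acts on test fields
    through phi S, which vanishes on Delta, and rG through phi - phi S, which lies
    in Delta :&: Gamma when phi lies in Gamma. *)
Lemma solution_weak : weak_momentum_equation g pi G F0 I q p c d.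
Proof.
have cp := interior_pc_cont; have cf := interior_drift_cont.
have lin := defect_linear cp cf.
have mul := test_field_mul interior_dom_open
  (fun t At => interior_comp At projector_smooth) interior_dS_cont.
have lin2 a phi psi : test_field I q c phi -> test_field I q c psi ->
    L (fun t => (a *: phi t + psi t) *m S t) =
    a * L (fun t => phi t *m S t) + L (fun t => psi t *m S t).
  move=> H1 H2; rewrite -(lin a _ _ (mul _ H1) (mul _ H2)); congr (defect _ _ _ _).
  by apply/funext => t; rewrite mulmxDl -scalemxAl.
exists (fun phi => L (fun t => phi t *m S t)).
exists (fun phi => L phi - L (fun t => phi t *m S t)); split.
- split; first by move=> a phi psi H1 H2; exact: lin2.
  move=> a phi psi H1 H2; rewrite (lin a phi psi H1 H2) (lin2 a phi psi H1 H2).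
  have alg (b y b' y' : R) : a * b + y - (a * b' + y') = a * (b - b') + (y - y') by ring.
  exact: alg.
- move=> phi H HD; have -> : (fun t => phi t *m S t) = fun=> 0.
    apply/funext => t; have [_ _ [K [_ KA z]]] := H.
    have [/KA[It ct]|nK] := pselect (K t); last by rewrite z// mul0mx.
    have := HD t (interior_subset It) ct; rewrite /Delta_loc sub_kermx => /eqP e.
    by rewrite mulmxA e mul0mx.
  exact: (defect_cst0 cp cf H).
- move=> phi H HG.
  have e : L (fun t => phi t - phi t *m S t) = L phi - L (fun t => phi t *m S t).
    have := lin (-1) _ _ (mul _ H) H.
    have -> : (fun t => -1 *: (phi t *m S t) + phi t) = fun t => phi t - phi t *m S t.
      by apply/funext => t; rewrite scaleN1r addrC.
    by move=> ->; rewrite mulN1r addrC.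
  rewrite -e; apply: defect_I_zero.
    have := test_field_lin (-1) (mul _ H) H.
    have -> // : (fun t => -1 *: (phi t *m S t) + phi t) = fun t => phi t - phi t *m S t.
    by apply/funext => t; rewrite scaleN1r addrC.
  move=> t It ct; rewrite mulmxA; have cx := cimg_map ct.
  apply: sub_Dh_I; last exact: HG.
  - exact: loc_posdef.
  - exact: (loc_tangent_full pi_subm cd).
  - exact: (loc_transversal pi_subm transv cd).
- move=> phi H; rewrite /defect.
  have alg (a b y : R) : - a = b + y + (- a - b - y) by ring.
  exact: alg.
Qed.

Lemma solution_chart_equations :
  (forall t, I t -> cdom c (q t) ->
      [/\ cont_in I (pc q p c) t,
          deriv_in I (cmap c \o q) t
          = grad (hamiltonian g c (cmap c (q t))) (pc q p c t),
          pi (q t) = u t,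
          (pc q p c t <= loc_distribution G c (cmap c (q t))
                     *m loc_metric g c (cmap c (q t)))%MS
        & derivable_in I (pc q p c) t -> momentum_equation g pi G F0 I q p c d t]) /\
    weak_momentum_equation g pi G F0 I q p c d.
Proof.
split; last exact: solution_weak.
move=> t It ct; split.
- exact: solution_pc_cont.
- rewrite solution_dx// -solution_pc_ginv//; apply: esym.
  apply: (grad_quadratic (pc q p c t)).
  by rewrite trmx_inv (loc_metric_sym g_metric).
- exact: (sol.2 t It).1.
- rewrite solution_pc// /loc_k /k_map mulmxA; apply: submxMr.
  exact: h_sub_G.
- exact: solution_pointwise.
Qed.

End Adapted.
Lemma solution_hamiltonian :
  (forall c d, adapted pi c d ->
     forall x, cimg c x -> forall p : 'rV[R]_(N + M),
       let v := p *m loc_Pstar_III g pi G c d x in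
       theta_I g pi G c d x v v = 0) ->
  ham_solution g pi G F0 I u q p.
Proof.
move=> H; split; first exact: sol.1.
by move=> c d cd; apply: solution_chart_equations => //; exact: H.
Qed.

Lemma solution_horizontal t : I t ->
  p t *m Pstar_I (g (q t)) (tangent_map pi (q t)) (G (q t)) = 0 /\
  velocity I q t *m P_I (g (q t)) (tangent_map pi (q t)) (G (q t)) = 0.
Proof.
move=> It; have pg := metric_posdef g_metric (q t).
split; first by rewrite -mulmxA (k_Pstar_I _ _ pg) mulmx0.
by rewrite (sol.2 t It).2 -mulmxA (h_P_I _ _ pg) mulmx0.
Qed.

End ControlSolution.

(** * Equivalence of the four conditions *)

Theorem theorem6p1 (R : realType) (N M nu : nat)
    (N_gt0 : (0 < N)%N) (M_gt0 : (0 < M)%N) (nu_gt0 : (0 < nu)%N)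
    (Q : manifold R (N + M)) (U : manifold R M)
    (g : Q -> 'M[R]_(N + M)) (pi : Q -> U) (G : Q -> 'M[R]_(N + M))
    (r : nat) (r_nu : (r + nu = N + M)%N)
    (g_metric : riemannian_metric g)
    (pi_subm : submersion pi)
    (G_distr : smooth_distribution r G)
    (transv : forall q, row_full (kermx (tangent_map pi q) + G q)%MS) :
  [<->
    (forall (I : set R) (u : R -> U) (q : R -> Q),
       time_interval I -> C1_curve I u -> control_solution g pi G I u q ->
       let p t := velocity I u t
                  *m k_map (g (q t)) (tangent_map pi (q t)) (G (q t)) in
       ham_solution g pi G (fun _ _ _ => 0) I u q p /\
       (forall t, I t ->
          p t *m Pstar_I (g (q t)) (tangent_map pi (q t)) (G (q t)) = 0 /\
          velocity I q t *m P_I (g (q t)) (tangent_map pi (q t)) (G (q t))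
          = 0));
    (forall c d, adapted pi c d ->
       forall x, cimg c x -> forall w, Psi g pi G c d x w = 0);
    (forall c d, adapted pi c d ->
       forall x, cimg c x -> forall p : 'rV[R]_(N + M),
         let v := p *m loc_Pstar_III g pi G c d x in
         theta_I g pi G c d x v v = 0);
    inertially_invariant g G
      [set qv | (qv.2 <= space_III (g qv.1) (tangent_map pi qv.1) (G qv.1))%MS]
  ].
Proof.
tfae.
- move=> H c d cd x cx w.
  apply: (Psi_of_hamiltonian g_metric pi_subm G_distr transv cd w cx).
  by move=> I u q TI uC1 sol; exact: (H I u q TI uC1 sol).1.
- move=> H c d cd x cx p; cbv zeta; have [ac _ _] := cd.
  have [w e] := Pstar_III_k (loc_posdef g_metric ac cx) (loc_tangent_full pi_subm cd cx)
    (loc_transversal pi_subm transv cd cx) p.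
  have := H c d cd x cx w; rewrite /Psi; cbv zeta.
  suff -> : w *m loc_k g pi G c d x = p *m loc_Pstar_III g pi G c d x by [].
  exact: esym e.
- exact: (III_invariant g_metric pi_subm G_distr transv).
- move=> inv I u q TI uC1 sol p.
  split; last by move=> t It; exact: (solution_horizontal g_metric sol It).
  apply: (solution_hamiltonian g_metric pi_subm G_distr transv TI uC1 sol).
  move=> c d cd x cx p0.
  exact: (theta_of_invariance g_metric pi_subm G_distr transv cd p0 cx inv).
Qed.
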